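(* Let $Y$ be a Lévy process in $\mathbb{R}^d$ with generating triplet $(A,N,b)$ and with $h(0^+)=\infty$. Each of the following (mutually equivalent) conditions (C1)–(C4) is equivalent to (C8). (C1) The density $p(t,x)$ of $Y_t$ exists and there are $T_1\in(0,\infty]$, $c_1>0$ such that $\sup_{x\in\mathbb{R}^d}p(t,x)\le c_1[h^{-1}(1/t)]^{-d}$ for all $0<t<T_1$. (C2) There are $T_2\in(0,\infty]$, $c_2>0$ such that $\int_{\mathbb{R}^d}e^{-t\,\mathrm{Re}[\Psi(z)]}dz\le c_2[h^{-1}(1/t)]^{-d}$ for all $0<t<T_2$. (C3) There are $T_3\in(0,\infty]$, $c_3\in(0,1]$, $\alpha_3\in(0,2]$ such that $c_3\Psi^*(|x|)\le \mathrm{Re}[\Psi(x)]$ for all $|x|>1/T_3$, and $\Psi^*(\lambda r)\ge c_3\lambda^{\alpha_3}\Psi^*(r)$ for all $\lambda\ge1$, $r>1/T_3$. (C4) There are $T_4\in(0,\infty]$, $c_4\in[1,\infty)$ such that $\Psi^*(|x|)\le c_4\big(\langle x,Ax\rangle+\int_{|\langle x,z\rangle|<1}|\langle x,z\rangle|^2N(dz)\big)$ for all $|x|>1/T_4$. (C8) There are $T_8\in(0,\infty]$, $c_8\in[1,\infty)$ and $\alpha_8\in(0,2]$ such that for every (orthogonal) projection $\Pi_1$ on a one-dimensional linear subspace of $\mathbb{R}^d$, $$h(r)\le c_8\,h_1(r)\qquad\text{and}\qquad h(r)\le c_8\,\lambda^{\alpha_8}h(\lambda r),\qquad 0<\lambda\le1,\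 0<r<T_8,$$ where $h_1$ is the concentration function of the projected Lévy process $\Pi_1Y$, i.e. $$h_1(r)=r^{-2}\|\Pi_1A\Pi_1\|+\int_{\mathbb{R}^d}\Big(1\wedge\frac{|\Pi_1z|^2}{r^2}\Big)N(dz).$$
   Context: $Y=(Y_t)_{t\ge0}$ is a Lévy process in $\mathbb{R}^d$, $d\in\mathbb{N}$, with generating triplet $(A,N,b)$: $A$ is a symmetric non-negative definite $d\times d$ matrix, $b\in\mathbb{R}^d$, and $N$ is a Lévy measure (Borel measure with $N(\{0\})=0$, $\int(1\wedge|z|^2)N(dz)<\infty$). The characteristic exponent $\Psi$ is given by $\mathbb{E}e^{i\langle x,Y_t\rangle}=e^{-t\Psi(x)}$, $$\Psi(x)=\langle x,Ax\rangle-i\langle x,b\rangle-\int_{\mathbb{R}^d}\big(e^{i\langle x,z\rangle}-1-i\langle x,z\rangle\mathbf{1}_{|z|<1}\big)N(dz).$$ For $r>0$, $h(r)=r^{-2}\|A\|+\int_{\mathbb{R}^d}\big(1\wedge\frac{|x|^2}{r^2}\big)N(dx)$ (the concentration function) and $\Psi^*(r)=\sup_{|z|\le r}\mathrm{Re}[\Psi(z)]$. Standing assumption: $h(0^+)=\infty$; then $h$ is a continuous strictly decreasing bijection of $(0,\infty)$ onto $(0,\infty)$ with inverse $h^{-1}$. Convention: $1/\infty=0$. $p(t,\cdot)$ is the density of the law of $Y_t$ with respect to Lebesgue measure (if $e^{-t\Psi}$ is integrable, it is the continuous one given by Fourier inversion). *)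

(* Defs.v *)
From HB Require Import structures.
From mathcomp Require Import all_boot all_order all_algebra.
From mathcomp Require Import all_classical all_reals all_analysis.
From mathcomp Require Import complex.

Set Implicit Arguments.
Unset Strict Implicit.
Unset Printing Implicit Defensive.

Import Order.TTheory GRing.Theory Num.Theory.
Import numFieldNormedType.Exports.

Local Open Scope classical_set_scope.
Local Open Scope ring_scope.

(** R^n is 'cV[R]_n with its Borel sigma-algebra. *)
HB.instance Definition _ (R : realType) (n : nat) :=
  @isMeasurable.Build (sigma_display (open : set (set 'cV[R]_n))) 'cV[R]_n
    <<s (open : set (set 'cV[R]_n)) >>
    (@sigma_algebra0 _ setT _) (@sigma_algebraC _ _)
    (@sigma_algebra_bigcup _ setT _).

Section measurable_cV.
Context {R : realType}.

Lemma measurable_coord n (i : 'I_n) :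
  measurable_fun [set: 'cV[R]_n] (fun x => x i 0 : R).
Proof.
apply: (measurability _ (measurable_realfun.RGenOpens.measurableE R)) => //.
move=> _ [_ [a [b ->] <-]]; rewrite setTI.
apply: sub_sigma_algebra.
apply: (@open_comp 'cV[R]_n R (fun x => x i 0)) => [x _|]; last exact: interval_open.
exact: coord_continuous.
Qed.

Lemma measurable_fun_coord n d (T : measurableType d) (f : T -> 'cV[R]_n) :
  (forall i, measurable_fun [set: T] (fun w => f w i 0 : R)) ->
  measurable_fun [set: T] f.
Proof.
move=> mf _ Y mY; rewrite setTI.
move: Y mY; apply: smallest_sub.
  split=> [|A mA|F mF]/=.
  - by rewrite preimage_set0.
  - by rewrite setTD preimage_setC; exact: measurableC.
  - by rewrite preimage_bigcup; exact: bigcupT_measurable.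
move=> U oU.
pose box (q : 'cV[rat]_n * 'cV[rat]_n) : set 'cV[R]_n :=
  [set x | forall i, x i 0 \in `]ratr (q.1 i 0), ratr (q.2 i 0)[].
have -> : f @^-1` U = \bigcup_(q in [set q | box q `<=` U]) (f @^-1` box q).
  apply/seteqP; split=> [w /= Ufw|w [q qU]]; last by move=> /qU.
  have := oU; rewrite openE => /(_ _ Ufw)/nbhs_ballP[e /= e0 eU].
  have lo i : exists q : rat, ratr q \in `](f w i 0 - e), (f w i 0)[.
    by have /rat_in_itvoo : f w i 0 - e < f w i 0 by rewrite ltrBlDr ltrDl.
  have hi i : exists q : rat, ratr q \in `](f w i 0), (f w i 0 + e)[.
    by have /rat_in_itvoo : f w i 0 < f w i 0 + e by rewrite ltrDl.
  have [a aP] := boolp.choice lo; have [b bP] := boolp.choice hi.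
  exists (\col_i a i, \col_i b i) => /=.
    move=> x xab; apply: eU; split=> // i j; rewrite ord1.
    have := xab i; have := aP i; have := bP i.
    rewrite /= !mxE !in_itv/= /ball/= => /andP[_ be] /andP[ae _] /andP[ax xb].
    by rewrite distrC ltr_distl (lt_trans ae ax) (lt_trans xb be).
  move=> i; have := aP i; have := bP i.
  by rewrite /= !mxE !in_itv/= => /andP[-> _] /andP[_ ->].
rewrite bigcup_mkcond; apply: countable_bigcupT_measurable => // q.
case: ifPn => // _.
rewrite (_ : _ @^-1` _ = \big[setI/setT]_(i < n)
    ((fun w => f w i 0) @^-1` `]ratr (q.1 i 0), ratr (q.2 i 0)[)); last first.
  rewrite -bigcap_seq; apply/seteqP; split=> w /= wq i; first by move=> _; exact: wq.
  by apply: (wq i); rewrite /= mem_index_enum.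
apply: bigsetI_measurable => i _.
by rewrite -[X in measurable X]setTI; apply: mf => //; exact: measurable_itv.
Qed.

End measurable_cV.

Section lebesgue_cV.
Context {R : realType}.

Definition cV_cons n (xv : R * 'cV[R]_n) : 'cV[R]_n.+1 :=
  col_mx xv.1%:M xv.2 : 'cV[R]_(1 + n).

Definition cV_uncons n (v : 'cV[R]_n.+1) : R * 'cV[R]_n :=
  (v 0 0, @dsubmx _ 1 n 1 v).

Lemma cV_consK n : cancel (@cV_cons n) (@cV_uncons n).
Proof.
move=> [x v]; rewrite /cV_cons /cV_uncons /= col_mxKd; congr pair.
transitivity ((x%:M : 'M[R]_1) 0 0); last by rewrite mxE.
rewrite -[RHS](col_mxEu _ v) (_ : lshift n 0 = 0) //; exact/val_inj.
Qed.

Lemma measurable_cV_cons n : measurable_fun [set: R * 'cV[R]_n] (@cV_cons n).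
Proof.
apply: measurable_fun_coord => i.
have [j ->|j ->] := split_ordP (i : 'I_(1 + n)).
  rewrite (_ : (fun _ => _) = fst); first exact: measurable_fst.
  by apply/funext => -[x v]; rewrite [LHS](col_mxEu (x%:M : 'M[R]_1) v) ord1 mxE.
rewrite (_ : (fun _ => _) = (fun v : 'cV[R]_n => v j 0) \o snd).
  by apply: measurableT_comp; [exact: measurable_coord|exact: measurable_snd].
by apply/funext => -[x v]; rewrite [LHS](col_mxEd (x%:M : 'M[R]_1) v).
Qed.

Lemma measurable_cV_uncons n : measurable_fun [set: 'cV[R]_n.+1] (@cV_uncons n).
Proof.
apply: measurable_fun_pair; first exact: measurable_coord.
apply: measurable_fun_coord => i.
under eq_fun do rewrite mxE.
exact: measurable_coord.
Qed.

(** Iterated product of the one-dimensional Lebesgue measure; see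
    [lebesgue_cV_box]. *)
Fixpoint lebesgue_cV n : set 'cV[R]_n -> \bar R :=
  match n with
  | 0 => \d_(0 : 'cV[R]_0)
  | m.+1 => pushforward (@lebesgue_measure R \x @lebesgue_cV m)%E (@cV_cons m)
  end.

Section step.
Context n (mu : {sigma_finite_measure set 'cV[R]_n -> \bar R}).
Let nu : set 'cV[R]_n.+1 -> \bar R :=
  pushforward (@lebesgue_measure R \x mu)%E (@cV_cons n).
Let nu0 : nu set0 = 0%E.
Proof. by rewrite /nu /pushforward preimage_set0 measure0. Qed.
Let nu_ge0 A : (0 <= nu A)%E.
Proof. exact: (measure_ge0 (@lebesgue_measure R \x mu)%E). Qed.
Let nu_sigma_additive : semi_sigma_additive nu.
Proof.
exact: (@measure_semi_sigma_additive _ _ _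
  (measure_function_pushforward__canonical__measure_function_Measure
     (@lebesgue_measure R \x mu)%E (@measurable_cV_cons n))).
Qed.
HB.instance Definition _ := isMeasure.Build _ _ _ nu nu0 nu_ge0 nu_sigma_additive.
Let nu_sigma_finite : sigma_finite setT nu.
Proof.
have /sigma_finiteP[F [FT ndF Foo]] := sigma_finiteT (@lebesgue_measure R).
have /sigma_finiteP[G [GT ndG Goo]] := sigma_finiteT mu.
exists (fun k => @cV_uncons n @^-1` (F k `*` G k)).
  rewrite -preimage_bigcup (_ : \bigcup_k _ = setT) ?preimage_setT//.
  rewrite -setXTT FT GT predeqE => -[x y]; split; last first.
    by move=> [/= [k _ Fx] [l _ Gy]]; exists (maxn k l) => //; split;
      [move: x Fx; exact/subsetPset/ndF/leq_maxl
      |move: y Gy; exact/subsetPset/ndG/leq_maxr].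
  by move=> [k _ []/= ? ?]; split; exists k.
move=> k; have [mF Fk] := Foo k; have [mG Gk] := Goo k.
split.
  rewrite -[X in measurable X]setTI.
  by apply: measurable_cV_uncons => //; exact: measurableX.
rewrite /nu /pushforward -comp_preimage.
rewrite (_ : _ \o _ = id) ?preimage_id; last by apply/funext => x; exact: cV_consK.
by rewrite product_measure1E// lte_mul_pinfty// ge0_fin_numE.
Qed.
HB.instance Definition _ := Measure_isSigmaFinite.Build _ _ _ nu nu_sigma_finite.
Lemma lebesgue_cV_step :
  exists nu' : {sigma_finite_measure set 'cV[R]_n.+1 -> \bar R}, nu = nu'.
Proof. by exists nu. Qed.
End step.

Lemma lebesgue_cV_sfin n :
  exists mu : {sigma_finite_measure set 'cV[R]_n -> \bar R}, @lebesgue_cV n = mu.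
Proof.
elim: n => [|n [mu muE]]; first by exists \d_(0 : 'cV[R]_0).
by have [nu nuE] := lebesgue_cV_step mu; exists nu; rewrite /= muE nuE.
Qed.

Section instances.
Variable n : nat.
Let leb0 : @lebesgue_cV n set0 = 0%E.
Proof. by have [mu ->] := lebesgue_cV_sfin n; exact: measure0. Qed.
Let leb_ge0 A : (0 <= @lebesgue_cV n A)%E.
Proof. by have [mu ->] := lebesgue_cV_sfin n; exact: measure_ge0. Qed.
Let leb_sigma_additive : semi_sigma_additive (@lebesgue_cV n).
Proof. by have [mu ->] := lebesgue_cV_sfin n; exact: measure_semi_sigma_additive. Qed.
HB.instance Definition _ :=
  isMeasure.Build _ _ _ (@lebesgue_cV n) leb0 leb_ge0 leb_sigma_additive.
Let leb_sigma_finite : sigma_finite setT (@lebesgue_cV n).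
Proof. by have [mu ->] := lebesgue_cV_sfin n; exact: sigma_finiteT. Qed.
HB.instance Definition _ :=
  Measure_isSigmaFinite.Build _ _ _ (@lebesgue_cV n) leb_sigma_finite.
End instances.

Lemma measurable_box n (A : 'I_n -> set R) : (forall i, measurable (A i)) ->
  measurable [set x : 'cV[R]_n | forall i, A i (x i 0)].
Proof.
move=> mA; rewrite (_ : [set _ | _] = \big[setI/setT]_(i < n)
    ((fun x : 'cV[R]_n => x i 0) @^-1` A i)).
  apply: bigsetI_measurable => i _; rewrite -[X in measurable X]setTI.
  exact: measurable_coord.
rewrite -bigcap_seq; apply/seteqP; split=> x /= xA i; first by move=> _; exact: xA.
by apply: (xA i); rewrite /= mem_index_enum.
Qed.

Lemma lebesgue_cV_box n (A : 'I_n -> set R) : (forall i, measurable (A i)) ->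
  lebesgue_cV [set x : 'cV[R]_n | forall i, A i (x i 0)] =
  (\prod_(i < n) lebesgue_measure (A i))%E.
Proof.
elim: n A => [|n IH] A mA.
  by rewrite big_ord0 /lebesgue_cV/= diracE mem_set//= => -[].
rewrite big_ord_recl -IH//= /pushforward.
have [mu muE] := lebesgue_cV_sfin n.
have cons0 (x : R) (v : 'cV[R]_n) : cV_cons (x, v) ord0 0 = x.
  by have := cV_consK (x, v) => -[].
have consS (x : R) (v : 'cV[R]_n) i : cV_cons (x, v) (lift ord0 i) 0 = v i 0.
  rewrite -[RHS](col_mxEd (x%:M : 'M[R]_1) v) /cV_cons /=.
  by rewrite (_ : rshift 1 i = lift ord0 i) //; exact/val_inj.
rewrite (_ : _ @^-1` _ = A ord0 `*`
    [set x : 'cV[R]_n | forall i, A (lift ord0 i) (x i 0)]).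
  rewrite muE product_measure1E//; first exact: (mA ord0).
  by apply: (@measurable_box _ (fun i => A (lift ord0 i))) => i; exact: mA.
apply/seteqP; split=> -[x v] /=.
  move=> H; split; first by have := H ord0; rewrite cons0.
  by move=> i; have := H (lift ord0 i); rewrite consS.
move=> [Ax Av] i; have [j ->|->] := unliftP ord0 i; first by rewrite consS.
by rewrite cons0.
Qed.

End lebesgue_cV.
Arguments lebesgue_cV {R n}.

Section complex_valued.
Context {R : realType}.
Local Open Scope complex_scope.

Definition cexp (z : R[i]) : R[i] :=
  (expR (complex.Re z))%:C * (cos (complex.Im z) +i* sin (complex.Im z)).

Context d (T : measurableType d) (mu : {measure set T -> \bar R}).

Definition cintegrable (f : T -> R[i]) : Prop :=
  mu.-integrable setT (fun x => (complex.Re (f x))%:E) /\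
  mu.-integrable setT (fun x => (complex.Im (f x))%:E).

Definition cintegral (f : T -> R[i]) : R[i] :=
  (\int[mu]_x complex.Re (f x)) +i* (\int[mu]_x complex.Im (f x)).

End complex_valued.

Section euclidean.
Context {R : realType} {n : nat}.
Implicit Types (x y : 'cV[R]_n) (M : 'M[R]_n).

Definition dotp x y : R := \sum_(i < n) x i 0 * y i 0.

(** The norm [`|x|] of the library is the sup norm. *)
Definition enorm x : R := Num.sqrt (dotp x x).

Definition opnorm M : R := sup [set enorm (M *m x) | x in [set x | enorm x <= 1]].

(** Orthogonal projections onto one-dimensional subspaces. *)
Definition line_projection M : Prop :=
  [/\ M^T = M, M *m M = M & \rank M = 1%N].

End euclidean.

Section triplet.
Context {R : realType} {n : nat}.
Variables (A : 'M[R]_n) (N : {measure set 'cV[R]_n -> \bar R}) (b : 'cV[R]_n).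
Local Open Scope complex_scope.

Definition levy_measure : Prop :=
  N [set 0] = 0%E /\ (\int[N]_z (Num.min 1 (enorm z ^+ 2))%:E < +oo)%E.

Definition generating_triplet : Prop :=
  [/\ A^T = A, forall x, 0 <= dotp x (A *m x) & levy_measure].

Definition Psi (x : 'cV[R]_n) : R[i] :=
  (dotp x (A *m x))%:C - 'i * (dotp x b)%:C
  - cintegral N (fun z => cexp ('i * (dotp x z)%:C) - 1
      - 'i * (dotp x z * \1_[set y | enorm y < 1] z)%:C).

Definition RePsi (x : 'cV[R]_n) : R := complex.Re (Psi x).

(** For [r > 0] this is the supremum of a nonempty bounded set. *)
Definition Psi_star (r : R) : R := sup [set RePsi z | z in [set z | enorm z <= r]].

Definition concentration (r : R) : R :=
  r ^- 2 * opnorm A + \int[N]_x Num.min 1 (enorm x ^+ 2 / r ^+ 2).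

Definition concentration_proj (Pi : 'M[R]_n) (r : R) : R :=
  r ^- 2 * opnorm (Pi *m A *m Pi)
  + \int[N]_z Num.min 1 (enorm (Pi *m z) ^+ 2 / r ^+ 2).

(** The inverse of the restriction of [concentration] to ]0, +oo[. *)
Definition concentration_inv : R -> R :=
  'pinv_(fun=> 0) `]0, +oo[ concentration.

End triplet.

Section levy_process.
Context {R : realType} {n : nat} d (Omega : measurableType d).
Variables (P : probability Omega R) (Y : R -> {RV P >-> 'cV[R]_n}).

Definition mutually_independent k (X : 'I_k -> Omega -> 'cV[R]_n) : Prop :=
  forall B : 'I_k -> set 'cV[R]_n, (forall i, measurable (B i)) ->
    P [set w | forall i, B i (X i w)] = (\prod_(i < k) P (X i @^-1` B i))%E.

Definition cadlag (y : R -> 'cV[R]_n) : Prop :=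
  (forall t, 0 <= t -> y s @[s --> t^'+] --> y t) /\
  (forall t, 0 < t -> cvg (y s @[s --> t^'-])).

(** The values of [Y] at negative times are unconstrained and unused. *)
Record levy_process : Prop := {
  levy_start : {ae P, forall w, Y 0 w = 0} ;
  levy_independent_increments : forall (k : nat) (t : nat -> R),
    0 <= t 0%N -> (forall i, t i <= t i.+1) ->
    mutually_independent (fun (i : 'I_k) w => Y (t i.+1) w - Y (t i) w) ;
  levy_stationary_increments : forall s t : R, 0 <= s -> 0 <= t ->
    forall B, measurable B ->
      P [set w | B (Y (s + t) w - Y s w)] = P (Y t @^-1` B) ;
  levy_stochastic_continuity : forall t e : R, 0 <= t -> 0 < e ->
    P [set w | e < enorm (Y s w - Y t w)]
      @[s --> within [set s | 0 <= s] (nbhs t)] --> 0%E ;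
  levy_paths : {ae P, forall w, cadlag (fun t => Y t w)} }.

End levy_process.

Section conditions.
Context {R : realType} {n : nat} d (Omega : measurableType d).
Variables (P : probability Omega R) (Y : R -> {RV P >-> 'cV[R]_n}).
Variables (A : 'M[R]_n) (N : {measure set 'cV[R]_n -> \bar R}) (b : 'cV[R]_n).
Local Open Scope complex_scope.

Local Notation Psi := (Psi A N b).
Local Notation RePsi := (RePsi A N b).
Local Notation Psi_star := (Psi_star A N b).
Local Notation h := (concentration A N).
Local Notation h1 := (concentration_proj A N).
Local Notation hinv := (concentration_inv A N).

Definition has_exponent : Prop := forall (t : R) (x : 'cV[R]_n), 0 <= t ->
  cintegral P (fun w => cexp ('i * (dotp x (Y t w))%:C)) = cexp (- t%:C * Psi x).

(** [p t] is a density of [Y t], given by Fourier inversion (hence everywhere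
    determined) as soon as [exp (- t Psi)] is integrable. *)
Definition transition_density (p : R -> 'cV[R]_n -> R) : Prop :=
  forall t : R, 0 < t ->
  [/\ measurable_fun setT (p t), forall x, 0 <= p t x,
      forall B, measurable B ->
        P (Y t @^-1` B) = (\int[lebesgue_cV]_(x in B) (p t x)%:E)%E
    & cintegrable (@lebesgue_cV R n) (fun z => cexp (- t%:C * Psi z)) ->
      forall x, (p t x)%:C = ((2 * pi) ^- n)%:C *
        cintegral (@lebesgue_cV R n)
          (fun z => cexp (- 'i * (dotp x z)%:C) * cexp (- t%:C * Psi z))].

(** Thresholds are extended reals, with [+oo^-1 = 0]. *)

Definition C1 : Prop := exists p, transition_density p /\
  exists (T1 : \bar R) (c1 : R), (0 < T1)%E /\ 0 < c1 /\
  forall t : R, 0 < t -> (t%:E < T1)%E ->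
    (ereal_sup [set (p t x)%:E | x in setT] <= (c1 * (hinv t^-1) ^- n)%:E)%E.

Definition C2 : Prop := exists (T2 : \bar R) (c2 : R), (0 < T2)%E /\ 0 < c2 /\
  forall t : R, 0 < t -> (t%:E < T2)%E ->
    (\int[lebesgue_cV]_z (expR (- t * RePsi z))%:E
       <= (c2 * (hinv t^-1) ^- n)%:E)%E.

Definition C3 : Prop := exists (T3 : \bar R) (c3 alpha3 : R),
  (0 < T3)%E /\ 0 < c3 <= 1 /\ 0 < alpha3 <= 2 /\
  (forall x, (T3^-1 < (enorm x)%:E)%E -> c3 * Psi_star (enorm x) <= RePsi x) /\
  (forall lambda r : R, 1 <= lambda -> (T3^-1 < r%:E)%E ->
     c3 * lambda `^ alpha3 * Psi_star r <= Psi_star (lambda * r)).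

Definition C4 : Prop := exists (T4 : \bar R) (c4 : R), (0 < T4)%E /\ 1 <= c4 /\
  forall x, (T4^-1 < (enorm x)%:E)%E ->
    Psi_star (enorm x) <= c4 * (dotp x (A *m x)
      + \int[N]_(z in [set z | `|dotp x z| < 1]) `|dotp x z| ^+ 2).

Definition C8 : Prop := exists (T8 : \bar R) (c8 alpha8 : R),
  (0 < T8)%E /\ 1 <= c8 /\ 0 < alpha8 <= 2 /\
  forall Pi1 : 'M[R]_n, line_projection Pi1 ->
  forall lambda r : R, 0 < lambda <= 1 -> 0 < r -> (r%:E < T8)%E ->
    h r <= c8 * h1 Pi1 r /\ h r <= c8 * lambda `^ alpha8 * h (lambda * r).

End conditions.

(* Main.v *)
(** For a direction [x] let [K x = <x, A x> + \int min 1 (<x, z> ^ 2) dN]: it is the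
    concentration function, at [1 / |x|], of the projection on the line of [x].  Always
    [psi x <= 2 K x] with [psi = Re Psi], and [K x <= h (1 / |x|)].  Conversely averaging
    [1 - cos (s <x, z>)] over [s] in [0, 1] bounds [K x], hence [h], by [Psi_star]; so
    (C3), (C4) and (C8) all say that no direction is much weaker than [h] and that [h] has a
    positive lower scaling exponent.

    (C8) => (C2): [psi x] is bounded below by a multiple of [h (1 / |x|)], and the integral
    is summed over dyadic shells.  (C2) => (C8): [exp (- t psi)] is bounded below on a cube of
    side comparable with [1 / hinv (1 / t)], whose volume yields the scaling of [h]; a
    direction with small [K] would provide too many disjoint such cubes.  (C1) => (C2):
    [exp (- 2 t psi)] is the squared modulus of the characteristic function of [Y t], hence
    the characteristic function of a symmetrised variable, whose density is also bounded;
    tested against [exp (- e (|z_1| + ... + |z_n|))], its integral becomes a mean of products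
    of Cauchy kernels, and [e] tends to [0].  (C2) => (C1): the same regularisation gives
    Fourier inversion, the limit of the Cauchy kernels being computed exactly on boxes. *)

Require Import Defs.
From HB Require Import structures.
From mathcomp Require Import all_boot all_order all_algebra.
From mathcomp Require Import all_classical all_reals all_analysis.
From mathcomp Require Import ring lra complex measurable_realfun.

Set Implicit Arguments.
Unset Strict Implicit.
Unset Printing Implicit Defensive.

Import Order.TTheory GRing.Theory Num.Theory.
Import numFieldNormedType.Exports.

Local Open Scope classical_set_scope.
Local Open Scope ring_scope.

(** * Euclidean norm and operator norm *)

(** What links scaling to (C4) is the truncated quantity [U]: dilating [x] by [s] changes the jump
    part of [K] only through a bounded window of [<x, z>], so [K (s x) - K x] is at most a multiple
    of [U x] and at least a multiple of [U (s x)]. Hence growth of [K] forces a large [U], and a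
    large [U] forces growth. The function [h] decays at most quadratically in any case; only its
    lower exponent carries information, and where it is not given it comes from iterating a one-step
    gain along a geometric sequence.

    Symmetrisation doubles the time, so a bound on the density controls the integral of (C2) at
    [2 t]; the cube argument makes [hinv] doubling and so recovers the right time.

    Laplace weights have transforms with elementary primitives. Oscillating integrands are carried
    as [1 + cos], so that Tonelli applies before anything is known to be integrable, and a phase
    [c], equal to 0 or [- pi / 2], treats cosine and sine together. In the inversion the faces of a
    box might carry mass of the law; equality is therefore reached on open boxes, exhausted from
    inside. *)

Section euclid.
Context {R : realType} {n : nat}.
Implicit Types (x y z v : 'cV[R]_n) (M : 'M[R]_n) (a : R).

Lemma dotpE x y : dotp x y = (x^T *m y) 0 0.
Proof. by rewrite mxE; apply: eq_bigr => i _; rewrite mxE. Qed.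

Lemma dotpC x y : dotp x y = dotp y x.
Proof. by apply: eq_bigr => i _; rewrite mulrC. Qed.

Lemma dotpDr x y z : dotp x (y + z) = dotp x y + dotp x z.
Proof. by rewrite -big_split; apply: eq_bigr => i _; rewrite mxE mulrDr. Qed.

Lemma dotpDl x y z : dotp (y + z) x = dotp y x + dotp z x.
Proof. by rewrite dotpC dotpDr !(dotpC x). Qed.

Lemma dotpZr a x y : dotp x (a *: y) = a * dotp x y.
Proof. by rewrite mulr_sumr; apply: eq_bigr => i _; rewrite mxE mulrCA. Qed.

Lemma dotpZl a x y : dotp (a *: x) y = a * dotp x y.
Proof. by rewrite dotpC dotpZr dotpC. Qed.

Lemma dotp0l y : dotp 0 y = 0.
Proof. by rewrite -(scale0r y) dotpZl mul0r. Qed.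

Lemma dotpNr x y : dotp x (- y) = - dotp x y.
Proof. by rewrite -scaleN1r dotpZr mulN1r. Qed.

Lemma dotp_ge0 x : 0 <= dotp x x.
Proof. by apply: sumr_ge0 => i _; rewrite -expr2 sqr_ge0. Qed.

Lemma enorm_ge0 x : 0 <= enorm x.
Proof. exact: sqrtr_ge0. Qed.

Lemma sqr_enorm x : enorm x ^+ 2 = dotp x x.
Proof. by rewrite sqr_sqrtr// dotp_ge0. Qed.

Lemma enorm_eq0 x : (enorm x == 0) = (x == 0).
Proof.
apply/eqP/eqP => [x0|->]; last by rewrite /enorm dotp0l sqrtr0.
apply/colP => i; rewrite mxE.
have := sqr_enorm x; rewrite x0 expr0n/= => /esym /eqP.
rewrite psumr_eq0 => [/allP/(_ i)|j _]; last by rewrite -expr2 sqr_ge0.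
by rewrite mem_index_enum => /(_ isT)/=; rewrite mulf_eq0 orbb => /eqP.
Qed.

Lemma enorm_gt0 x : (0 < enorm x) = (x != 0).
Proof. by rewrite lt_def enorm_ge0 andbT enorm_eq0. Qed.

Lemma enormZ a x : enorm (a *: x) = `|a| * enorm x.
Proof.
rewrite /enorm dotpZl dotpZr mulrA -expr2 sqrtrM ?sqr_ge0//.
by rewrite sqrtr_sqr.
Qed.

Lemma form_cauchy_schwarz M x y : M^T = M ->
  (forall z, 0 <= dotp z (M *m z)) ->
  dotp x (M *m y) ^+ 2 <= dotp x (M *m x) * dotp y (M *m y).
Proof.
move=> Ms M0.
have sym u w : dotp u (M *m w) = dotp w (M *m u).
  rewrite !dotpE (_ : u^T *m (M *m w) = (w^T *m (M *m u))^T) ?mxE//.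
  by rewrite !trmx_mul trmxK Ms mulmxA.
have P s t : 0 <= s ^+ 2 * dotp x (M *m x) + 2 * s * t * dotp x (M *m y)
                  + t ^+ 2 * dotp y (M *m y).
  have := M0 (s *: x + t *: y).
  rewrite mulmxDr -!scalemxAr !(dotpDl, dotpDr, dotpZl, dotpZr) (sym y x).
  by move=> /le_trans; apply; rewrite le_eqVlt; apply/orP; left; apply/eqP; ring.
set a := dotp x (M *m x) in P *; set c := dotp y (M *m y) in P *.
set b := dotp x (M *m y) in P *.
have a0 : 0 <= a := M0 x.
have [a_0|an] := eqVneq a 0.
  have c0 : 0 <= c := M0 y.
  rewrite a_0 mul0r; rewrite leNgt; apply/negP => b0.
  (* With [a = 0] the form at [s x + t y] is affine in [s], so a nonzero [b] lets it become
     negative; this choice gives [- b ^ 4 (c + 2)]. *)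
  have := P (- (c + 1) * b) (b ^+ 2); rewrite a_0 mulr0 add0r.
  rewrite leNgt => /negP; apply.
  have -> : 2 * (- (c + 1) * b) * b ^+ 2 * b + (b ^+ 2) ^+ 2 * c
     = - (b ^+ 2 * b ^+ 2) * (c + 2) by ring.
  by rewrite mulNr oppr_lt0; apply: mulr_gt0; [exact: mulr_gt0|lra].
(* The minimiser of the quadratic polynomial up to scaling: the value factors as
   [a (a c - b ^ 2)]. *)
have := P (- b) a.
have -> : (- b) ^+ 2 * a + 2 * - b * a * b + a ^+ 2 * c = a * (a * c - b ^+ 2) by ring.
by rewrite pmulr_rge0 ?subr_ge0// lt_def an a0.
Qed.

Lemma dotp_le x y : `|dotp x y| <= enorm x * enorm y.
Proof.
rewrite -ler_sqr ?nnegrE ?normr_ge0 ?mulr_ge0 ?enorm_ge0//.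
rewrite exprMn !sqr_enorm real_normK ?num_real//.
have := @form_cauchy_schwarz 1%:M x y; rewrite !mul1mx trmx1; apply => // z.
by rewrite mul1mx dotp_ge0.
Qed.

Lemma normr_coord_le x (i : 'I_n) : `|x i 0| <= enorm x.
Proof.
rewrite -ler_sqr ?nnegrE ?normr_ge0 ?enorm_ge0// real_normK ?num_real//.
rewrite sqr_enorm /dotp (bigD1 i)//= -expr2 lerDl.
by apply: sumr_ge0 => j _; rewrite -expr2 sqr_ge0.
Qed.

Lemma enorm_le_coord x a : 0 <= a -> (forall i, `|x i 0| <= a) ->
  enorm x <= n%:R * a.
Proof.
move=> a0 xa; rewrite -ler_sqr ?nnegrE ?mulr_ge0 ?enorm_ge0// sqr_enorm.
have : dotp x x <= n%:R * a ^+ 2.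
  rewrite -[n in n%:R]card_ord -sum1_card natr_sum mulr_suml; apply: ler_sum => i _.
  by rewrite mul1r -expr2 -(@real_normK _ (x i 0)) ?num_real// ler_sqr ?nnegrE ?normr_ge0.
move=> /le_trans; apply; rewrite exprMn ler_wpM2r ?sqr_ge0//.
by rewrite -natrX ler_nat; have [->//|n0] := posnP n; rewrite -{1}(expn1 n) leq_pexp2l.
Qed.

Definition bvec (i : 'I_n) : 'cV[R]_n := delta_mx i 0.

Lemma dotp_bvec i x : dotp (bvec i) x = x i 0.
Proof.
rewrite /dotp (bigD1 i)//= big1 ?addr0 ?mxE ?eqxx ?mul1r// => j /negPf ji.
by rewrite mxE ji mul0r.
Qed.

Lemma enorm_bvec i : enorm (bvec i) = 1.
Proof. by rewrite /enorm dotp_bvec mxE !eqxx sqrtr1. Qed.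

Lemma mul_bvec M i : M *m bvec i = col i M.
Proof. by rewrite colE. Qed.

Lemma dotp_mxE M i j : dotp (bvec i) (M *m bvec j) = M i j.
Proof. by rewrite dotp_bvec mul_bvec mxE. Qed.

Lemma rank1_mulmx M : \rank M = 1%N ->
  exists (c : 'cV[R]_n) (r : 'rV[R]_n), M = c *m r.
Proof.
have: M = col_base M *m row_base M by rewrite mulmx_base.
move: (col_base M) (row_base M); move: (\rank M) => k c r Mcr k1.
by subst k; exists c, r.
Qed.

Lemma mulmx_row_col v x : v *m v^T *m x = dotp v x *: v.
Proof. by rewrite -mulmxA [v^T *m x]mx11_scalar -dotpE mul_mx_scalar. Qed.

(** Replaces projections by unit directions. A rank one matrix is a column times a row; the column
    can be rescaled to a unit vector [v] fixed by [M], and then the row equals [v^T M], which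
    symmetry turns into [(M v)^T = v^T]. *)
Lemma line_projectionP M : line_projection M <->
  exists2 v, enorm v = 1 & M = v *m v^T.
Proof.
split=> [[Ms Mi Mr]|[v v1 ->]]; last first.
  have vv : dotp v v = 1 by rewrite -sqr_enorm v1 expr1n.
  split; first by rewrite trmx_mul trmxK.
    by rewrite mulmxA mulmx_row_col vv scale1r.
  apply/eqP; rewrite eqn_leq (leq_trans (mxrankM_maxl _ _)) ?rank_leq_col//=.
  rewrite lt0n mxrank_eq0; apply: contra_eq_neq vv => vv0.
  have : dotp v v *: v = 0 by rewrite -mulmx_row_col vv0 mul0mx.
  move=> /eqP; rewrite scaler_eq0 orbC => /orP[/eqP->|/eqP ->];
    by rewrite ?dotp0l eq_sym oner_eq0.
have [c [r Mcr]] := rank1_mulmx Mr.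
have [u Mu0] : exists u : 'cV_n, M *m u != 0.
  have: M != 0 by rewrite -mxrank_eq0 Mr.
  apply: contraPP => /forallNP M0; apply/negP; rewrite negbK; apply/eqP/matrixP => i j.
  rewrite -dotp_mxE; have /negP/negPn/eqP -> := M0 (bvec j).
  by rewrite dotpC dotp0l mxE.
pose v := (enorm (M *m u))^-1 *: (M *m u).
have w0 : 0 < enorm (M *m u) by rewrite enorm_gt0.
have v1 : enorm v = 1 by rewrite enormZ ger0_norm ?invr_ge0 ?ltW// mulVf ?gt_eqF.
have Mv : M *m v = v by rewrite /v -scalemxAr mulmxA Mi.
exists v => //.
pose s := (r *m v) 0 0.
have vE : v = s *: c.
  by rewrite -{1}Mv Mcr -mulmxA [r *m v]mx11_scalar mul_mx_scalar.
have s0 : s != 0.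
  apply/eqP => s0; move: v1; rewrite vE s0 scale0r => /eqP.
  by rewrite /enorm dotp0l sqrtr0 eq_sym oner_eq0.
have Mvr : M = v *m (s^-1 *: r).
  by rewrite vE -scalemxAl -scalemxAr scalerA mulfV// scale1r.
have vTv : v^T *m v = 1%:M.
  by apply/matrixP => i j; rewrite !ord1 -dotpE -sqr_enorm v1 expr1n mxE.
have rE : s^-1 *: r = v^T *m M.
  by rewrite Mvr mulmxA vTv mul1mx.
rewrite {1}Mvr rE; congr (_ *m _).
by apply: trmx_inj; rewrite trmx_mul trmxK Ms Mv.
Qed.

Lemma opnorm_has_ubound M :
  has_ubound [set enorm (M *m x) | x in [set x | enorm x <= 1]].
Proof.
exists (n%:R * \sum_i enorm (row i M)^T) => _ [x /= x1 <-].
apply: enorm_le_coord => [|i]; first by apply: sumr_ge0 => *; exact: enorm_ge0.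
have -> : (M *m x) i 0 = dotp (row i M)^T x.
  by rewrite mxE; apply: eq_bigr => j _; rewrite !mxE.
apply: le_trans (dotp_le _ _) _.
apply: (@le_trans _ _ (enorm (row i M)^T)).
  by rewrite ler_piMr// enorm_ge0.
rewrite (bigD1 i)//= lerDl; apply: sumr_ge0 => *; exact: enorm_ge0.
Qed.

Lemma opnorm_ub M x : enorm x <= 1 -> enorm (M *m x) <= opnorm M.
Proof. by move=> x1; apply: ub_le_sup; [exact: opnorm_has_ubound|exists x]. Qed.

Lemma opnorm_ge0 M : 0 <= opnorm M.
Proof.
apply: le_trans (@opnorm_ub M 0 _); first exact: enorm_ge0.
by rewrite /enorm dotp0l sqrtr0.
Qed.

Lemma opnorm_le M a : (forall x, enorm x <= 1 -> enorm (M *m x) <= a) ->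
  opnorm M <= a.
Proof.
move=> Ma; apply: ge_sup; last by move=> _ [x /= x1 <-]; exact: Ma.
by exists (enorm (M *m 0)), 0 => //=; rewrite /enorm dotp0l sqrtr0.
Qed.

Lemma form_le_opnorm M x : dotp x (M *m x) <= opnorm M * enorm x ^+ 2.
Proof.
have [->|x0] := eqVneq x 0; first by rewrite dotp0l mulr_ge0 ?opnorm_ge0 ?sqr_ge0.
have e0 : 0 < enorm x by rewrite enorm_gt0.
apply: le_trans (ler_norm _) _; apply: le_trans (dotp_le _ _) _.
rewrite expr2 mulrA mulrC ler_wpM2r ?enorm_ge0//.
rewrite -ler_pdivrMr// mulrC -[X in X^-1]ger0_norm ?enorm_ge0// -normfV -enormZ scalemxAr.
by apply: opnorm_ub; rewrite enormZ normfV ger0_norm ?enorm_ge0// mulVf ?gt_eqF.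
Qed.

(** Only coordinate vectors will be tested against the form, so the operator norm has to be read off
    the diagonal: by Cauchy-Schwarz every entry is at most the geometric mean of two diagonal
    entries, hence at most the trace. *)
Lemma opnorm_le_trace M : M^T = M -> (forall z, 0 <= dotp z (M *m z)) ->
  opnorm M <= n%:R * (n%:R * \sum_i dotp (bvec i) (M *m bvec i)).
Proof.
move=> Ms M0; set t := \sum_i _.
have t0 : 0 <= t by apply: sumr_ge0.
have Mt i : M i i <= t.
  by rewrite -dotp_mxE /t (bigD1 i)//= lerDl; apply: sumr_ge0.
have Mij i j : `|M i j| <= t.
  rewrite -ler_sqr ?nnegrE// real_normK ?num_real//.
  have := form_cauchy_schwarz (bvec i) (bvec j) Ms M0; rewrite !dotp_mxE.
  by move=> /le_trans; apply; rewrite expr2 ler_pM// -dotp_mxE.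
apply: opnorm_le => x x1; apply: enorm_le_coord; first by rewrite mulr_ge0.
move=> i; rewrite mxE; apply: le_trans (ler_norm_sum _ _ _) _.
rewrite -[n in n%:R]card_ord -sum1_card natr_sum mulr_suml; apply: ler_sum => j _.
rewrite mul1r normrM -[leRHS]mulr1 ler_pM// (le_trans _ x1)//.
exact: normr_coord_le.
Qed.

Lemma line_projection_conj v M :
  v *m v^T *m M *m (v *m v^T) = dotp v (M *m v) *: (v *m v^T).
Proof.
have E : v^T *m M *m v = (dotp v (M *m v))%:M.
  by rewrite dotpE mulmxA; exact: mx11_scalar.
rewrite mulmxA -[v *m v^T *m M]mulmxA -[v *m _ *m v]mulmxA E.
by rewrite mul_mx_scalar -scalemxAl.
Qed.

Lemma opnorm_line v a : 0 <= a -> enorm v = 1 -> opnorm (a *: (v *m v^T)) = a.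
Proof.
move=> a0 v1; apply/eqP; rewrite eq_le; apply/andP; split.
  apply: opnorm_le => x x1; rewrite -scalemxAl mulmx_row_col !enormZ v1 mulr1.
  rewrite ger0_norm// ler_piMr// (le_trans (dotp_le _ _))// v1 mul1r.
  exact: x1.
have := @opnorm_ub (a *: (v *m v^T)) v; rewrite v1 lexx => /(_ isT); apply: le_trans.
rewrite -scalemxAl mulmx_row_col -sqr_enorm v1 expr1n scale1r enormZ v1 mulr1.
exact: ler_norm.
Qed.

End euclid.

(** * Elementary inequalities for the cosine *)

Section cosine.
Context {R : realType}.
Implicit Types (u v a b s : R).

Lemma sin_mvt u : 0 <= u -> exists2 c, 0 <= c <= u & sin u = cos c * u.
Proof.
move=> u0; have [|c cu] := @MVT_segment R sin cos 0 u u0.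
  exact/continuous_subspaceT/continuous_sin.
by rewrite sin0 !subr0 => ->; exists c => //; move: cu; rewrite in_itv.
Qed.

Lemma normr_sin_le u : `|sin u| <= `|u|.
Proof.
wlog u0 : u / 0 <= u => [H|].
  have [/H//|u0] := leP 0 u.
  by rewrite -normrN -(normrN u) -sinN H// oppr_ge0 ltW.
have [c _ ->] := sin_mvt u0.
by rewrite normrM ler_piMl// cos_max.
Qed.

Lemma subr1_cos u : 1 - cos u = 2 * sin (u / 2) ^+ 2.
Proof.
rewrite (_ : cos u = cos ((u / 2) *+ 2)); last by congr cos; rewrite mulr2n; lra.
by rewrite cos_mulr2n; have := cos2Dsin2 (u / 2); lra.
Qed.

Lemma subr1_cos_ge0 u : 0 <= 1 - cos u.
Proof. by rewrite subr_ge0 cos_le1. Qed.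

Lemma subr1_cos_le_sqr u : 1 - cos u <= u ^+ 2 / 2.
Proof.
rewrite subr1_cos; have : sin (u / 2) ^+ 2 <= (u / 2) ^+ 2.
  rewrite -(@real_normK _ (sin _)) ?num_real// -[leRHS]real_normK ?num_real//.
  by rewrite ler_sqr ?nnegrE// normr_sin_le.
by rewrite exprMn; lra.
Qed.

Lemma subr1_cos_le u : 1 - cos u <= 2 * Num.min 1 (u ^+ 2).
Proof.
have := subr1_cos_le_sqr u; have := cos_geN1 u; have := sqr_ge0 u.
by case: (leP 1 (u ^+ 2)); lra.
Qed.

(** The constant is [2 (1/2)^2 (1/2)^2]: in [1 - cos u = 2 sin (u / 2) ^ 2] the mean value theorem
    writes the sine as [cos c] times [u / 2], and [cos c >= 1 / 2] for [c] in [0, 1]. *)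
Lemma sqr_le_subr1_cos u : `|u| <= 2 -> u ^+ 2 / 8 <= 1 - cos u.
Proof.
wlog u0 : u / 0 <= u => [H|].
  have [/H//|u0] := leP 0 u; rewrite -normrN -cosN -sqrrN => /H; apply.
  by rewrite oppr_ge0 ltW.
rewrite ger0_norm// => u2; rewrite subr1_cos.
have [|c /andP[c0 cu] ->] := @sin_mvt (u / 2); first by lra.
have cc : 1 / 2 <= cos c.
  have := subr1_cos_le_sqr c; have : c ^+ 2 <= 1; last by lra.
  by rewrite expr_le1//; lra.
have : (1 / 2) ^+ 2 <= cos c ^+ 2 by rewrite ler_sqr ?nnegrE; lra.
rewrite exprMn => h; have -> : u ^+ 2 / 8 = 2 * ((1 / 2) ^+ 2 * (u / 2) ^+ 2) by field.
by rewrite ler_wpM2l// [leRHS]exprMn ler_wpM2r ?sqr_ge0//; move: h; rewrite exprMn.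
Qed.

(** With half angles this is the addition formula for the sine, cosines bounded by 1, and
    [(p + q) ^ 2 <= 2 p ^ 2 + 2 q ^ 2]. It makes the real part of the exponent nearly subadditive,
    which controls it on translated cubes. *)
Lemma subr1_cosD_le a b : 1 - cos (a + b) <= 2 * (1 - cos a) + 2 * (1 - cos b).
Proof.
rewrite !subr1_cos [(a + b) / 2]mulrDl sinD.
set p := sin (a / 2); set q := sin (b / 2).
have H (x y : R) : `|x| <= 1 -> x ^+ 2 * y ^+ 2 <= y ^+ 2.
  move=> x1; rewrite ler_piMl ?sqr_ge0//.
  by rewrite -(@real_normK _ x) ?num_real// expr_le1.
have := H _ p (cos_max (b / 2)); have := H _ q (cos_max (a / 2)).
set c := cos (b / 2); set c' := cos (a / 2).
have := sqr_ge0 (p * c - c' * q).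
rewrite sqrrB sqrrD !exprMn => h1 h2 h3; lra.
Qed.

Lemma measurable_cos : measurable_fun [set: R] (@cos R).
Proof. by apply: continuous_measurable_fun; exact: continuous_cos. Qed.

Lemma measurable_sin : measurable_fun [set: R] (@sin R).
Proof. by apply: continuous_measurable_fun; exact: continuous_sin. Qed.

Lemma integral_cos01 u : u != 0 ->
  (\int[lebesgue_measure]_(s in `[0%R, 1%R]) (1 - cos (s * u))%:E
   = (1 - sin u / u)%:E)%E.
Proof.
move=> u0.
have dF (x : R) : is_derive x 1 (fun s => s - sin (s * u) / u) (1 - cos (x * u)).
  apply: is_derive_eq.
  by rewrite !scaler0 !add0r /GRing.scale/= mulr1 mulrCA mulVf ?mulr1.
rewrite (@continuous_FTC2 _ _ (fun s => s - sin (s * u) / u)) ?ltr01//.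
- by rewrite -EFinB mul1r mul0r sin0 mul0r subrr subr0.
- apply: continuous_subspaceT => x.
  apply: cvgB; first exact: cvg_cst.
  apply: continuous_comp; last exact: continuous_cos.
  by apply: cvgMl; exact: cvg_id.
- have cF x : {for x, continuous (fun s => s - sin (s * u) / u)}.
    by apply/differentiable_continuous/derivable1_diffP; exact: ex_derive.
  split.
  + by move=> x _; exact: ex_derive.
  + exact/cvg_at_right_filter/cF.
  + exact/cvg_at_left_filter/cF.
- by move=> x _; rewrite derive1E derive_val.
Qed.

(** Small [u]: on [1/2, 1] the integrand is at least [u ^ 2 / 32], which gives [u ^ 2 / 64]. Large
    [u]: the integral is [1 - sin u / u], at least 1/2. The indicator sits in the integrand, over
    the whole line, so that the bound can be integrated against [N] by Tonelli. *)
Lemma min1_le_integral_cos u :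
  ((Num.min 1 (u ^+ 2))%:E <=
   64%:E * \int[lebesgue_measure]_s ((1 - cos (s * u)) * \1_`[0%R, 1%R] s)%:E)%E.
Proof.
rewrite (_ : integral _ _ _ =
    \int[lebesgue_measure]_(s in `[0%R, 1%R]) (1 - cos (s * u))%:E)%E; last first.
  rewrite [RHS]integral_mkcond; apply: eq_integral => s _.
  by rewrite patchE indicE; case: (s \in _); rewrite ?mulr1 ?mulr0.
have [u2|u2] := leP `|u| 2.
  apply: (@le_trans _ _ (64%:E * \int[lebesgue_measure]_(s in `[(1/2)%R, 1%R])
     (u ^+ 2 / 32)%:E)%E).
    rewrite integral_cst//= lebesgue_measure_itv/= lte_fin.
    rewrite ifT; last by lra.
    rewrite -EFinD -!EFinM lee_fin ge_min; apply/orP; right.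
    by lra.
  rewrite lee_pmul2l// ?lte_fin//.
  have mf (D : set R) : measurable_fun D (EFin \o (fun s : R => 1 - cos (s * u))).
    apply/measurable_EFinP/measurable_funTS; apply: measurable_funB => //.
    by apply: (measurableT_comp measurable_cos); exact: measurable_funM.
  apply: (@le_trans _ _ (\int[lebesgue_measure]_(s in `[(1/2)%R, 1%R])
     (1 - cos (s * u))%:E)%E).
    apply: ge0_le_integral => //.
    + by move=> s _; rewrite lee_fin divr_ge0// sqr_ge0.
    + exact: mf.
    + move=> s /=; rewrite in_itv/= => /andP[s1 s2]; rewrite lee_fin.
      apply: le_trans (@sqr_le_subr1_cos (s * u) _).
        rewrite exprMn; have : (1/2) ^+ 2 <= s ^+ 2 by rewrite ler_sqr ?nnegrE; lra.
        move=> /(ler_wpM2r (sqr_ge0 u)); lra.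
      rewrite normrM (ger0_norm (le_trans _ s1)); last by lra.
      apply: le_trans u2; rewrite ler_piMl//.
  apply: ge0_subset_integral => //.
  - exact: mf.
  - move=> s /=; rewrite !in_itv/= => /andP[s1 ->]; rewrite andbT; lra.
have u0 : u != 0 by rewrite -normr_gt0; lra.
rewrite integral_cos01// -EFinM lee_fin ge_min; apply/orP; left.
have : sin u / u <= 1 / 2; last by lra.
apply: le_trans (ler_norm _) _; rewrite normrM normfV ler_pdivrMr ?normr_gt0//.
by have := sin_max u; lra.
Qed.

End cosine.

(** * The real part of the exponent *)

Lemma measurable_fun_dotp {R : realType} n d (T : measurableType d)
    (f g : T -> 'cV[R]_n) :
  measurable_fun setT f -> measurable_fun setT g ->
  measurable_fun setT (fun t => dotp (f t) (g t)).
Proof.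
move=> mf mg; apply: measurable_sum => i; apply: measurable_funM.
- exact: (measurableT_comp (measurable_coord i) mf).
- exact: (measurableT_comp (measurable_coord i) mg).
Qed.

Lemma measurable_dotp {R : realType} n (x : 'cV[R]_n) :
  measurable_fun setT (dotp x).
Proof. by apply: measurable_fun_dotp; [exact: measurable_cst|exact: measurable_id]. Qed.

Lemma measurable_sqr_enorm {R : realType} n :
  measurable_fun setT (fun z : 'cV[R]_n => enorm z ^+ 2).
Proof.
under eq_fun do rewrite sqr_enorm.
by apply: measurable_fun_dotp; exact: measurable_id.
Qed.

Section min1_sqr.
Context {R : realType}.
Implicit Types (u a b c : R).

Lemma min1_sqr_ge0 u : 0 <= Num.min 1 (u ^+ 2).
Proof. by rewrite le_min ler01 sqr_ge0. Qed.

Lemma min1_le_scale a b c : 0 <= b -> 1 <= a -> c <= a * b ->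
  Num.min 1 c <= a * Num.min 1 b.
Proof.
move=> b0 a1 cab; have [b1|b1] := leP 1 b.
  by rewrite ge_min mulr1 a1.
by rewrite ge_min cab orbT.
Qed.

(** The jump integrand of (C4) in the scalar variable [u = <x, z>]; the product with an indicator
    makes it measurable by composition. *)
Definition trunc_sqr u : R := u ^+ 2 * \1_[set` `]-1, 1[] u.

Lemma trunc_sqrE u : trunc_sqr u = if `|u| < 1 then u ^+ 2 else 0.
Proof.
rewrite /trunc_sqr indicE mem_setE in_itv/= -ltr_norml.
by case: ifP; rewrite ?mulr1 ?mulr0.
Qed.

Lemma measurable_trunc_sqr : measurable_fun setT trunc_sqr.
Proof.
apply: measurable_funM; first exact: measurable_funX.
by apply: measurable_indic; exact: measurable_itv.
Qed.

Lemma trunc_sqr_le u : trunc_sqr u <= Num.min 1 (u ^+ 2).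
Proof.
rewrite trunc_sqrE; case: ifPn => [u1|_]; last exact: min1_sqr_ge0.
by rewrite le_min lexx andbT -real_normK ?num_real// expr_le1// ltW.
Qed.

Lemma trunc_sqr_ge0 u : 0 <= trunc_sqr u.
Proof. by rewrite trunc_sqrE; case: ifP => // _; exact: sqr_ge0. Qed.

Lemma trunc_sqr_le_cos u : trunc_sqr u <= 8 * (1 - cos u).
Proof.
rewrite trunc_sqrE; case: ifPn => [u1|_].
  have := @sqr_le_subr1_cos _ u; have : `|u| <= 2 by lra.
  by move=> -> /(_ isT); lra.
by have := subr1_cos_ge0 u; lra.
Qed.

(** Dilation by [a] alters [min 1 (u ^ 2)] only while [|u| < 1]; beyond, both minima are already 1.
    This is the pointwise, discrete form of the truncated second moment being the rate of change of
    [K] along a ray. *)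
Lemma min1_sqr_incr_le a u : 1 <= a ->
  Num.min 1 ((a * u) ^+ 2) <= Num.min 1 (u ^+ 2) + (a ^+ 2 - 1) * trunc_sqr u.
Proof.
move=> a1; have aa : 1 <= a ^+ 2 by rewrite expr_ge1//; lra.
rewrite trunc_sqrE; case: ifPn => [u1|]; rewrite ?mulr0 ?addr0 -?leNgt.
  rewrite (@min_r _ _ 1 (u ^+ 2)); last by rewrite -real_normK ?num_real// expr_le1// ltW.
  by rewrite ge_min exprMn; apply/orP; right; lra.
by move=> u1; rewrite (@min_l _ _ _ (u ^+ 2)) ?ge_min ?lexx// -real_normK ?num_real// expr_ge1.
Qed.

(** Here the window is imposed after the dilation: for [|a u| < 1] neither minimum has saturated,
    and the difference is exactly [(1 - a ^ -2) (a u) ^ 2]. *)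
Lemma min1_sqr_incr_ge a u : 1 <= a ->
  (1 - a ^- 2) * trunc_sqr (a * u) + Num.min 1 (u ^+ 2) <= Num.min 1 ((a * u) ^+ 2).
Proof.
move=> a1; have aa : 1 <= a ^+ 2 by rewrite expr_ge1//; lra.
have a0 : a ^+ 2 != 0 by lra.
rewrite trunc_sqrE; case: ifPn => [u1|]; rewrite ?mulr0 ?add0r -?leNgt.
  rewrite (@min_r _ _ 1 ((a * u) ^+ 2)); last first.
    by rewrite -real_normK ?num_real// expr_le1// ltW.
  have -> : (1 - a ^- 2) * (a * u) ^+ 2 = (a * u) ^+ 2 - u ^+ 2 by field; lra.
  by rewrite -lerBrDl opprB addrC subrK ge_min lexx orbT.
move=> u1; rewrite (@min_l _ _ _ ((a * u) ^+ 2)) ?ge_min ?lexx//.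
by rewrite -real_normK ?num_real// expr_ge1.
Qed.

End min1_sqr.

Section levy.
Context {R : realType} {n : nat}.
Variables (A : 'M[R]_n) (N : {measure set 'cV[R]_n -> \bar R}) (b : 'cV[R]_n).
Hypothesis ANb : generating_triplet A N.
Implicit Types (x y z : 'cV[R]_n) (r s : R) (f g k : 'cV[R]_n -> R).

(** The bound matches the integrability condition of a Lévy measure. It has to be tracked because
    real-valued integrals are linear and monotone only on integrable functions. *)
Definition levy_dominated f : Prop := measurable_fun setT f /\
  exists C, forall z, `|f z| <= C * Num.min 1 (enorm z ^+ 2).

Lemma levy_dominated_integrable f : levy_dominated f ->
  N.-integrable setT (EFin \o f).
Proof.
move=> [mf [C fC]]; have [_ _ [_ Nfin]] := ANb.
have mm : measurable_fun setT (fun z : 'cV[R]_n => Num.min 1 (enorm z ^+ 2)).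
  by apply: measurable_minr => //; exact: measurable_sqr_enorm.
have im : N.-integrable setT (EFin \o (fun z : 'cV[R]_n => Num.min 1 (enorm z ^+ 2))).
  apply/integrableP; split; first exact/measurable_EFinP.
  apply: le_lt_trans Nfin; rewrite le_eqVlt; apply/orP; left; apply/eqP.
  by apply: eq_integral => z _ /=; rewrite ger0_norm// min1_sqr_ge0.
apply: (@le_integrable _ _ _ N _ measurableT (EFin \o f)
   (fun z => (C * Num.min 1 (enorm z ^+ 2))%:E)).
- exact/measurable_EFinP.
- by move=> z _; rewrite lee_fin (le_trans (fC z))// ler_norm.
- exact: (@integrableZl _ _ _ N _ measurableT _ _ im).
Qed.

Lemma levy_le f g k s r : levy_dominated f -> levy_dominated g -> levy_dominated k ->
  (forall z, f z <= s * g z + r * k z) ->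
  \int[N]_z f z <= s * (\int[N]_z g z) + r * (\int[N]_z k z).
Proof.
move=> /levy_dominated_integrable mf /levy_dominated_integrable mg.
move=> /levy_dominated_integrable mk fgk.
have sg : N.-integrable setT (EFin \o (fun z => s * g z)).
  exact: (@integrableZl _ _ _ N _ measurableT _ _ mg).
have rk : N.-integrable setT (EFin \o (fun z => r * k z)).
  exact: (@integrableZl _ _ _ N _ measurableT _ _ mk).
rewrite -!RintegralZl// -RintegralD//; apply: le_Rintegral => //.
exact: (@integrableD _ _ _ N _ measurableT _ _ sg rk).
Qed.

Lemma levy_le1 f g s : levy_dominated f -> levy_dominated g ->
  (forall z, f z <= s * g z) -> \int[N]_z f z <= s * (\int[N]_z g z).
Proof.
move=> df dg fg; have := @levy_le f g g s 0 df dg dg; rewrite mul0r addr0; apply.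
by move=> z; rewrite mul0r addr0.
Qed.

Lemma levy_dominated_dotp (G : R -> R) C x : measurable_fun setT G ->
  (forall u, `|G u| <= C * Num.min 1 (u ^+ 2)) -> levy_dominated (fun z => G (dotp x z)).
Proof.
move=> mG GC; split; first exact: (measurableT_comp mG (measurable_dotp x)).
have C0 : 0 <= C.
  by apply: le_trans (normr_ge0 _) (le_trans (GC 1) _); rewrite expr1n minxx mulr1.
exists (C * (1 + enorm x ^+ 2)) => z; apply: le_trans (GC _) _.
rewrite -mulrA ler_wpM2l//; apply: min1_le_scale; rewrite ?sqr_ge0//.
  by rewrite lerDl sqr_ge0.
apply: (@le_trans _ _ (enorm x ^+ 2 * enorm z ^+ 2)).
  rewrite -exprMn -(@real_normK _ (dotp x z)) ?num_real//.
  by rewrite ler_sqr ?nnegrE ?mulr_ge0 ?enorm_ge0// dotp_le.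
by rewrite ler_wpM2r ?sqr_ge0// lerDr.
Qed.

Lemma dominated_min x : levy_dominated (fun z => Num.min 1 (dotp x z ^+ 2)).
Proof.
apply: (@levy_dominated_dotp (fun u => Num.min 1 (u ^+ 2)) 1).
  by apply: measurable_minr => //; exact: measurable_funX.
by move=> u; rewrite mul1r ger0_norm// min1_sqr_ge0.
Qed.

Lemma dominated_trunc x : levy_dominated (fun z => trunc_sqr (dotp x z)).
Proof.
apply: (@levy_dominated_dotp (@trunc_sqr R) 1); first exact: measurable_trunc_sqr.
by move=> u; rewrite mul1r ger0_norm ?trunc_sqr_le// trunc_sqr_ge0.
Qed.

Lemma dominated_cos x : levy_dominated (fun z => 1 - cos (dotp x z)).
Proof.
apply: (@levy_dominated_dotp (fun u => 1 - cos u) 2).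
  by apply: measurable_funB => //; exact: measurable_cos.
by move=> u; rewrite ger0_norm ?subr1_cos_le// subr1_cos_ge0.
Qed.

Lemma dominated_enorm r : levy_dominated (fun z => Num.min 1 (enorm z ^+ 2 / r ^+ 2)).
Proof.
split.
  apply: measurable_minr => //; apply: measurable_funM => //.
  exact: measurable_sqr_enorm.
exists (1 + r ^- 2) => z; rewrite ger0_norm; last first.
  by rewrite le_min ler01 divr_ge0// sqr_ge0.
apply: min1_le_scale; rewrite ?sqr_ge0 ?lerDl ?invr_ge0 ?sqr_ge0//.
by rewrite mulrC ler_wpM2r ?sqr_ge0// lerDr.
Qed.

Lemma quad_form_ge0 x : 0 <= dotp x (A *m x).
Proof. by have [_ /(_ x)] := ANb. Qed.

Lemma quad_formZ s x : dotp (s *: x) (A *m (s *: x)) = s ^+ 2 * dotp x (A *m x).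
Proof. by rewrite -scalemxAr dotpZl dotpZr mulrA -expr2. Qed.

Definition dir_concentration x : R :=
  dotp x (A *m x) + \int[N]_z Num.min 1 (dotp x z ^+ 2).

(** Literally the bracket of (C4), so that (C4) unfolds to it; [dir_truncatedE] gives the form used
    in estimates. *)
Definition dir_truncated x : R := dotp x (A *m x)
  + \int[N]_(z in [set z | `|dotp x z| < 1]) `|dotp x z| ^+ 2.

Local Notation K := dir_concentration.
Local Notation U := dir_truncated.
Local Notation psi := (RePsi A N b).
Local Notation h := (concentration A N).

Lemma dir_truncatedE x : U x = dotp x (A *m x) + \int[N]_z trunc_sqr (dotp x z).
Proof.
rewrite /U Rintegral_mkcond; congr (_ + _); apply: eq_Rintegral => z _.
rewrite patchE trunc_sqrE real_normK ?num_real//.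
have -> // : (z \in [set z | `|dotp x z| < 1]) = (`|dotp x z| < 1).
by apply/idP/idP; rewrite inE.
Qed.

Lemma RePsiE x : psi x = dotp x (A *m x) + \int[N]_z (1 - cos (dotp x z)).
Proof.
rewrite /RePsi /Psi /cintegral /=.
rewrite !(mul0r, mulr0, mul1r, mulr1, subr0, add0r, oppr0, addr0, subrr).
congr (_ + _); rewrite -[RHS]opprK; congr (- _).
rewrite -[RHS]mulN1r -RintegralZl//; last exact/levy_dominated_integrable/dominated_cos.
apply: eq_Rintegral => z _ /=.
rewrite !(mul0r, mulr0, mul1r, mulr1, subr0, add0r, oppr0, addr0, subrr).
rewrite expR0; ring.
Qed.

Lemma RePsi_ge0 x : 0 <= psi x.
Proof.
rewrite RePsiE addr_ge0 ?quad_form_ge0//; apply: Rintegral_ge0 => z _.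
exact: subr1_cos_ge0.
Qed.

Lemma dir_concentration_ge0 x : 0 <= K x.
Proof.
by rewrite addr_ge0 ?quad_form_ge0//; apply: Rintegral_ge0 => z _; exact: min1_sqr_ge0.
Qed.

Lemma dir_truncated_le x : U x <= K x.
Proof.
rewrite dir_truncatedE lerD2l -[leRHS]mul1r; apply: levy_le1.
- exact: dominated_trunc.
- exact: dominated_min.
- by move=> z; rewrite mul1r trunc_sqr_le.
Qed.

Lemma RePsi_le_dir x : psi x <= 2 * K x.
Proof.
rewrite RePsiE mulrDr lerD ?ler_peMl ?quad_form_ge0 ?ler1n//; apply: levy_le1.
- exact: dominated_cos.
- exact: dominated_min.
- by move=> z; exact: subr1_cos_le.
Qed.

Lemma dir_truncated_le_RePsi x : U x <= 8 * psi x.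
Proof.
rewrite RePsiE dir_truncatedE mulrDr lerD ?ler_peMl ?quad_form_ge0 ?ler1n//; apply: levy_le1.
- exact: dominated_trunc.
- exact: dominated_cos.
- by move=> z; exact: trunc_sqr_le_cos.
Qed.

Lemma RePsiD_le x y : psi (x + y) <= 2 * psi x + 2 * psi y.
Proof.
rewrite !RePsiE.
have : dotp (x + y) (A *m (x + y)) <=
    2 * dotp x (A *m x) + 2 * dotp y (A *m y).
  have := quad_form_ge0 (x + (-1) *: y).
  rewrite !mulmxDr -!scalemxAr !(dotpDl, dotpDr, dotpZl, dotpZr); lra.
have : \int[N]_z (1 - cos (dotp (x + y) z)) <=
    2 * \int[N]_z (1 - cos (dotp x z)) + 2 * \int[N]_z (1 - cos (dotp y z)).
  apply: levy_le; [exact: dominated_cos..|] => z.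
  by rewrite dotpDl; exact: subr1_cosD_le.
lra.
Qed.

Lemma dir_concentrationZ_le s x : 1 <= s -> K (s *: x) <= s ^+ 2 * K x.
Proof.
move=> s1; rewrite /K quad_formZ mulrDr lerD2l; apply: levy_le1; [exact: dominated_min..|] => z.
apply: min1_le_scale; rewrite ?sqr_ge0 ?expr_ge1//; first by lra.
by rewrite dotpZl exprMn.
Qed.

(** Serves to deduce a large [U] from growth: if [K (s x)] exceeds [K x] by a fixed factor, the
    excess must come from [U x]. *)
Lemma dir_concentrationZ_le_add s x : 1 <= s ->
  K (s *: x) <= K x + (s ^+ 2 - 1) * U x.
Proof.
move=> s1; rewrite /K dir_truncatedE quad_formZ.
suff : \int[N]_z Num.min 1 (dotp (s *: x) z ^+ 2) <=
    1 * \int[N]_z Num.min 1 (dotp x z ^+ 2)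
    + (s ^+ 2 - 1) * \int[N]_z trunc_sqr (dotp x z) by lra.
apply: levy_le; [exact: dominated_min|exact: dominated_min|exact: dominated_trunc|] => z.
by rewrite mul1r dotpZl; exact: min1_sqr_incr_le.
Qed.

(** Serves in the opposite direction: a [U] comparable with [K] at [s x] forces [K] to have grown by
    a fixed factor since [x]. *)
Lemma dir_concentrationZ_ge_add s x : 1 <= s ->
  K x + (1 - s ^- 2) * U (s *: x) <= K (s *: x).
Proof.
move=> s1; rewrite /K dir_truncatedE quad_formZ.
suff : 1 * \int[N]_z Num.min 1 (dotp x z ^+ 2) <=
    1 * \int[N]_z Num.min 1 (dotp (s *: x) z ^+ 2)
    + - (1 - s ^- 2) * \int[N]_z trunc_sqr (dotp (s *: x) z).
  have -> : (1 - s ^- 2) * (s ^+ 2 * dotp x (A *m x)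
      + \int[N]_z trunc_sqr (dotp (s *: x) z)) =
    s ^+ 2 * dotp x (A *m x) - dotp x (A *m x)
    + (1 - s ^- 2) * \int[N]_z trunc_sqr (dotp (s *: x) z) by field; lra.
  lra.
rewrite mul1r.
apply: levy_le; [exact: dominated_min|exact: dominated_min|exact: dominated_trunc|] => z.
by have := @min1_sqr_incr_ge _ s (dotp x z) s1; rewrite dotpZl; lra.
Qed.

Lemma dir_concentration_le x r : 0 < r -> enorm x <= r^-1 -> K x <= h r.
Proof.
move=> r0 xr; apply: lerD.
  apply: le_trans (form_le_opnorm _ _) _; rewrite mulrC ler_wpM2r ?opnorm_ge0//.
  by rewrite -exprVn ler_sqr ?nnegrE ?enorm_ge0 ?invr_ge0 ?(ltW r0).
rewrite -[leRHS]mul1r; apply: levy_le1; [exact: dominated_min|exact: dominated_enorm|] => z.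
apply: min1_le_scale; rewrite ?divr_ge0 ?sqr_ge0// mul1r -exprVn -exprMn.
rewrite -real_normK ?num_real// ler_sqr ?nnegrE ?mulr_ge0 ?invr_ge0 ?enorm_ge0 ?(ltW r0)//.
by rewrite (le_trans (dotp_le _ _))// mulrC ler_wpM2l ?enorm_ge0.
Qed.

Lemma RePsi_le x r : 0 < r -> enorm x <= r^-1 -> psi x <= 2 * h r.
Proof.
move=> r0 xr; apply: le_trans (RePsi_le_dir _) _.
by rewrite ler_wpM2l// dir_concentration_le.
Qed.

End levy.

(** * The concentration function *)

Lemma min1_sum_le {R : realType} n (a : 'I_n -> R) : (forall i, 0 <= a i) ->
  Num.min 1 (\sum_i a i) <= \sum_i Num.min 1 (a i).
Proof.
move=> a0; have: 0 <= \sum_i a i /\ Num.min 1 (\sum_i a i) <= \sum_i Num.min 1 (a i).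
  elim/big_ind2: _ => [|x1 y1 x2 y2 [p1 q1] [p2 q2]|i _].
  - by split=> //; rewrite ge_min lexx orbT.
  - split; first exact: addr_ge0.
    apply: le_trans (lerD q1 q2).
    case: (leP 1 y1) => ?; case: (leP 1 y2) => ?; rewrite ge_min; apply/orP;
      by [left; lra|left; lra|left; lra|right; lra].
  - by split.
by case.
Qed.

(** * Sigma-finiteness of Lévy measures *)

Section sigma_finite_levy.
Context {R : realType} {n : nat}.

(** The sets where [|z| ^ 2 >= 1 / (k + 1)] have finite mass by Markov's inequality, and the origin,
    which they miss, is null. Tonelli's theorem for [N] rests on this. *)
Lemma levy_sigma_finite (N : {measure set 'cV[R]_n -> \bar R}) :
  levy_measure N -> sigma_finite setT N.
Proof.
move=> [N0 Nfin].
pose B k := [set z : 'cV[R]_n | k.+1%:R^-1 <= enorm z ^+ 2].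
have mB k : measurable (B k).
  have -> : B k = setT `&` (fun z => enorm z ^+ 2) @^-1` `[k.+1%:R^-1, +oo[.
    by apply/seteqP; split=> z; rewrite /B/= in_itv/= andbT // => -[].
  by apply: measurable_sqr_enorm => //; exact: measurable_itv.
have m0 : measurable [set 0 : 'cV[R]_n].
  have -> : [set 0] = [set z : 'cV[R]_n | forall i, [set 0] (z i 0)].
    apply/seteqP; split=> [_ -> i|z z0]/=; first by rewrite mxE.
    by apply/matrixP => i j; rewrite ord1 z0 mxE.
  by apply: (@measurable_box R n (fun=> [set 0])) => i; exact: measurable_set1.
exists (fun k => B k `|` [set 0]).
  apply/seteqP; split=> // z _.
  have [->|z0] := eqVneq z 0; first by exists 0%N => //; right.
  have e0 : 0 < enorm z ^+ 2 by rewrite exprn_gt0// enorm_gt0.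
  exists (Num.truncn (enorm z ^+ 2)^-1) => //; left; rewrite /B/=.
  rewrite -[leRHS]invrK lef_pV2 ?posrE ?invr_gt0//.
  by apply/ltW/truncnS_gt; rewrite invr_ge0 ltW.
move=> k; split; first exact: measurableU.
apply: le_lt_trans (measureU2 _ _ _) _ => //.
rewrite [X in (_ + X)%E]N0 adde0.
apply: (@le_lt_trans _ _ (k.+1%:R%:E * \int[N]_z (Num.min 1 (enorm z ^+ 2))%:E)%E);
  last by rewrite lte_mul_pinfty.
have mm : measurable_fun setT (EFin \o (fun z : 'cV[R]_n => Num.min 1 (enorm z ^+ 2))).
  by apply/measurable_EFinP/measurable_minr => //; exact: measurable_sqr_enorm.
rewrite -ge0_integralZl//; last by move=> z _; rewrite lee_fin min1_sqr_ge0.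
apply: (@le_trans _ _ (\int[N]_x (\1_(B k) x)%:E)%E); first by rewrite integral_indic// setIT.
apply: ge0_le_integral => //.
- by apply/measurable_EFinP/measurable_indic.
- by apply: measurable_funeM.
- move=> z _; rewrite -EFinM lee_fin indicE.
  have [|_] := boolP (z \in B k); last by rewrite mulr_ge0// min1_sqr_ge0.
  rewrite inE /B/= => zk; rewrite -ler_pdivrMl ?ltr0n// mulr1 le_min zk andbT.
  by rewrite invf_le1 ?ltr0n// ler1n.
Qed.

(** Bundles the property into a structure, the form in which the product-measure theorems expect it;
    the underlying measure is unchanged. *)
Lemma sigma_finite_measureP d (T : measurableType d) (mu : {measure set T -> \bar R}) :
  sigma_finite setT mu ->
  exists M : {sigma_finite_measure set T -> \bar R}, mu = M :> {measure set T -> \bar R}.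
Proof.
move=> muf.
have H1 : isSFinite d T R (Measure.sort mu).
  by split; exact: sfinite_measure_sigma_finite.
have H2 : isSigmaFinite d T R (Measure.sort mu) by split.
pose M := HB.pack_for (SigmaFiniteMeasure.type T R) (Measure.sort mu) H1 H2.
by exists M; apply: eq_measure.
Qed.

End sigma_finite_levy.

Section concentration.
Context {R : realType} {n : nat}.
Variables (A : 'M[R]_n) (N : {measure set 'cV[R]_n -> \bar R}) (b : 'cV[R]_n).
Hypothesis ANb : generating_triplet A N.
Hypothesis h0 : concentration A N r @[r --> 0^'+] --> +oo.
Implicit Types (x y z : 'cV[R]_n) (r s t : R).

Local Notation K := (dir_concentration A N).
Local Notation U := (dir_truncated A N).
Local Notation psi := (RePsi A N b).
Local Notation h := (concentration A N).
Local Notation hinv := (concentration_inv A N).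

Lemma concentration_ge0 r : 0 <= h r.
Proof.
rewrite addr_ge0 ?mulr_ge0 ?opnorm_ge0 ?invr_ge0 ?sqr_ge0//.
by apply: Rintegral_ge0 => z _; rewrite le_min ler01 divr_ge0// sqr_ge0.
Qed.

Lemma concentration_scale_le t r : 1 <= t -> 0 < r -> h r <= t ^+ 2 * h (t * r).
Proof.
move=> t1 r0; have tr : r ^- 2 = t ^+ 2 * (t * r) ^- 2.
  by rewrite exprMn; field; apply/andP; split; lra.
rewrite /concentration mulrDr mulrA {1}tr lerD2l.
apply: (levy_le1 ANb); [exact: dominated_enorm..|] => z.
apply: min1_le_scale; rewrite ?divr_ge0 ?sqr_ge0 ?expr_ge1//; first by lra.
by rewrite tr mulrCA.
Qed.

Lemma concentration_le r s : 0 < r -> r <= s -> h s <= h r.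
Proof.
move=> r0 rs; have sr : s ^- 2 <= r ^- 2.
  by rewrite lef_pV2 ?posrE ?exprn_gt0 ?ler_sqr ?nnegrE//; lra.
apply: lerD; first by rewrite ler_wpM2r ?opnorm_ge0.
rewrite -[leRHS]mul1r.
apply: (levy_le1 ANb); [exact: dominated_enorm..|] => z.
apply: min1_le_scale; rewrite ?divr_ge0 ?sqr_ge0// mul1r.
by rewrite ler_wpM2l ?sqr_ge0.
Qed.

(* [u |-> h (u ^ - 1/2)] is concave. *)
Lemma concentration_concave r r1 r2 t : 0 <= t <= 1 ->
  r ^- 2 = t * r1 ^- 2 + (1 - t) * r2 ^- 2 ->
  t * h r1 + (1 - t) * h r2 <= h r.
Proof.
move=> /andP[t0 t1] rE; rewrite /concentration !mulrDr {1}rE.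
suff : t * \int[N]_z Num.min 1 (enorm z ^+ 2 / r1 ^+ 2)
    <= 1 * \int[N]_z Num.min 1 (enorm z ^+ 2 / r ^+ 2)
     + (- (1 - t)) * \int[N]_z Num.min 1 (enorm z ^+ 2 / r2 ^+ 2) by rewrite mul1r; lra.
rewrite -RintegralZl//; last exact/(levy_dominated_integrable ANb)/dominated_enorm.
apply: (levy_le ANb); [|exact: dominated_enorm..|] => [|z].
  have [m [C HC]] := @dominated_enorm R n r1; split; first exact: measurable_funM.
  by exists (t * C) => z; rewrite normrM (ger0_norm t0) -[leRHS]mulrA; apply: ler_wpM2l.
rewrite mul1r rE mulrDr; set a := enorm z ^+ 2.
have a0 : 0 <= a by exact: sqr_ge0.
rewrite mulNr lerBrDr le_min.
have p1 : t * Num.min 1 (a / r1 ^+ 2) <= t.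
  by rewrite ler_piMr// ge_min lexx.
have p2 : t * Num.min 1 (a / r1 ^+ 2) <= t * (a / r1 ^+ 2).
  by rewrite ler_wpM2l// ge_min lexx orbT.
have q1 : (1 - t) * Num.min 1 (a / r2 ^+ 2) <= 1 - t.
  by rewrite ler_piMr ?subr_ge0// ge_min lexx.
have q2 : (1 - t) * Num.min 1 (a / r2 ^+ 2) <= (1 - t) * (a / r2 ^+ 2).
  by rewrite ler_wpM2l ?subr_ge0// ge_min lexx orbT.
apply/andP; split; lra.
Qed.

(** Concavity upgrades weak to strict monotonicity. If [h s >= h r] with [r < s], the blow-up at 0
    yields [q < r] with [h q > h s]; as [r ^ -2] lies between [s ^ -2] and [q ^ -2], concavity then
    puts [h r] strictly above [h s]. *)
Lemma concentration_lt r s : 0 < r -> r < s -> h s < h r.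
Proof.
move=> r0 rs; rewrite ltNge; apply/negP => hrs.
have [q /andP[q0 qr] hq] : exists2 q, 0 < q < r & h s < h q.
  have := h0 => /cvgryPgt /(_ (h s)) H.
  have : \forall q \near 0^'+, 0 < q < r /\ h s < h q.
    near=> q; split; last by near: q.
    by apply/andP; split; near: q; [exact: nbhs_right_gt|exact: nbhs_right_lt].
  by move=> /filter_ex[q [? ?]]; exists q.
have lt2 (u v : R) : 0 < u -> u < v -> v ^- 2 < u ^- 2.
  move=> u0 uv; have v0 : 0 < v by exact: lt_trans uv.
  by rewrite ltf_pV2 ?posrE ?exprn_gt0// ltr_sqr ?nnegrE// ltW.
have d1 := lt2 _ _ r0 rs; have d2 := lt2 _ _ q0 qr.
(* Barycentric coordinate of [r ^ -2] between [s ^ -2] and [q ^ -2]. *)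
pose t := (q ^- 2 - r ^- 2) / (q ^- 2 - s ^- 2).
have D0 : 0 < q ^- 2 - s ^- 2 by lra.
have t0 : 0 <= t by rewrite divr_ge0//; lra.
have t1 : t < 1 by rewrite ltr_pdivrMr//; lra.
have tD : t * (q ^- 2 - s ^- 2) = q ^- 2 - r ^- 2 by rewrite divfK//; lra.
have := @concentration_concave r s q t; rewrite t0 (ltW t1) => /(_ isT) H.
have : t * h s + (1 - t) * h q <= h r by apply: H; lra.
have : (1 - t) * h s < (1 - t) * h q by rewrite ltr_pM2l//; lra.
lra.
Unshelve. all: by end_near.
Qed.

Lemma concentration_gt0 r : 0 < r -> 0 < h r.
Proof.
move=> r0; apply: le_lt_trans (concentration_ge0 (r + 1)) (concentration_lt r0 _).
by lra.
Qed.

(** Monotonicity and the at most quadratic decay trap [h s] between [h r] and [(r ^ 2 / s ^ 2) h r],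
    in one order or the other; continuity follows. *)
Lemma concentration_near r s : 0 < r -> 0 < s ->
  `|h r - h s| <= `|1 - r ^+ 2 / s ^+ 2| * h r.
Proof.
move=> r0 s0; have hr := concentration_ge0 r; have hs := concentration_ge0 s.
have rs2 : 0 < r ^+ 2 / s ^+ 2 by rewrite divr_gt0 ?exprn_gt0.
have [rs|sr] := leP r s.
  have rs1 : r ^+ 2 / s ^+ 2 <= 1.
    by rewrite ler_pdivrMr ?exprn_gt0// mul1r ler_sqr ?nnegrE ?(ltW r0) ?(ltW s0).
  rewrite !ger0_norm ?subr_ge0 ?concentration_le//.
  have := @concentration_scale_le (s / r) r; rewrite divfK ?gt_eqF//.
  rewrite ler_pdivlMr// mul1r => /(_ rs r0).
  move=> /(ler_wpM2l (ltW rs2)); rewrite mulrA -expr_div_n -exprMn.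
  by rewrite mulrA divfK ?gt_eqF// divff ?gt_eqF// expr1n mul1r; lra.
have rs1 : 1 <= r ^+ 2 / s ^+ 2.
  by rewrite ler_pdivlMr ?exprn_gt0// mul1r ler_sqr ?nnegrE ?(ltW r0) ?(ltW s0) ?(ltW sr).
rewrite !ler0_norm ?subr_le0 ?(concentration_le s0 (ltW sr))//.
have := @concentration_scale_le (r / s) s; rewrite divfK ?gt_eqF//.
by rewrite expr_div_n ler_pdivlMr// mul1r => /(_ (ltW sr) s0); lra.
Qed.

Lemma concentration_continuous r : 0 < r -> {for r, continuous h}.
Proof.
move=> r0.
have cq : `|1 - r ^+ 2 / s ^+ 2| * h r @[s --> r] --> (0 : R).
  rewrite -[X in _ --> X](mul0r (h r)); apply: cvgMl.
  rewrite -[X in _ --> X](@normr0 _ R); apply: cvg_norm.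
  rewrite -[X in _ --> X](subrr 1); apply: cvgB; first exact: cvg_cst.
  rewrite -[X in _ --> X](@divff _ (r ^+ 2)) ?sqrf_eq0 ?gt_eqF//.
  apply: cvgM; first exact: cvg_cst.
  apply: cvgV; first by rewrite sqrf_eq0 gt_eqF.
  exact: exprn_continuous.
apply/cvgrPdist_le => /= e e0.
move/cvgrPdist_le : cq => /(_ e e0) H.
near=> s; apply: (@le_trans _ _ (`|1 - r ^+ 2 / s ^+ 2| * h r)).
  by apply: concentration_near => //; near: s; exact: lt_nbhsr.
have : `|0 - `|1 - r ^+ 2 / s ^+ 2| * h r| <= e by near: s.
by rewrite sub0r normrN normrM normr_id (ger0_norm (concentration_ge0 r)).
Unshelve. all: by end_near.
Qed.

Lemma cvg_expV2 : k.+1%:R ^- 2 @[k --> \oo] --> (0 : R).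
Proof.
rewrite -[X in _ --> X](mul0r 0); under eq_fun do rewrite -exprVn expr2.
by apply: cvgM; exact: cvg_harmonic.
Qed.

(** Dominated convergence along the integers, with the integrand at radius 1 as majorant. *)
Lemma concentration_small e : 0 < e -> exists2 r, 0 < r & h r < e.
Proof.
move=> e0.
pose f (k : nat) z := Num.min 1 (enorm z ^+ 2 / k.+1%:R ^+ 2).
have hk : h k.+1%:R @[k --> \oo] --> (0 : R).
  rewrite -[X in _ --> X](addr0 0); apply: cvgD.
    rewrite -[X in _ --> X](mul0r (opnorm A)); apply: cvgMl.
    exact: cvg_expV2.
  have mf k := levy_dominated_integrable ANb (@dominated_enorm R n k.+1%:R).
  have [|||||_ _] := @dominated_convergence _ _ _ N setT measurableT
      (fun k z => (f k z)%:E) (fun=> 0%E) (fun z => (Num.min 1 (enorm z ^+ 2 / 1 ^+ 2))%:E).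
  - by move=> k; have /integrableP[] := mf k.
  - exact: measurable_cst.
  - apply: aeW => z _; apply: cvg_EFin; first exact: nearW.
    apply: (@squeeze_cvgr _ _ _ _ (fun=> 0) (fun k => enorm z ^+ 2 * k.+1%:R ^- 2)).
    + by apply: nearW => k; rewrite /= le_min ler01 divr_ge0 ?sqr_ge0//= ge_min lexx orbT.
    + exact: cvg_cst.
    + rewrite -[X in _ --> X](mulr0 (enorm z ^+ 2)); apply: cvgMr; exact: cvg_expV2.
  - exact: (levy_dominated_integrable ANb (@dominated_enorm R n 1)).
  - apply: aeW => z k _; rewrite lee_fin ger0_norm; last first.
      by rewrite le_min ler01 divr_ge0 ?sqr_ge0.
    rewrite -[leRHS]mul1r; apply: min1_le_scale; rewrite ?divr_ge0 ?sqr_ge0//.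
    rewrite mul1r ler_wpM2l ?sqr_ge0// lef_pV2 ?posrE ?exprn_gt0//.
    by rewrite ler_sqr ?nnegrE// ler1n.
  by rewrite integral0 => /fine_cvg.
move/cvgrPdist_lt: hk => /(_ e e0)[k _ /(_ k (leqnn _))]/=.
rewrite sub0r normrN ger0_norm ?concentration_ge0// => hk.
by exists k.+1%:R.
Qed.

Lemma concentration_inj : {in (`]0, +oo[%classic : set R) &, injective h}.
move=> r s; rewrite !inE/= !in_itv/= !andbT => r0 s0 hrs.
by have [/(concentration_lt r0)|/(concentration_lt s0)|//] := ltgtP r s; rewrite hrs ltxx.
Qed.

Lemma concentration_invP (y : R) : 0 < y -> 0 < hinv y /\ h (hinv y) = y.
Proof.
move=> y0.
have [s s0 hs] := concentration_small y0.
have [q /andP[q0 qs] hq] : exists2 q, 0 < q < s & y < h q.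
  have := h0 => /cvgryPgt /(_ y) H.
  have : \forall q \near 0^'+, 0 < q < s /\ y < h q.
    near=> q; split; last by near: q.
    by apply/andP; split; near: q; [exact: nbhs_right_gt|exact: nbhs_right_lt].
  by move=> /filter_ex[q [? ?]]; exists q.
have hy : [set h r | r in `]0, +oo[%classic] y.
  have [| |r] := @IVT R h q s y (ltW qs).
  - apply: continuous_in_subspaceT => r; rewrite inE/= in_itv/= => /andP[qr _].
    by apply: concentration_continuous; exact: lt_le_trans qr.
  - by rewrite ge_min le_max (ltW hs) (ltW hq) orbT.
  rewrite in_itv/= => /andP[qr _] <-; exists r => //=.
  by rewrite in_itv/= andbT; exact: lt_le_trans qr.
split; last by apply: pinvK; rewrite inE.
(* [pinv] is known to return to the half-line only from attained values, so positivity is read off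
   the image of the image. *)
have hI : (hinv @` (h @` `]0, +oo[%classic)) (hinv y) by exists y.
by move: hI; rewrite (injpinv_image (fun=> 0) concentration_inj)/= in_itv/= andbT.
Unshelve. all: by end_near.
Qed.

Lemma concentrationK r : 0 < r -> hinv (h r) = r.
Proof.
move=> r0; apply: (pinvKV (fun=> 0) concentration_inj).
by rewrite inE/= in_itv/= r0.
Qed.

Lemma measurable_form : measurable_fun setT (fun x => dotp x (A *m x)).
Proof.
apply: measurable_fun_dotp; first exact: measurable_id.
apply: measurable_fun_coord => i; under eq_fun do rewrite mxE.
apply: measurable_sum => j; apply: measurable_funM => //.
exact: measurable_coord.
Qed.

Lemma RePsi_EFin x :
  ((psi x)%:E = (dotp x (A *m x))%:E + \int[N]_z (1 - cos (dotp x z))%:E)%E.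
Proof.
rewrite (RePsiE b ANb) EFinD; congr (_ + _)%E; rewrite fineK//.
exact: integrable_fin_num (levy_dominated_integrable ANb (@dominated_cos _ _ x)).
Qed.

Lemma measurable_subr1_cos_dotp d (T : measurableType d) (f g : T -> 'cV[R]_n) :
  measurable_fun setT f -> measurable_fun setT g ->
  measurable_fun setT (EFin \o (fun w => 1 - cos (dotp (f w) (g w)))).
Proof.
move=> mf mg; apply/measurable_EFinP/measurable_funB => //.
by apply: (measurableT_comp measurable_cos); exact: measurable_fun_dotp.
Qed.

(** The jump part is an integral over [z] with parameter [x]; joint measurability and Tonelli give
    measurability in [x]. *)
Lemma measurable_RePsi : measurable_fun setT psi.
Proof.
have [_ _ Nlevy] := ANb; have [M NM] := sigma_finite_measureP (levy_sigma_finite Nlevy).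
apply/measurable_EFinP.
have -> : EFin \o psi = (fun x => (EFin \o (fun x => dotp x (A *m x))) x +
    fubini_F M (fun p : 'cV[R]_n * 'cV[R]_n => (1 - cos (dotp p.1 p.2))%:E) x)%E.
  by apply/funext => x; rewrite /= RePsi_EFin NM.
apply: emeasurable_funD; first by apply/measurable_EFinP; exact: measurable_form.
apply: measurable_fun_fubini_tonelli_F.
  by apply: measurable_subr1_cos_dotp; [exact: measurable_fst|exact: measurable_snd].
by move=> p; rewrite lee_fin subr1_cos_ge0.
Qed.

Lemma RePsi_has_ubound r : 0 < r ->
  has_ubound [set psi z | z in [set z | enorm z <= r]].
Proof.
move=> r0; exists (2 * h r^-1) => _ [z /= zr <-].
by apply: (RePsi_le _ ANb); rewrite ?invr_gt0// invrK.
Qed.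

Lemma RePsi_le_Psi_star x r : 0 < r -> enorm x <= r -> psi x <= Psi_star A N b r.
Proof. by move=> r0 xr; apply: ub_le_sup; [exact: RePsi_has_ubound|exists x]. Qed.

Lemma Psi_star_le r : 0 < r -> Psi_star A N b r <= 2 * h r^-1.
Proof.
move=> r0; apply: ge_sup.
  by exists (psi 0), 0 => //=; rewrite /enorm dotp0l sqrtr0 ltW.
move=> _ [z /= zr <-].
by apply: (RePsi_le _ ANb); rewrite ?invr_gt0// invrK.
Qed.

(** [psi (s x)] stays below [Psi_star] for all [s] in [0, 1], so its mean does too; Tonelli moves
    the mean inside the integral over [N]. The jump part costs 64, the Gaussian part 1. *)
Lemma dir_concentration_le_Psi_star x : x != 0 -> K x <= 65 * Psi_star A N b (enorm x).
Proof.
move=> x0; have e0 : 0 < enorm x by rewrite enorm_gt0.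
set P := Psi_star _ _ _ _.
have [_ _ Nlevy] := ANb; have [M NM] := sigma_finite_measureP (levy_sigma_finite Nlevy).
have xP : psi x <= P by exact: RePsi_le_Psi_star.
have H : \int[N]_z Num.min 1 (dotp x z ^+ 2) <= 64 * P.
  rewrite -lee_fin fineK; last first.
    exact: integrable_fin_num (levy_dominated_integrable ANb (@dominated_min _ _ x)).
  pose F (p : 'cV[R]_n * measurableTypeR R) := ((1 - cos (p.2 * dotp x p.1)) * \1_`[0%R, 1%R] p.2)%:E.
  have mF : measurable_fun setT F.
    apply/measurable_EFinP/measurable_funM.
      apply: measurable_funB => //; apply: (measurableT_comp measurable_cos).
      apply: measurable_funM; first exact: measurable_snd.
      exact: (measurableT_comp (measurable_dotp x) measurable_fst).
    apply: measurableT_comp; last exact: measurable_snd.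
    by apply: measurable_indic; exact: measurable_itv.
  have F0 p : (0 <= F p)%E by rewrite lee_fin mulr_ge0 ?subr1_cos_ge0.
  have mG := measurable_fun_fubini_tonelli_F (m2 := @lebesgue_measure R) F mF F0.
  have G0 z : (0 <= fubini_F (@lebesgue_measure R) F z)%E by exact: integral_ge0.
  apply: (@le_trans _ _ (\int[N]_z (64%:E * fubini_F (@lebesgue_measure R) F z))%E).
    apply: ge0_le_integral => //.
    - by move=> z _; rewrite lee_fin min1_sqr_ge0.
    - by have /integrableP[] := levy_dominated_integrable ANb (@dominated_min _ _ x).
    - exact: measurable_funeM.
    - by move=> z _; exact: min1_le_integral_cos.
  rewrite ge0_integralZl// EFinM lee_pmul2l// NM fubini_tonelli//.
  apply: (@le_trans _ _ (\int[lebesgue_measure]_s (P%:E * (\1_`[0%R, 1%R] s)%:E))%E).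
    apply: ge0_le_integral => //.
    - by move=> s _; exact: integral_ge0.
    - by have := measurable_fun_fubini_tonelli_G (m1 := M) F mF F0.
    - apply: measurable_funeM; apply/measurable_EFinP.
      by apply: measurable_indic; exact: measurable_itv.
    - move=> s _; rewrite [leLHS](_ : _ = \int[N]_z F (z, s))%E; last by rewrite NM.
      rewrite /F /= indicE mem_setE in_itv/=.
      have [/andP[s0 s1]|_] := boolP (0 <= s <= 1)%R; last first.
        by under eq_integral do rewrite mulr0; rewrite integral0 mule0.
      under eq_integral do rewrite mulr1 -dotpZl.
      rewrite mule1; apply: (@le_trans _ _ (psi (s *: x))%:E).
        by rewrite RePsi_EFin leeDr// lee_fin; exact: (quad_form_ge0 ANb).
      rewrite lee_fin; apply: RePsi_le_Psi_star => //.
      by rewrite enormZ ger0_norm// ler_piMl// ltW.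
  rewrite ge0_integralZl//.
  - have mI : measurable (`[0%R, 1%R] : set (measurableTypeR R)) by exact: measurable_itv.
    rewrite integral_indic//.
    have L1 : lebesgue_measure (`[0%R, 1%R] : set R) = 1%E.
      by rewrite lebesgue_measure_itv/= lte01 oppr0 adde0.
    by rewrite setIT [X in (_ * X)%E]L1 mule1.
  - by apply/measurable_EFinP/measurable_indic; exact: measurable_itv.
  - by rewrite lee_fin (le_trans (RePsi_ge0 b ANb x)).
rewrite /K; have : dotp x (A *m x) <= P.
  apply: le_trans xP; rewrite (RePsiE b ANb) lerDl; apply: Rintegral_ge0 => z _.
  exact: subr1_cos_ge0.
lra.
Qed.

(** Tested on the coordinate vectors scaled to length [r]. Their directional jump parts add up to at
    least that of [h], whence [n * 65]; the other term of the constant bounds the operator norm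
    through the trace. *)
Lemma concentration_le_Psi_star r : 0 < r ->
  h r^-1 <= (n%:R * 65 + n%:R * (n%:R * (n%:R * 65))) * Psi_star A N b r.
Proof.
move=> r0; set P := Psi_star _ _ _ _.
have [As A0 _] := ANb.
have E i : enorm (r *: bvec i : 'cV[R]_n) = r by rewrite enormZ enorm_bvec mulr1 gtr0_norm.
have KP i : K (r *: bvec i) <= 65 * P.
  rewrite /P -{2}(E i); apply: dir_concentration_le_Psi_star.
  by rewrite -enorm_gt0 E.
have sumP (F : 'I_n -> R) : (forall i, F i <= 65 * P) -> \sum_i F i <= n%:R * 65 * P.
  move=> FP; rewrite -[n in n%:R]card_ord -sum1_card natr_sum !mulr_suml.
  by apply: ler_sum => i _; rewrite mul1r.
rewrite mulrDl addrC; apply: lerD.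
  rewrite -exprVn invrK.
  have -> : n%:R * (n%:R * (n%:R * 65)) * P = n%:R * (n%:R * (n%:R * 65 * P)) by ring.
  apply: (@le_trans _ _ (r ^+ 2 * (n%:R * (n%:R * \sum_i dotp (bvec i) (A *m bvec i))))).
  by rewrite ler_wpM2l ?sqr_ge0 ?opnorm_le_trace.
  rewrite mulrCA ler_wpM2l// mulrCA ler_wpM2l// mulr_sumr; apply: sumP => i.
  rewrite -quad_formZ; apply: le_trans (KP i); rewrite lerDl; apply: Rintegral_ge0 => z _.
  exact: min1_sqr_ge0.
have : \int[N]_z Num.min 1 (enorm z ^+ 2 / r^-1 ^+ 2) <=
    \sum_i \int[N]_z Num.min 1 (dotp (r *: bvec i) z ^+ 2).
  have iF z : integral N setT (EFin \o (fun y => Num.min 1 (dotp z y ^+ 2))) \is a fin_num.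
    exact: integrable_fin_num (levy_dominated_integrable ANb (@dominated_min _ _ z)).
  have mF z : measurable_fun setT (EFin \o (fun y => Num.min 1 (dotp z y ^+ 2))).
    by have /integrableP[] := levy_dominated_integrable ANb (@dominated_min _ _ z).
  rewrite -lee_fin -sumEFin fineK; last first.
    exact: integrable_fin_num (levy_dominated_integrable ANb (@dominated_enorm _ _ r^-1)).
  rewrite (eq_bigr (fun i => \int[N]_z (Num.min 1 (dotp (r *: bvec i) z ^+ 2))%:E)%E);
    last by move=> i _; rewrite fineK//; exact: iF.
  rewrite -ge0_integral_sum//; first last.
  - by move=> i y _; rewrite lee_fin min1_sqr_ge0.
  - by move=> i; exact: mF.
  apply: ge0_le_integral => //.
  - by move=> y _; rewrite lee_fin le_min ler01 divr_ge0// sqr_ge0.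
  - by have /integrableP[] := levy_dominated_integrable ANb (@dominated_enorm _ _ r^-1).
  - by apply: emeasurable_sum => i; exact: mF.
  - move=> y _; rewrite sumEFin lee_fin sqr_enorm -exprVn invrK mulr_suml.
    apply: le_trans (min1_sum_le _) _ => [i|].
      by rewrite mulr_ge0 ?sqr_ge0// -expr2 sqr_ge0.
    by apply: ler_sum => i _; rewrite dotpZl dotp_bvec exprMn mulrC -expr2.
move=> /le_trans; apply; apply: sumP => i; apply: le_trans (KP i).
by rewrite lerDr (quad_form_ge0 ANb).
Qed.

End concentration.

(** * (C8), (C3) and (C4) *)

Section scaling.
Context {R : realType}.
Implicit Types (r s t q a : R) (T : \bar R).

Lemma inve_lt_EFin T r : (0 < T)%E -> 0 < r -> (T^-1 < r%:E)%E = (r^-1%:E < T)%E.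
Proof.
move=> T0 r0; rewrite inve_plt ?inE ?lee_fin ?(ltW r0) ?(ltW T0)//.
by rewrite inver gt_eqF.
Qed.

Lemma gt0_inve_lt T r : (0 < T)%E -> (T^-1 < r%:E)%E -> 0 < r.
Proof.
by move=> T0 /(le_lt_trans _) => /(_ 0%E); rewrite lte_fin; apply; rewrite inve_ge0 ltW.
Qed.

Lemma powR_inv a s : 0 < a -> (a^-1) `^ s = (a `^ s)^-1.
Proof. by move=> a0; rewrite -powR_inv1 ?ltW// -powRrM mulN1r powRN. Qed.

(** Iterating the gain [q] over the radii [r / a ^ k] makes [f] grow like a power with exponent
    [ln q / ln a], at most 2 because [q <= a ^ 2]. Rounding [t] to a power of [a] costs at most one
    step, which is the extra factor [q]. *)
Lemma power_scaling (f : R -> R) T a q :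
  1 < a -> 1 < q -> q <= a ^+ 2 ->
  (forall r, 0 < r -> 0 <= f r) ->
  (forall r s, 0 < r -> r <= s -> f s <= f r) ->
  (forall r, 0 < r -> (r%:E < T)%E -> q * f r <= f (r / a)) ->
  exists2 p, 0 < p <= 2 & forall t r, 0 < t <= 1 -> 0 < r -> (r%:E < T)%E ->
    f r <= q * t `^ p * f (t * r).
Proof.
move=> a1 q1 qa f0 fmono fq.
have la : 0 < ln a by rewrite ln_gt0.
have lq : 0 < ln q by rewrite ln_gt0.
have a0 : 0 < a by lra.
have q0 : 0 < q by lra.
exists (ln q / ln a).
  rewrite divr_gt0//= ler_pdivrMr// mulr_natl -lnXn//.
  by rewrite ler_ln ?posrE ?exprn_gt0.
move=> t r /andP[t0 t1] r0 rT.
have iter k : q ^+ k * f r <= f (r / a ^+ k) /\ ((r / a ^+ k)%:E < T)%E.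
  elim: k => [|k [IH1 IH2]]; first by rewrite expr0 mul1r divr1 rT.
  have E : r / a ^+ k.+1 = r / a ^+ k / a by rewrite exprSr invfM mulrA.
  have p0 : 0 < r / a ^+ k by rewrite divr_gt0 ?exprn_gt0.
  split; rewrite E.
    apply: le_trans (fq _ p0 IH2); by rewrite exprS -mulrA ler_wpM2l// ltW.
  by apply: le_lt_trans IH2; rewrite lee_fin ler_pdivrMr// ler_peMr// ?(ltW p0) ?(ltW a1).
(* Largest [k] with [a ^ k <= 1 / t]: then [t r <= r / a ^ k], while one more step reaches [t r] or
   goes below it. *)
pose k := Num.truncn (- ln t / ln a).
have lt0 : 0 <= - ln t / ln a by rewrite divr_ge0 ?oppr_ge0 ?ln_le0 ?(ltW la).
have k1 : k%:R * ln a <= - ln t by rewrite -ler_pdivlMr// truncn_le.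
have k2 : - ln t <= k.+1%:R * ln a by rewrite -ler_pdivrMr// ltW// truncnS_gt.
have [fk _] := iter k; clearbody k.
have tk : t * r <= r / a ^+ k.
  rewrite mulrC ler_wpM2l ?(ltW r0)// -[t]lnK ?posrE// -[a ^+ k]lnK ?posrE ?exprn_gt0//.
  by rewrite -expRN ler_expR lnXn// -mulr_natl lerNr.
have qt : 1 <= q * t `^ (ln q / ln a) * q ^+ k.
  rewrite -[X in X * _ * _]lnK ?posrE// -[q ^+ k]lnK ?posrE ?exprn_gt0// lnXn//.
  rewrite /powR gt_eqF// -!expRD -expR0 ler_expR -mulr_natl.
  have : - (ln q / ln a) * (k.+1%:R * ln a) <= ln q / ln a * ln t.
    by rewrite mulNr -mulrN ler_pM2l ?divr_gt0// lerNl.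
  by rewrite mulNr mulrCA divfK ?gt_eqF// -natr1; lra.
apply: (@le_trans _ _ (q * t `^ (ln q / ln a) * (q ^+ k * f r))).
  by rewrite mulrA ler_peMl// f0.
rewrite ler_wpM2l ?mulr_ge0 ?powR_ge0 ?(ltW q0)//.
by apply: le_trans fk _; apply: fmono => //; rewrite mulr_gt0.
Qed.

End scaling.

Section conditions_equiv.
Context {R : realType} {n : nat}.
Variables (A : 'M[R]_n) (N : {measure set 'cV[R]_n -> \bar R}) (b : 'cV[R]_n).
Hypothesis n0 : (0 < n)%N.
Hypothesis ANb : generating_triplet A N.
Hypothesis h0 : concentration A N r @[r --> 0^'+] --> +oo.
Implicit Types (x y z : 'cV[R]_n) (r s t : R) (T : \bar R).

Local Notation K := (dir_concentration A N).
Local Notation U := (dir_truncated A N).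
Local Notation psi := (RePsi A N b).
Local Notation h := (concentration A N).
Local Notation Psi_star := (Psi_star A N b).

Definition Psi_star_const : R := n%:R * 65 + n%:R * (n%:R * (n%:R * 65)).
Local Notation C0 := Psi_star_const.

Lemma Psi_star_const_ge1 : 1 <= C0.
Proof.
have n1 : 1 <= n%:R :> R by rewrite ler1n.
have : 0 <= n%:R * (n%:R * (n%:R * 65)) :> R by rewrite !mulr_ge0.
rewrite /C0; lra.
Qed.

Lemma concentration_projE v r : 0 < r -> enorm v = 1 ->
  concentration_proj A N (v *m v^T) r = K (r^-1 *: v).
Proof.
move=> r0 v1; rewrite /concentration_proj /K line_projection_conj.
rewrite opnorm_line ?(quad_form_ge0 ANb)// quad_formZ exprVn; congr (_ + _).
apply: eq_Rintegral => z _; congr Num.min.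
rewrite mulmx_row_col enormZ v1 mulr1 dotpZl exprMn real_normK ?num_real//.
by rewrite exprVn mulrC.
Qed.

Lemma concentration_proj_dir P T c : line_projection P ->
  (forall x, x != 0 -> ((enorm x)^-1%:E < T)%E -> h (enorm x)^-1 <= c * K x) ->
  forall r, 0 < r -> (r%:E < T)%E -> h r <= c * concentration_proj A N P r.
Proof.
move=> /line_projectionP[v v1 ->] H r r0 rT; rewrite concentration_projE//.
have E : enorm (r^-1 *: v) = r^-1 by rewrite enormZ v1 mulr1 gtr0_norm ?invr_gt0.
have := H (r^-1 *: v); rewrite -enorm_gt0 E invr_gt0 invrK; exact.
Qed.

Lemma dir_concentration_proj x : x != 0 ->
  exists2 P, line_projection P & K x = concentration_proj A N P (enorm x)^-1.
Proof.
rewrite -enorm_gt0 => e0; pose v := (enorm x)^-1 *: x.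
have v1 : enorm v = 1.
  by rewrite enormZ ger0_norm ?invr_ge0 ?(ltW e0)// mulVf ?gt_eqF.
exists (v *m v^T); first by apply/line_projectionP; exists v.
by rewrite concentration_projE ?invr_gt0// invrK scalerA divff ?gt_eqF// scale1r.
Qed.

(* [C8], with the projections encoded by directions: the concentration function
   of the projection on the line spanned by [x], at [1 / |x|], is [K x]. *)
Lemma C8_dir : C8 A N <-> exists T (c p : R), (0 < T)%E /\ 1 <= c /\ 0 < p <= 2 /\
  (forall x, x != 0 -> ((enorm x)^-1%:E < T)%E -> h (enorm x)^-1 <= c * K x) /\
  (forall t r, 0 < t <= 1 -> 0 < r -> (r%:E < T)%E -> h r <= c * t `^ p * h (t * r)).
Proof.
split=> [[T [c [p [T0 [c1 [p0 H]]]]]]|[T [c [p [T0 [c1 [p0 [H1 H2]]]]]]]].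
  exists T, c, p; do 3 split=> //; split=> [x x0 xT|t r t1 r0 rT].
    have [P lP ->] := dir_concentration_proj x0.
    have [] // := H _ lP 1 (enorm x)^-1; first by rewrite ltr01 lexx.
    by rewrite invr_gt0 enorm_gt0.
  have [|P lP _] := @dir_concentration_proj (bvec (Ordinal n0)).
    by rewrite -enorm_gt0 enorm_bvec.
  by have [] := H _ lP _ _ t1 r0 rT.
exists T, c, p; do 3 split=> //; move=> P lP t r t1 r0 rT; split; last exact: H2.
exact: (concentration_proj_dir lP H1).
Qed.

(** Dilate [x] by an [s] so large that the scaling of [h] beats both losses of [c]: then
    [K (s x) >= 2 h (1 / |x|) >= 2 K x], and [dir_concentrationZ_le_add] leaves [(s ^ 2 - 1) U x] at
    least as large as [K x]. *)
Lemma C8_dir_truncated : C8 A N -> exists T (c : R), (0 < T)%E /\ 1 <= c /\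
  (forall x, x != 0 -> ((enorm x)^-1%:E < T)%E -> h (enorm x)^-1 <= c * U x).
Proof.
move=> /C8_dir[T [c [p [T0 [c1 [/andP[p0 p2] [H1 H2]]]]]]].
have cc : 1 <= c * c by rewrite -expr2 expr_ge1//; lra.
(* [s ^ p] must absorb one [c] from the scaling and one from comparing [h] with [K] at [s x], and
   still leave a factor 2. *)
pose s := (2 * (c * c)) `^ p^-1.
have sp : s `^ p = 2 * (c * c).
  by rewrite -powRrM mulVf ?gt_eqF// powRr1//; lra.
have s1 : 1 <= s.
  rewrite /s -[leLHS](powRr0 (2 * (c * c))) ler_powR ?invr_ge0 ?(ltW p0)//; lra.
exists T, (Num.max 1 (c * (s ^+ 2 - 1))); split=> //.
rewrite le_max lexx; split=> // x x0 xT.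
have e0 : 0 < enorm x by rewrite enorm_gt0.
have s0 : 0 < s by lra.
have Es : enorm (s *: x) = s * enorm x by rewrite enormZ gtr0_norm.
have Ei : (enorm (s *: x))^-1 = s^-1 * (enorm x)^-1 by rewrite Es invfM.
have sx0 : s *: x != 0 by rewrite -enorm_gt0 Es mulr_gt0.
have sxT : ((enorm (s *: x))^-1%:E < T)%E.
  apply: le_lt_trans xT; rewrite lee_fin Ei ler_piMl ?invr_ge0 ?(ltW e0)//.
  by rewrite invf_le1.
have k1 := H1 _ sx0 sxT.
have k2 : h (enorm x)^-1 <= c * s^-1 `^ p * h (s^-1 * (enorm x)^-1).
  by apply: H2; rewrite ?invr_gt0 ?s0 ?invf_le1.
have k3 : K x <= h (enorm x)^-1.
  by apply: (dir_concentration_le ANb); rewrite ?invr_gt0// invrK.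
have k4 := dir_concentrationZ_le_add ANb x s1.
have k5 := H1 _ x0 xT.
have U0 : 0 <= U x.
  by rewrite addr_ge0 ?(quad_form_ge0 ANb)//; apply: Rintegral_ge0 => z _; exact: exprn_ge0.
have D0 : 0 < 2 * (c * c) by lra.
have k6 : 2 * h (enorm x)^-1 <= K (s *: x).
  rewrite powR_inv// sp -Ei in k2.
  have : 2 * (c * c) * h (enorm x)^-1 <= c * h (enorm (s *: x))^-1.
    rewrite mulrC -ler_pdivlMr//; apply: le_trans k2 _.
    by rewrite mulrAC.
  move=> /le_trans /(_ (ler_wpM2l _ k1)) H.
  have : c * c * (2 * h (enorm x)^-1) <= c * c * K (s *: x) by have := H; lra.
  by rewrite ler_pM2l//; lra.
have k7 : K x <= (s ^+ 2 - 1) * U x by lra.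
apply: le_trans k5 _; apply: (@le_trans _ _ (c * ((s ^+ 2 - 1) * U x))).
  by rewrite ler_wpM2l//; lra.
by rewrite mulrA ler_wpM2r// le_max lexx orbT.
Qed.

Lemma C8_C4 : C8 A N -> C4 A N b.
Proof.
move=> /C8_dir_truncated[T [c [T0 [c1 H]]]].
exists T, (2 * c); split=> //; split; first by lra.
move=> x xT; have e0 := gt0_inve_lt T0 xT; rewrite inve_lt_EFin// in xT.
apply: le_trans (Psi_star_le _ ANb e0) _; rewrite -mulrA ler_wpM2l//.
by apply: H; rewrite -?enorm_gt0.
Qed.

Lemma C8_C3 : C8 A N -> C3 A N b.
Proof.
move=> H8; have [T [c [T0 [c1 H]]]] := C8_dir_truncated H8.
have /C8_dir[T' [c' [p [T'0 [c'1 [/andP[p0 p2] [H1 H2]]]]]]] := H8.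
have C1 := Psi_star_const_ge1.
(* One constant for both halves: the first needs [16 * c] (2 from [Psi_star <= 2 h], 8 from
   [U <= 8 psi]), the second [2 * c' * C0]. *)
pose D := 16 * c * c' * C0.
have D1 : 1 <= D by rewrite /D !mulr_ege1// ler1n.
exists (Order.min T T'), D^-1, p; split; first by rewrite lt_min T0.
have D0 : 0 < D by lra.
split; first by rewrite invr_gt0 D0 invf_le1.
split; first by rewrite p0.
have min0 : (0 < Order.min T T')%E by rewrite lt_min T0.
split=> [x xT|t r t1 rT].
  have e0 := gt0_inve_lt min0 xT; rewrite inve_lt_EFin// lt_min in xT.
  have /andP[xT1 xT2] := xT.
  rewrite mulrC ler_pdivrMr//.
  apply: le_trans (Psi_star_le _ ANb e0) _.
  have x0 : x != 0 by rewrite -enorm_gt0.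
  have := H _ x0 xT1; have := dir_truncated_le_RePsi b ANb x; have := RePsi_ge0 b ANb x.
  move=> a1 a2 a3; apply: (@le_trans _ _ (16 * c * psi x)).
    have : c * U x <= c * (8 * psi x) by rewrite ler_wpM2l//; lra.
    lra.
  rewrite [leRHS](_ : _ = 16 * c * psi x * (c' * C0)); last by rewrite /D; ring.
  by apply: ler_peMr; [rewrite !mulr_ge0//; lra|rewrite mulr_ege1].
have r0 := gt0_inve_lt min0 rT; rewrite inve_lt_EFin// lt_min in rT.
have /andP[rT1 rT2] := rT.
have t0 : 0 < t by lra.
rewrite -mulrA mulrC ler_pdivrMr// -ler_pdivlMl ?powR_gt0//.
apply: le_trans (Psi_star_le _ ANb r0) _.
have := H2 t^-1 r^-1; rewrite invr_gt0 t0 invf_le1// t1 invr_gt0 => /(_ isT r0 rT2).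
have tr0 : 0 < t * r by rewrite mulr_gt0.
have := concentration_le_Psi_star b ANb tr0; rewrite -/C0 invfM => k1 k2.
have P0 : 0 <= Psi_star (t * r).
  apply: le_trans (RePsi_le_Psi_star b ANb tr0 (_ : enorm 0 <= _)); first exact: RePsi_ge0.
  by rewrite /enorm dotp0l sqrtr0 ltW.
apply: (@le_trans _ _ (2 * (c' * t^-1 `^ p * (C0 * Psi_star (t * r))))).
  rewrite ler_wpM2l//; apply: le_trans k2 _; rewrite ler_wpM2l//.
  by rewrite mulr_ge0 ?powR_ge0//; lra.
rewrite powR_inv// mulrC.
have -> : c' / t `^ p * (C0 * Psi_star (t * r)) * 2 =
   (t `^ p)^-1 * (Psi_star (t * r) * (2 * c' * C0)) by ring.
rewrite ler_wpM2l ?invr_ge0 ?powR_ge0// ler_wpM2l// /D.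
rewrite ler_wpM2r//; first lra.
by rewrite ler_wpM2r//; lra.
Qed.

Lemma C3_C8 : C3 A N b -> C8 A N.
Proof.
move=> [T [c [p [T0 [/andP[c0 c1] [/andP[p0 p2] [H1 H2]]]]]]].
have C1 := Psi_star_const_ge1.
(* Each half passes from [h] to [Psi_star] through [C0], uses (C3) at the price of [1 / c], and
   returns through an upper bound with factor 2. *)
pose D := 2 * C0 / c.
have D1 : 1 <= D by rewrite /D ler_pdivlMr//; lra.
apply/C8_dir; exists T, D, p; do 2 split=> //; split; first by rewrite p0.
split=> [x x0 xT|t r /andP[t0 t1] r0 rT].
  have e0 : 0 < enorm x by rewrite enorm_gt0.
  have k1 := concentration_le_Psi_star b ANb e0; rewrite -/C0 in k1.
  have := H1 x; rewrite inve_lt_EFin// => /(_ xT) k2.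
  have k3 := RePsi_le_dir b ANb x.
  apply: le_trans k1 _; rewrite /D mulrAC ler_pdivlMr//.
  have : C0 * (c * Psi_star (enorm x)) <= C0 * (2 * K x) by rewrite ler_wpM2l//; lra.
  lra.
have tr0 : 0 < (t * r)^-1 by rewrite invr_gt0 mulr_gt0.
have r0' : 0 < r^-1 by rewrite invr_gt0.
have k1 := concentration_le_Psi_star b ANb r0'; rewrite -/C0 invrK in k1.
have k2 := Psi_star_le b ANb tr0; rewrite invrK in k2.
have := H2 t^-1 r^-1; rewrite invf_ge1// inve_lt_EFin// invrK => /(_ t1 rT).
rewrite powR_inv// -invfM => k3.
have tp : 0 < t `^ p by rewrite powR_gt0.
apply: le_trans k1 _; apply: (@le_trans _ _ (C0 * (t `^ p / c * Psi_star (t * r)^-1))).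
  rewrite ler_wpM2l//; first lra.
  apply: le_trans (ler_wpM2l _ k3); last by rewrite divr_ge0 ?ltW.
  rewrite [leRHS](_ : _ = Psi_star r^-1)//.
  by field; rewrite !gt_eqF.
have -> : D * t `^ p * h (t * r) = C0 * (t `^ p / c * (2 * h (t * r))) by rewrite /D; ring.
rewrite ler_wpM2l//; first lra.
by rewrite ler_wpM2l// divr_ge0 ?ltW.
Qed.

(** Doubling [x] adds at least [(3 / 4) U (2 x)] to [K], where [3 / 4 = 1 - 2 ^ -2]; as [U]
    dominates [K] up to [D], this is a gain by the factor [q], and [power_scaling] gives an
    exponent. Since [K] and [h] are comparable, a single direction suffices for the scaling of
    [h]. *)
Lemma C4_C8 : C4 A N b -> C8 A N.
Proof.
move=> [T [c [T0 [c1 H]]]].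
have C1 := Psi_star_const_ge1.
have [D [D1 HU]] : exists D, 1 <= D /\
    forall x, x != 0 -> ((enorm x)^-1%:E < T)%E -> h (enorm x)^-1 <= D * U x.
  exists (C0 * c); split; first by rewrite mulr_ege1.
  move=> x x0 xT; have e0 : 0 < enorm x by rewrite enorm_gt0.
  apply: le_trans (concentration_le_Psi_star b ANb e0) _.
  rewrite -/C0 -mulrA ler_wpM2l//; first lra.
  by apply: H; rewrite inve_lt_EFin.
have D0 : 0 < D by lra.
have U0 x : 0 <= U x.
  by rewrite addr_ge0 ?(quad_form_ge0 ANb)//; apply: Rintegral_ge0 => z _; exact: exprn_ge0.
pose v := bvec (Ordinal n0) : 'cV[R]_n.
have Ev r : 0 < r -> enorm (r^-1 *: v) = r^-1.
  by move=> r0; rewrite enormZ enorm_bvec mulr1 gtr0_norm ?invr_gt0.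
have v0 r : 0 < r -> r^-1 *: v != 0 by move=> r0; rewrite -enorm_gt0 Ev// invr_gt0.
pose q := 1 + 3 / (4 * D).
have q1 : 1 < q by rewrite ltrDl divr_gt0//; lra.
have q2 : q <= 2 by rewrite /q -lerBrDl ler_pdivrMr; lra.
have [|||||p p2 Hp] := @power_scaling _ (fun r => K (r^-1 *: v)) T 2 q _ q1.
- by lra.
- by rewrite expr2; lra.
- by move=> r _; exact: dir_concentration_ge0.
- move=> r s r0 rs; have s0 : 0 < s by exact: lt_le_trans rs.
  have sr : 1 <= s / r by rewrite ler_pdivlMr// mul1r.
  have -> : r^-1 *: v = (s / r) *: (s^-1 *: v).
    by rewrite scalerA mulrAC divff ?gt_eqF// mul1r.
  apply: le_trans (dir_concentrationZ_ge_add ANb _ sr).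
  rewrite lerDl mulr_ge0// subr_ge0 invf_le1 ?expr_ge1 ?exprn_gt0//; lra.
- move=> r r0 rT; have r20 : 0 < r / 2 by lra.
  have E : (r / 2)^-1 *: v = 2 *: (r^-1 *: v).
    by rewrite scalerA invfM invrK mulrC.
  have k1 := HU _ (v0 _ r20); rewrite Ev// invrK in k1.
  have {}k1 := k1 (le_lt_trans _ rT); rewrite lee_fin in k1.
  have {}k1 : h (r / 2) <= D * U ((r / 2)^-1 *: v) by apply: k1; lra.
  have k2 : K ((r / 2)^-1 *: v) <= h (r / 2).
    by apply: (dir_concentration_le ANb) => //; rewrite Ev.
  have k3 := @dir_concentrationZ_ge_add _ _ A N ANb 2 (r^-1 *: v) (ler1n _ 2).
  rewrite -E in k3.
  set k := K (r^-1 *: v) in k3 *; set k' := K ((r / 2)^-1 *: v) in k2 k3 *.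
  have kk : k <= k' by have := U0 ((r / 2)^-1 *: v); move: k3; rewrite expr2; lra.
  have k4 : 3 / (4 * D) * k' <= k' - k.
    apply: (@le_trans _ _ (3 / 4 * U ((r / 2)^-1 *: v))); last by move: k3; rewrite expr2; lra.
    rewrite [leLHS](_ : _ = 3 / 4 * (k' / D)); last by field; rewrite gt_eqF.
    by rewrite ler_wpM2l// ler_pdivrMr// mulrC; exact: le_trans k2 k1.
  rewrite mulrDl mul1r; apply: le_trans (_ : k + 3 / (4 * D) * k' <= _); last by lra.
  by rewrite lerD2l ler_wpM2l// divr_ge0//; lra.
apply/C8_dir; exists T, (D * q), p; split=> //.
split; first by rewrite mulr_ege1// ltW.
split=> //; split=> [x x0 xT|t r t1 r0 rT].
  apply: le_trans (HU _ x0 xT) _.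
  apply: (@le_trans _ _ (D * K x)); first by rewrite ler_wpM2l ?dir_truncated_le//; lra.
  rewrite ler_wpM2r ?dir_concentration_ge0// ler_peMr//; lra.
have /andP[t0 _] := t1.
have k1 := HU _ (v0 _ r0); rewrite Ev// invrK in k1.
have k2 := Hp t r t1 r0 rT.
apply: le_trans (k1 rT) _.
apply: (@le_trans _ _ (D * K (r^-1 *: v))); first by rewrite ler_wpM2l ?dir_truncated_le//; lra.
rewrite -2!mulrA ler_wpM2l//; first lra.
apply: le_trans k2 _; rewrite -mulrA ler_wpM2l//; first lra.
rewrite ler_wpM2l ?powR_ge0//; apply: (dir_concentration_le ANb); rewrite ?mulr_gt0//.
by rewrite Ev ?mulr_gt0.
Qed.

End conditions_equiv.

(** * (C2) implies (C8) *)

Section boxes.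
Context {R : realType} {n : nat}.
Implicit Types (x z : 'cV[R]_n) (a : R).

Definition cube x a : set 'cV[R]_n := [set z | forall i, `|z i 0 - x i 0| < a].

Lemma cubeE x a :
  cube x a = [set z : 'cV[R]_n | forall i, `](x i 0 - a), (x i 0 + a)[%classic (z i 0)].
Proof.
by apply/seteqP; split=> z H i; have := H i; rewrite /= in_itv/= ltr_distl.
Qed.

Lemma measurable_cube x a : measurable (cube x a).
Proof.
rewrite cubeE; apply: (@measurable_box R n
  (fun i => `](x i 0 - a), (x i 0 + a)[%classic)) => i; exact: measurable_itv.
Qed.

Lemma lebesgue_cube x a : 0 <= a -> lebesgue_cV (cube x a) = ((a *+ 2) ^+ n)%:E.
Proof.
move=> a0; rewrite cubeE.
rewrite (@lebesgue_cV_box R n (fun i => `](x i 0 - a), (x i 0 + a)[%classic)) => [|i];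
  last exact: measurable_itv.
under eq_bigr do rewrite lebesgue_measure_itv/= lte_fin.
rewrite (eq_bigr (fun=> (a *+ 2)%:E)) => [|i _].
  by rewrite prodEFin prodr_const card_ord.
case: ifPn => [_|]; first by rewrite -EFinB; congr EFin; rewrite mulr2n; lra.
by rewrite -leNgt => h; congr EFin; rewrite mulr2n; lra.
Qed.

Lemma enorm_cube a x z : 0 <= a -> cube x a z -> enorm (z - x) <= n%:R * a.
Proof.
move=> a0 zQ; apply: enorm_le_coord => // i.
by rewrite !mxE; exact/ltW/zQ.
Qed.

End boxes.

Section C2_C8.
Context {R : realType} {n : nat}.
Variables (A : 'M[R]_n) (N : {measure set 'cV[R]_n -> \bar R}) (b : 'cV[R]_n).
Hypothesis n0 : (0 < n)%N.
Hypothesis ANb : generating_triplet A N.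
Hypothesis h0 : concentration A N r @[r --> 0^'+] --> +oo.
Implicit Types (x y z : 'cV[R]_n) (r s t : R) (T : \bar R).

Local Notation K := (dir_concentration A N).
Local Notation U := (dir_truncated A N).
Local Notation psi := (RePsi A N b).
Local Notation h := (concentration A N).
Local Notation hinv := (concentration_inv A N).

(** Time [1 / h r] and radius [r] determine each other, so a threshold on one becomes a threshold on
    the other. The case [T = +oo] is separate: the resulting threshold is again infinite. *)
Lemma concentration_threshold T : (0 < T)%E -> exists2 T', (0 < T')%E &
  forall r, 0 < r -> (r%:E < T')%E -> ((h r)^-1%:E < T)%E.
Proof.
case: T => [T|_|//]; last by exists +oo%E => // r _ _; rewrite ltry.
rewrite lte_fin => T0; have Ti : 0 < T^-1 by rewrite invr_gt0.
have [i0 hi] := concentration_invP ANb h0 Ti.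
exists (hinv T^-1)%:E; first by rewrite lte_fin.
move=> r r0; rewrite !lte_fin => /(concentration_lt ANb h0 r0); rewrite hi => hr.
by rewrite -[ltRHS]invrK ltf_pV2// posrE ?invr_gt0// (lt_trans _ hr)// invr_gt0.
Qed.

Lemma concentration_inv_threshold T : (0 < T)%E -> exists2 T', (0 < T')%E &
  forall t, 0 < t -> (t%:E < T')%E -> ((hinv t^-1)%:E < T)%E.
Proof.
case: T => [T|_|//]; last by exists +oo%E => // r _ _; rewrite ltry.
rewrite lte_fin => T0; have hT := concentration_gt0 ANb h0 T0.
exists (h T)^-1%:E; first by rewrite lte_fin invr_gt0.
move=> t t0; rewrite !lte_fin => tT.
have ti : 0 < t^-1 by rewrite invr_gt0.
have [i0 hi] := concentration_invP ANb h0 ti.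
rewrite ltNge; apply/negP => /(concentration_le ANb T0); rewrite hi leNgt => /negP; apply.
by rewrite -[ltLHS]invrK ltf_pV2// posrE ?invr_gt0.
Qed.

Lemma measurable_expR_RePsi t :
  measurable_fun setT (EFin \o (fun z => expR (- t * psi z))).
Proof.
apply/measurable_EFinP; apply: (measurableT_comp (@measurable_expR R)).
by apply: measurable_funM => //; exact: measurable_RePsi.
Qed.

(** The cube of half-side [1 / (n s)] lies in the ball of radius [1 / s], where
    [t psi <= 2 t h s <= 2 k]. Its volume [(2 / (n s)) ^ n] is rounded down. *)
Lemma cube_lower_bound t s k M : 0 < t -> 0 < s -> t * h s <= k ->
  (\int[lebesgue_cV]_z (expR (- t * psi z))%:E <= M%:E)%E ->
  expR (- (2 * k)) * (n%:R * s)^-1 ^+ n <= M.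
Proof.
move=> t0 s0 tk HM; have n1 : 1 <= n%:R :> R by rewrite ler1n.
have ns : 0 < n%:R * s by rewrite mulr_gt0//; lra.
set a := (n%:R * s)^-1; have a0 : 0 < a by rewrite invr_gt0.
rewrite -lee_fin; apply: le_trans HM.
have mQ := @measurable_cube R n 0 a.
pose I : 'cV[R]_n -> R := \1_(cube 0 a).
have mI : measurable_fun setT (EFin \o I) by apply/measurable_EFinP/measurable_indic.
apply: (@le_trans _ _ (\int[lebesgue_cV]_z ((expR (- (2 * k)))%:E * (EFin \o I) z))%E).
  have IE : (\int[lebesgue_cV]_z (EFin \o I) z = ((a *+ 2) ^+ n)%:E)%E.
    by rewrite integral_indic// setIT; exact: (lebesgue_cube _ (ltW a0)).
  rewrite ge0_integralZl//; last by move=> z _; rewrite lee_fin /I indicE.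
  rewrite IE -EFinM lee_fin.
  rewrite ler_wpM2l ?expR_ge0// ler_pXn2r ?nnegrE ?mulrn_wge0 ?(ltW a0)//.
  by rewrite mulr2n lerDl ltW.
apply: ge0_le_integral => //.
- by move=> z _; rewrite -EFinM lee_fin mulr_ge0 ?expR_ge0.
- exact: measurable_funeM.
- exact: measurable_expR_RePsi.
- move=> z _; rewrite -EFinM lee_fin /I indicE.
  have [|_] := boolP (z \in cube 0 a); last by rewrite mulr0 expR_ge0.
  rewrite inE mulr1 ler_expR => /(enorm_cube (ltW a0)); rewrite subr0 => za.
  have : psi z <= 2 * h s.
    apply: (RePsi_le b ANb s0); apply: le_trans za _.
    by rewrite /a invfM mulrA divff ?mul1r// gt_eqF//; lra.
  rewrite mulNr lerN2 => /(ler_wpM2l (ltW t0)); lra.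
Qed.

(** The lower bound taken at radius [hinv (2 / t)] meets the upper bound in terms of [hinv (1 / t)],
    so the [n]-th power of their ratio is bounded. The parameter [k] is 1 when starting from (C2)
    and 2 when starting from a density, which controls the integral at time [2 t]. *)
Lemma cube_doubling c k : 0 < c -> 0 < k -> exists2 a, 2 <= a & forall t, 0 < t ->
  (\int[lebesgue_cV]_z (expR (- (k * t) * psi z))%:E <= (c * (hinv t^-1) ^- n)%:E)%E ->
  hinv t^-1 <= a * hinv (2 * t^-1).
Proof.
move=> c0 k0; have n1 : 1 <= n%:R :> R by rewrite ler1n.
pose B := c * expR (4 * k) * n%:R ^+ n.
(* No [n]-th root is taken: [r / s] is either at most 1 or at most its [n]-th power. The summand 2
   lets [power_scaling] be applied with gain 2. *)
exists (2 + B); first by rewrite lerDl !mulr_ge0 ?expR_ge0 ?exprn_ge0 ?(ltW c0).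
move=> t t0 H; have ti : 0 < t^-1 by rewrite invr_gt0.
have [r0 hr] := concentration_invP ANb h0 ti.
have ti2 : 0 < 2 * t^-1 by lra.
have [s0 hs] := concentration_invP ANb h0 ti2.
set r := hinv t^-1 in r0 hr H *; set s := hinv (2 * t^-1) in s0 hs *.
have := @cube_lower_bound (k * t) s (2 * k) _ (mulr_gt0 k0 t0) s0 _ H.
rewrite hs -mulrA [t * _]mulrCA mulfV ?gt_eqF// mulr1 [k * 2]mulrC lexx => /(_ isT) H2.
have rs0 : 0 < r / s by rewrite divr_gt0.
have : (r / s) ^+ n <= B.
  rewrite /B -ler_pdivrMr ?exprn_gt0//; last lra.
  rewrite -ler_pdivrMr ?expR_gt0// -expRN mulrC.
  move: H2; rewrite ler_pdivlMr ?exprn_gt0//; apply: le_trans.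
  rewrite (_ : 2 * (2 * k) = 4 * k); last by ring.
  rewrite !exprVn !exprMn !exprVn !invfM le_eqVlt; apply/orP; left; apply/eqP; ring.
have B0 : 0 <= B by rewrite !mulr_ge0 ?expR_ge0 ?exprn_ge0 ?(ltW c0).
move=> rsB; rewrite -ler_pdivrMr//.
have [rs1|rs1] := leP (r / s) 1; first lra.
have : r / s <= (r / s) ^+ n by rewrite -[leLHS]expr1 ler_weXn2l// ltW.
lra.
Qed.

(** At time [t = 1 / h r] the doubling of [hinv] reads [h (r / a) >= 2 h r], the one-step gain of
    [power_scaling]. *)
Lemma C2_scaling c T :
  0 < c -> (0 < T)%E -> (forall t, 0 < t -> (t%:E < T)%E ->
    (\int[lebesgue_cV]_z (expR (- t * psi z))%:E <= (c * (hinv t^-1) ^- n)%:E)%E) ->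
  exists T' (p : R), [/\ (0 < T')%E, 0 < p <= 2 &
    forall t r, 0 < t <= 1 -> 0 < r -> (r%:E < T')%E -> h r <= 2 * t `^ p * h (t * r)].
Proof.
move=> c0 T0 H; have [T' T'0 hT'] := concentration_threshold T0.
have [a a2 Ha] := cube_doubling c0 ltr01.
have [||||||p p2 Hp] := @power_scaling _ h T' a 2.
- lra.
- lra.
- have : 2 * 2 <= a * a by rewrite ler_pM.
  by rewrite expr2; lra.
- by move=> r _; exact: concentration_ge0.
- by move=> r s; exact: (concentration_le ANb).
- move=> r r0 rT; have hr0 := concentration_gt0 ANb h0 r0.
  have t0 : 0 < (h r)^-1 by rewrite invr_gt0.
  have := Ha _ t0; rewrite mul1r => /(_ (H _ t0 (hT' _ r0 rT))); rewrite invrK (concentrationK ANb h0 r0) => ra.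
  have h20 : 0 < 2 * h r by lra.
  have [s0 hs] := concentration_invP ANb h0 h20; rewrite -[leLHS]hs.
  apply: (concentration_le ANb); first by rewrite divr_gt0//; lra.
  by rewrite ler_pdivrMr 1?mulrC//; lra.
by exists T', p; split.
Qed.

(* If [K x] were small compared with [h (1 / |x|)], then [psi] would be bounded by
   [8 h (1 / |x|)] on the disjoint cubes centred at [x, 2 x, ..., L x]. *)
Lemma C2_nondegenerate c T :
  0 < c -> (0 < T)%E -> (forall t, 0 < t -> (t%:E < T)%E ->
    (\int[lebesgue_cV]_z (expR (- t * psi z))%:E <= (c * (hinv t^-1) ^- n)%:E)%E) ->
  exists T' (c' : R), [/\ (0 < T')%E, 1 <= c' &
    forall x, x != 0 -> ((enorm x)^-1%:E < T')%E -> h (enorm x)^-1 <= c' * K x].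
Proof.
move=> c0 T0 H; have [T' T'0 hT'] := concentration_threshold T0.
have n1 : 1 <= n%:R :> R by rewrite ler1n.
(* Enough cubes that their total contribution, each [exp (- 8)] times the volume [(2 n r) ^ - n],
   exceeds the assumed bound [c r ^ - n]. *)
pose L := (Num.truncn (c * (expR 8 * (n%:R * 2) ^+ n))).+1.
have LB : c * (expR 8 * (n%:R * 2) ^+ n) < L%:R by exact: truncnS_gt.
exists T', (L%:R ^+ 2); split => //; first by rewrite expr_ge1// ler1n.
move=> x x0 xT; have e0 : 0 < enorm x by rewrite enorm_gt0.
have r0 : 0 < (enorm x)^-1 by rewrite invr_gt0.
set r := (enorm x)^-1 in xT r0 *.
rewrite leNgt; apply/negP => KL.
have hr0 := concentration_gt0 ANb h0 r0.
have t0 : 0 < (h r)^-1 by rewrite invr_gt0.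
have := H _ t0 (hT' _ r0 xT); rewrite invrK (concentrationK ANb h0 r0).
apply/negP; rewrite -ltNge.
(* A coordinate carrying a fixed share of [|x|]: along it, consecutive centres are at least one side
   of a cube apart. *)
have [i xi] : exists i, enorm x / (n%:R * 2) <= `|x i 0|.
  apply: contrapT => /forallNP xi.
  have : enorm x <= n%:R * (enorm x / (n%:R * 2)).
    apply: enorm_le_coord => [|i]; first by rewrite divr_ge0 ?mulr_ge0 ?(ltW e0).
    by have /negP := xi i; rewrite -ltNge => /ltW.
  have -> : n%:R * (enorm x / (n%:R * 2)) = enorm x / 2 by field; rewrite gt_eqF//; lra.
  lra.
pose a := (n%:R * 4 * r)^-1.
have a0 : 0 < a by rewrite invr_gt0 !mulr_gt0//; lra.
pose Q (k : nat) := cube (k%:R *: x) a.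
have mQ k : measurable (Q k) by exact: measurable_cube.
(* [8 = 2 * 2 + 2 * 2]: both [psi (z - k x)] and [psi (k x)] are at most [2 h r], the latter because
   [k ^ 2 K x <= L ^ 2 K x < h r]; [k = 0] is treated apart. *)
have psiQ k z : (k < L)%N -> Q k z -> psi z <= 8 * h r.
  move=> kL zQ; rewrite -(subrK (k%:R *: x) z).
  apply: le_trans (RePsiD_le b ANb _ _) _.
  have : psi (z - k%:R *: x) <= 2 * h r.
    apply: (RePsi_le b ANb r0); apply: le_trans (enorm_cube (ltW a0) zQ) _.
    rewrite /a -mulrA invfM mulrA divff ?mul1r ?gt_eqF//; last lra.
    by rewrite lef_pV2 ?posrE//; lra.
  have : psi (k%:R *: x) <= 2 * h r.
    apply: le_trans (RePsi_le_dir b ANb _) _; rewrite ler_wpM2l//.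
    have [->|k0] := posnP k.
      rewrite scale0r; apply: (dir_concentration_le ANb) => //.
      by rewrite /enorm dotp0l sqrtr0 invr_ge0 ltW.
    apply: le_trans (dir_concentrationZ_le ANb _ _) _; first by rewrite ler1n.
    apply: le_trans (ltW KL); rewrite ler_wpM2r ?dir_concentration_ge0//.
    by rewrite ler_sqr ?nnegrE// ler_nat ltnW.
  lra.
have disj k l z : (k < l)%N -> Q k z -> Q l z -> False.
  move=> kl /(_ i) zk /(_ i) zl; rewrite !mxE in zk zl.
  have : `|l%:R * x i 0 - k%:R * x i 0| < a + a.
    rewrite -(subrK (z i 0) (l%:R * x i 0)) -addrA.
    apply: le_lt_trans (ler_normD _ _) _; rewrite distrC; exact: ltrD.
  rewrite -mulrBl normrM -natrB ?(ltnW kl)// normr_nat.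
  have : `|x i 0| <= (l - k)%:R * `|x i 0|.
    by rewrite ler_peMl// ler1n subn_gt0.
  have : a + a = enorm x / (n%:R * 2).
    by rewrite /a /r; field; rewrite !gt_eqF//; lra.
  lra.
apply: (@lt_le_trans _ _ (\int[lebesgue_cV]_z
    ((expR (- 8))%:E * (\sum_(k < L) \1_(Q k) z)%:E))%E).
  have mI k : measurable_fun setT (EFin \o (\1_(Q k) : 'cV[R]_n -> R)).
    by apply/measurable_EFinP/measurable_indic.
  rewrite ge0_integralZl//; first last.
  - by move=> z _; rewrite lee_fin sumr_ge0.
  - by apply/measurable_EFinP/measurable_sum => k; exact: measurable_indic.
  under eq_integral do rewrite -sumEFin.
  rewrite ge0_integral_sum//; last by move=> k; exact: mI.
  rewrite (eq_bigr (fun=> ((a *+ 2) ^+ n)%:E)); last first.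
    by move=> k _; rewrite integral_indic// setIT; exact: (lebesgue_cube _ (ltW a0)).
  rewrite sumEFin sumr_const card_ord -EFinM lte_fin.
  have -> : a *+ 2 = (n%:R * 2 * r)^-1.
    by rewrite /a mulr2n; field; rewrite !gt_eqF//; lra.
  have E0 : (0 : R) < expR 8 * (n%:R * 2) ^+ n.
    by rewrite mulr_gt0 ?expR_gt0 ?exprn_gt0//; lra.
  rewrite [ltRHS](_ : _ = L%:R / (expR 8 * (n%:R * 2) ^+ n) / r ^+ n).
    by rewrite ltr_pM2r ?invr_gt0 ?exprn_gt0// ltr_pdivlMr.
  by rewrite -[_ *+ L]mulr_natl expRN exprVn exprMn !invfM; ring.
apply: ge0_le_integral => //.
- by move=> z _; rewrite -EFinM lee_fin mulr_ge0 ?expR_ge0 ?sumr_ge0.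
- apply: measurable_funeM; apply/measurable_EFinP/measurable_sum => k.
  by apply: measurable_indic.
- exact: measurable_expR_RePsi.
- move=> z _; rewrite -EFinM lee_fin.
  have [[k zk]|nk] := pselect (exists k : 'I_L, Q k z); last first.
    rewrite big1 ?mulr0 ?expR_ge0// => k _; rewrite indicE memNset// => zk.
    by apply: nk; exists k.
  rewrite (bigD1 k)//= big1 ?addr0; last first.
    move=> l lk; rewrite indicE memNset// => zl.
    by have [/disj|/disj|/val_inj/eqP] := ltngtP l k; [exact|exact|exact/negP].
  rewrite indicE mem_set// mulr1 ler_expR mulNr lerN2 ler_pdivrMl//.
  by rewrite mulrC; exact: (psiQ k).
Qed.

Lemma C2_C8 : C2 A N b -> C8 A N.
Proof.
move=> [T [c [T0 [c0 H]]]].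
have [T1 [p [T10 p2 H1]]] := C2_scaling c0 T0 H.
have [T2 [c' [T20 c'1 H2]]] := C2_nondegenerate c0 T0 H.
apply/(C8_dir n0 ANb); exists (Order.min T1 T2), (2 * c'), p.
split; first by rewrite lt_min T10.
split; first by lra.
split=> //; split=> [x x0|t r t1 r0]; rewrite lt_min => /andP[rT1 rT2].
  apply: le_trans (H2 _ x0 rT2) _; rewrite ler_wpM2r ?dir_concentration_ge0//; lra.
apply: le_trans (H1 _ _ t1 r0 rT1) _.
rewrite ler_wpM2r ?concentration_ge0// ler_wpM2r ?powR_ge0//; lra.
Qed.

End C2_C8.

(** * (C8) implies (C2) *)

Section tail.
Context {R : realType}.
Implicit Types (y w k : R).

(** The [m]-th power of [exp (y / m) >= y / m], inverted. *)
Lemma expRN_le_pow y (m : nat) : 0 < y -> (0 < m)%N -> expR (- y) <= (m%:R / y) ^+ m.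
Proof.
move=> y0 m0; have mR : 0 < m%:R :> R by rewrite ltr0n.
rewrite -[m%:R / y]invrK invf_div exprVn expRN lef_pV2 ?posrE ?expR_gt0 ?exprn_gt0 ?divr_gt0//.
have -> : expR y = expR (y / m%:R) ^+ m.
  by rewrite -expRM_natl; congr expR; rewrite mulrC divfK// gt_eqF.
rewrite ler_pXn2r ?nnegrE ?expR_ge0 ?divr_ge0 ?(ltW y0)//.
by apply: le_trans (expR_ge1Dx _); rewrite lerDr.
Qed.

Lemma dyadic_shell w : 1 <= w -> exists k : nat, 2 ^+ k <= w < 2 ^+ k.+1.
Proof.
move=> w1; pose m := Num.truncn w.
have m0 : (0 < m)%N by rewrite truncn_gt0.
exists (trunc_log 2 m); apply/andP; split.
  apply: (@le_trans _ _ m%:R); last by rewrite truncn_le//; lra.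
  by rewrite -natrX ler_nat trunc_logP.
apply: (@lt_le_trans _ _ m.+1%:R); first exact: truncnS_gt.
by rewrite -natrX ler_nat trunc_log_ltn.
Qed.

Lemma nneseries_geometric_le : (\sum_(k <oo) (2 ^- k)%:E <= 2%:E :> \bar R)%E.
Proof.
have H m : (\sum_(0 <= k < m) (2 ^- k)%:E <= (2 - 2 * 2 ^- m)%:E :> \bar R)%E.
  elim: m => [|m IH]; first by rewrite big_geq// expr0 invr1 mulr1 subrr.
  rewrite big_nat_recr//= (le_trans (leeD2r _ IH))// -EFinD lee_fin exprS invfM.
  by set u := 2 ^- m; lra.
apply: lime_le; first by apply: is_cvg_nneseries => k _ _; rewrite lee_fin invr_ge0 exprn_ge0.
apply: nearW => m; apply: le_trans (H m) _.
by rewrite lee_fin gerBl mulr_ge0// invr_ge0 exprn_ge0.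
Qed.

(** The radius enters only through [r ^ - n], so the constant is uniform in time when this is
    applied. As [p m >= n + 1], on the dyadic shell [j] the integrand is at most a multiple of
    [2 ^ - ((n + 1) j)], against a cube volume of order [2 ^ (n j)]: the series is geometric with
    sum at most 2. *)
Lemma integral_expR_le n (f : 'cV[R]_n -> R) k p r : 0 < k -> 0 < p -> 0 < r ->
  measurable_fun setT f -> (forall z, 0 <= f z) ->
  (forall z, 1 <= r * enorm z -> k * (r * enorm z) `^ p <= f z) ->
  (\int[lebesgue_cV]_z (expR (- f z))%:E <=
    (2 * 4 ^+ n * (1 + ((Num.truncn (n.+1%:R / p)).+1%:R / k)
       ^+ (Num.truncn (n.+1%:R / p)).+1) * r ^- n)%:E)%E.
Proof.
move=> k0 p0 r0 mf f0 H; set m := (Num.truncn _).+1.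
have m0 : (0 < m)%N by [].
set C := 1 + _ ^+ m.
have mR : 0 < m%:R :> R by rewrite ltr0n.
have C1 : 1 <= C by rewrite lerDl exprn_ge0// divr_ge0 ?ltW.
have pm : n.+1%:R <= p * m%:R.
  by rewrite mulrC -ler_pdivrMr//; apply/ltW/truncnS_gt.
pose a (j : nat) := 2 ^+ j.+1 / r.
have a0 j : 0 < a j by rewrite divr_gt0 ?exprn_gt0.
pose I j : 'cV[R]_n -> R := \1_(cube 0 (a j)).
pose g (j : nat) (z : 'cV[R]_n) : \bar R :=
  ((C * 2 ^- (n.+1 * j))%:E * (EFin \o I j) z)%E.
have C0 : 0 < C by lra.
have g0 j z : (0 <= g j z)%E by rewrite mule_ge0// lee_fin ?mulr_ge0 ?invr_ge0 ?exprn_ge0 ?(ltW C0).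
have mI j : measurable_fun setT (EFin \o I j).
  by apply/measurable_EFinP/measurable_indic; exact: measurable_cube.
have mg j : measurable_fun setT (g j) by exact: measurable_funeM.
have gS j z : (g j z <= \sum_(j <oo) g j z)%E.
  apply: (@le_trans _ _ (\sum_(0 <= i < j.+1) g i z)%E); last exact: nneseries_lim_ge.
  by rewrite big_nat_recr//= leeDr// sume_ge0.
(* Each shell is enlarged to a centred cube; the overlaps only add nonnegative terms. *)
have fg z : ((expR (- f z))%:E <= \sum_(j <oo) g j z)%E.
  have [w1|w1] := leP 1 (r * enorm z).
    have [j /andP[j1 j2]] := dyadic_shell w1.
    apply: (@le_trans _ _ (g j z)); last exact: gS.
    rewrite /g /I /= indicE mem_set; last first.
      move=> i; rewrite mxE subr0; apply: le_lt_trans (normr_coord_le _ _) _.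
      by rewrite /a ltr_pdivlMr// mulrC.
    rewrite mule1 lee_fin; set w := r * enorm z in w1 j1 j2.
    have w0 : 0 < w by lra.
    have y0 : 0 < k * w `^ p by rewrite mulr_gt0// powR_gt0.
    apply: (@le_trans _ _ (expR (- (k * w `^ p)))); first by rewrite ler_expR lerN2 H.
    apply: le_trans (expRN_le_pow y0 m0) _.
    have E : (w `^ p) ^+ m = w `^ (p * m%:R) by rewrite powRrM powR_mulrn ?powR_ge0.
    rewrite invfM mulrA exprMn [(_ `^ p)^-1 ^+ m]exprVn E.
    apply: ler_pM; rewrite ?exprn_ge0 ?divr_ge0 ?invr_ge0 ?powR_ge0 ?(ltW k0)//.
      by rewrite lerDr.
    rewrite lef_pV2 ?posrE ?exprn_gt0 ?powR_gt0//.
    apply: (@le_trans _ _ (w `^ n.+1%:R)); last by rewrite ler_powR.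
    by rewrite powR_mulrn ?(ltW w0)// mulnC exprM ler_pXn2r ?nnegrE ?exprn_ge0 ?(ltW w0).
  apply: (@le_trans _ _ (g 0%N z)); last exact: gS.
  rewrite /g /I /= indicE mem_set; last first.
    move=> i; rewrite mxE subr0; apply: le_lt_trans (normr_coord_le _ _) _.
    by rewrite /a ltr_pdivlMr// mulrC expr1; lra.
  rewrite mule1 lee_fin muln0 expr0 invr1 mulr1.
  by apply: le_trans C1; rewrite -expR0 ler_expR oppr_le0.
apply: (@le_trans _ _ (\int[lebesgue_cV]_z \sum_(j <oo) g j z)%E).
  apply: ge0_le_integral => //.
  - apply/measurable_EFinP/(measurableT_comp (@measurable_expR R)).
    exact: measurableT_comp.
  - exact: ge0_emeasurable_sum.
rewrite integral_nneseries//.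
rewrite (eq_eseriesr (g := fun j => (C * (4 / r) ^+ n)%:E * (2 ^- j)%:E)%E); last first.
  move=> j _; have IE : (\int[lebesgue_cV]_z (EFin \o I j) z = ((a j *+ 2) ^+ n)%:E)%E.
    rewrite integral_indic ?setIT//; last exact: measurable_cube.
    exact: (lebesgue_cube _ (ltW (a0 j))).
  rewrite /g ge0_integralZl//; first last.
  - by rewrite lee_fin mulr_ge0 ?invr_ge0 ?exprn_ge0 ?(ltW C0).
  - by move=> z _; rewrite lee_fin /I indicE.
  rewrite [X in (_ * X)%E]IE.
  rewrite -!EFinM; congr EFin.
  have -> : a j *+ 2 = 2 ^+ j * (4 / r) by rewrite /a exprS mulr2n; lra.
  rewrite exprMn mulnC exprM exprS; set u := 2 ^+ j.
  have u0 : u != 0 by rewrite expf_neq0.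
  have un : u ^+ n != 0 by rewrite expf_neq0.
  by field; rewrite u0 un.
rewrite nneseriesZl//.
apply: (@le_trans _ _ ((C * (4 / r) ^+ n)%:E * 2%:E)%E).
  rewrite lee_pmul2l ?nneseries_geometric_le//.
  by rewrite lte_fin mulr_gt0 ?exprn_gt0 ?divr_gt0.
by rewrite -EFinM lee_fin exprMn exprVn le_eqVlt; apply/orP; left; apply/eqP; ring.
Qed.

End tail.

Section C8_C2.
Context {R : realType} {n : nat}.
Variables (A : 'M[R]_n) (N : {measure set 'cV[R]_n -> \bar R}) (b : 'cV[R]_n).
Hypothesis n0 : (0 < n)%N.
Hypothesis ANb : generating_triplet A N.
Hypothesis h0 : concentration A N r @[r --> 0^'+] --> +oo.
Implicit Types (x y z : 'cV[R]_n) (r s t : R) (T : \bar R).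

Local Notation U := (dir_truncated A N).
Local Notation psi := (RePsi A N b).
Local Notation h := (concentration A N).
Local Notation hinv := (concentration_inv A N).

Lemma C8_C2 : C8 A N -> C2 A N b.
Proof.
move=> H8; have [T [c [T0 [c1 H]]]] := C8_dir_truncated n0 ANb H8.
have /(C8_dir n0 ANb)[T' [c' [p [T'0 [c'1 [/andP[p0 p2] [_ H2]]]]]]] := H8.
have min0 : (0 < Order.min T T')%E by rewrite lt_min T0.
have [T2 T20 HT2] := concentration_inv_threshold ANb h0 min0.
(* Here [c] and 8 come from [h <= c U <= 8 c psi], and [c'] from the scaling of [h] between
   [1 / |z|] and [r = hinv (1 / t)], where [t h r = 1]. *)
pose k := (8 * c * c')^-1.
have D0 : 0 < 8 * c * c' by rewrite !mulr_gt0//; lra.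
have k0 : 0 < k by rewrite invr_gt0.
(* The constant of (C2) is left to unification: it is the one of [integral_expR_le]. *)
eexists T2, _; split; first exact: T20.
split; last first.
  move=> t t0 tT; have ti : 0 < t^-1 by rewrite invr_gt0.
  have [r0 hr] := concentration_invP ANb h0 ti.
  have := HT2 t t0 tT; rewrite lt_min => /andP[rT rT'].
  set r := hinv t^-1 in r0 hr rT rT' *.
  rewrite (_ : (fun z => (expR (- t * psi z))%:E) = (fun z => (expR (- (t * psi z)))%:E));
    last by apply/funext => z; rewrite mulNr.
  apply: (integral_expR_le k0 p0 r0).
  - by apply: measurable_funM => //; exact: measurable_RePsi.
  - by move=> z; rewrite mulr_ge0 ?RePsi_ge0// ltW.
  - move=> z w1.
    have e0 : 0 < enorm z.
      by rewrite lt_neqAle enorm_ge0 andbT; apply: contraTneq w1 => <-; rewrite mulr0 -ltNge.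
    have z0 : z != 0 by rewrite -enorm_gt0.
    have zr : (enorm z)^-1 <= r by rewrite -[r]invrK lef_pV2 ?posrE ?invr_gt0// -[r^-1]mul1r ler_pdivrMr// mulrC.
    have k1 := H _ z0 (le_lt_trans _ rT); rewrite lee_fin in k1; have {}k1 := k1 zr.
    have k2 := dir_truncated_le_RePsi b ANb z.
    have w0 : 0 < r * enorm z by rewrite mulr_gt0.
    have := H2 (r * enorm z)^-1 r; rewrite invr_gt0 w0 invf_le1// w1 => /(_ isT r0 rT').
    have -> : (r * enorm z)^-1 * r = (enorm z)^-1.
      by rewrite invfM mulrAC mulVf ?mul1r// gt_eqF.
    rewrite powR_inv// hr => k3.
    have wp : 0 < (r * enorm z) `^ p by rewrite powR_gt0.
    have k4 : (r * enorm z) `^ p <= t * (c' * h (enorm z)^-1).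
      have := ler_wpM2l (ltW (mulr_gt0 t0 wp)) k3; set w := _ `^ p in wp *.
      have -> : t * w * t^-1 = w by field; rewrite gt_eqF.
      by move=> /le_trans; apply; rewrite [leLHS](_ : _ = t * (c' * h (enorm z)^-1))//;
         field; rewrite gt_eqF.
    rewrite mulrC ler_pdivrMr//; apply: le_trans k4 _.
    have k5 : h (enorm z)^-1 <= c * (8 * psi z).
      by apply: le_trans k1 _; rewrite ler_wpM2l//; lra.
    rewrite [leRHS](_ : _ = t * (c' * (c * (8 * psi z)))); last by ring.
    by rewrite ler_wpM2l ?(ltW t0)// ler_wpM2l//; lra.
rewrite !mulr_gt0 ?exprn_gt0//.
by rewrite ltr_pwDl// exprn_ge0// divr_ge0// ltW.
Qed.

End C8_C2.

(** * Laplace weights and Cauchy kernels *)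

Section one_dimensional.
Context {R : realType}.
Implicit Types (f : R -> R) (a e x c s u : R).
Local Notation mu := (@lebesgue_measure R).

(** Moves both ends to [+oo], where the fundamental theorem of calculus for nonnegative integrands
    takes the limit of a primitive. *)
Lemma ge0_integralT_split f a : continuous f -> (forall x, 0 <= f x) ->
  (\int[mu]_x (f x)%:E = \int[mu]_(x in `[a, +oo[) (f x)%:E
    + \int[mu]_(x in `[(- a)%R, +oo[) (f (- x))%:E)%E.
Proof.
move=> cf f0.
have mf D : measurable_fun D (EFin \o f).
  by apply/measurable_EFinP/measurable_funTS; exact: continuous_measurable_fun.
have -> : [set: R] = `]-oo, a] `|` `]a, +oo[.
  by rewrite -itv_bndbnd_setU// set_itvNyy.
rewrite ge0_integral_setU//; last 3 first.
- exact: mf.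
- by move=> x _; rewrite lee_fin.
- rewrite disj_set2E; apply/eqP; rewrite -subset0 => x [/=].
  by rewrite !in_itv/= andbT => xa ax; move: (le_lt_trans xa ax); rewrite ltxx.
rewrite addeC integral_itv_obnd_cbnd//; congr (_ + _)%E.
rewrite -{1}(opprK a) ge0_integration_by_substitutionNy//.
exact: continuous_subspaceT.
Qed.

Lemma cvg_expRN e : 0 < e -> expR (- (e * s)) @[s --> +oo] --> (0 : R).
Proof.
move=> e0.
apply: (@cvg_comp _ _ _ (fun s => e * s) (fun t => expR (- t)) _ (pinfty_nbhs R)).
  by apply: gt0_cvgMry => //; exact: cvg_id.
exact: cvgr_expR.
Qed.

(** Fourier transform of [exp (- e |s|)], and [2 pi] times the Cauchy density of width [e]. *)
Definition cauchy_kernel e u : R := 2 * e / (e ^+ 2 + u ^+ 2).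

Lemma cauchy_kernel_ge0 e u : 0 <= e -> 0 <= cauchy_kernel e u.
Proof. by move=> e0; rewrite divr_ge0 ?mulr_ge0 ?addr_ge0 ?sqr_ge0. Qed.

Lemma cauchy_kernelN e u : cauchy_kernel e (- u) = cauchy_kernel e u.
Proof. by rewrite /cauchy_kernel sqrrN. Qed.

(** The 1 makes the integrand nonnegative, as the improper fundamental theorem requires; the phase
    [c] covers cosine and sine at once. *)
Lemma laplace_half e x c : 0 < e ->
  (\int[mu]_(s in `[0%R, +oo[) ((1 + cos (x * s + c)) * expR (- (e * s)))%:E =
   (e^-1 + (e * cos c - x * sin c) / (e ^+ 2 + x ^+ 2))%:E)%E.
Proof.
move=> e0; have D0 : 0 < e ^+ 2 + x ^+ 2 by rewrite ltr_wpDr ?sqr_ge0 ?exprn_gt0.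
pose F s := - (expR (- (e * s)) *
  (e^-1 + (e * cos (x * s + c) - x * sin (x * s + c)) / (e ^+ 2 + x ^+ 2))).
have dF (s : R) : is_derive s 1 F ((1 + cos (x * s + c)) * expR (- (e * s))).
  apply: is_derive_eq.
  rewrite !scaler0 ?add0r ?addr0 /GRing.scale/=.
  by field; rewrite !gt_eqF.
have cF s : {for s, continuous F}.
  by apply/differentiable_continuous/derivable1_diffP; exact: ex_derive.
rewrite (@ge0_continuous_FTC2y _ _ F 0 0).
- have -> : F 0 = - (e^-1 + (e * cos c - x * sin c) / (e ^+ 2 + x ^+ 2)).
    by rewrite /F !mulr0 oppr0 expR0 mul1r add0r.
  by rewrite -EFinB sub0r opprK.
- move=> s _; rewrite mulr_ge0 ?expR_ge0//; have := cos_geN1 (x * s + c); lra.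
- apply: continuous_subspaceT => s.
  apply: cvgM; last first.
    apply: continuous_comp; last exact: continuous_expR.
    by apply: cvgN; apply: cvgMr; exact: cvg_id.
  apply: cvgD; first exact: cvg_cst.
  apply: continuous_comp; last exact: continuous_cos.
  by apply: cvgD; [apply: cvgMr; exact: cvg_id|exact: cvg_cst].
- pose M := e^-1 + (e + `|x|) / (e ^+ 2 + x ^+ 2).
  apply: (@squeeze_cvgr _ _ _ _ (fun s => - (expR (- (e * s)) * M)) (fun s => expR (- (e * s)) * M)).
  + apply: nearW => s; rewrite -ler_norml /F normrN normrM (ger0_norm (expR_ge0 _)).
    rewrite ler_wpM2l ?expR_ge0// (le_trans (ler_normD _ _))// lerD//.
      by rewrite ger0_norm ?invr_ge0 ?(ltW e0).
    rewrite normrM normfV (gtr0_norm D0) ler_wpM2r ?invr_ge0 ?(ltW D0)//.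
    rewrite (le_trans (ler_normB _ _))// !normrM (gtr0_norm e0) lerD//.
      by rewrite ler_piMr ?cos_max ?(ltW e0).
    by rewrite ler_piMr ?sin_max.
  + rewrite -[X in _ --> X]oppr0 -(mul0r M); apply: cvgN; apply: cvgMl; exact: cvg_expRN.
  + rewrite -[X in _ --> X](mul0r M); apply: cvgMl; exact: cvg_expRN.
- by move=> s _; exact: ex_derive.
- exact/cvg_at_right_filter/cF.
- by move=> s _; rewrite derive1E derive_val.
Qed.

Lemma laplaceT e x c : 0 < e ->
  (\int[mu]_s ((1 + cos (x * s + c)) * expR (- (e * `|s|)))%:E =
   (2 / e + cos c * cauchy_kernel e x)%:E)%E.
Proof.
move=> e0; rewrite (@ge0_integralT_split _ 0); last 2 first.
- move=> s; apply: cvgM; last first.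
    apply: continuous_comp; last exact: continuous_expR.
    by apply: cvgN; apply: cvgMr; exact: norm_continuous.
  apply: cvgD; first exact: cvg_cst.
  apply: continuous_comp; last exact: continuous_cos.
  by apply: cvgD; [apply: cvgMr; exact: cvg_id|exact: cvg_cst].
- move=> s; rewrite mulr_ge0 ?expR_ge0//; have := cos_geN1 (x * s + c); lra.
rewrite oppr0.
have -> : (\int[mu]_(s in `[0%R, +oo[) ((1 + cos (x * s + c)) * expR (- (e * `|s|)))%:E =
    \int[mu]_(s in `[0%R, +oo[) ((1 + cos (x * s + c)) * expR (- (e * s)))%:E)%E.
  by apply: eq_integral => s; rewrite inE/= in_itv/= andbT => s0; rewrite ger0_norm.
have -> : (\int[mu]_(s in `[0%R, +oo[) ((1 + cos (x * - s + c)) * expR (- (e * `|- s|)))%:E =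
    \int[mu]_(s in `[0%R, +oo[) ((1 + cos (- x * s + c)) * expR (- (e * s)))%:E)%E.
  apply: eq_integral => s; rewrite inE/= in_itv/= andbT => s0.
  by rewrite normrN ger0_norm// mulrN mulNr.
rewrite !laplace_half// -EFinD; congr EFin; rewrite /cauchy_kernel sqrrN.
have D0 : 0 < e ^+ 2 + x ^+ 2 by rewrite ltr_wpDr ?sqr_ge0 ?exprn_gt0.
by field; rewrite !gt_eqF.
Qed.

Lemma integral_expRN_abs e : 0 < e -> (\int[mu]_s (expR (- (e * `|s|)))%:E = (2 / e)%:E)%E.
Proof.
(* At frequency 0 and phase [pi / 2] the cosine vanishes identically. *)
move=> e0; have := @laplaceT e 0 (pi / 2) e0.
rewrite cos_pihalf mul0r addr0 => <-; apply: eq_integral => s _.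
by rewrite mul0r add0r cos_pihalf addr0 mul1r.
Qed.

Lemma derive_atan_div e u s : 0 < e ->
  is_derive s 1 (fun s => 2 * atan ((s - u) / e)) (cauchy_kernel e (s - u)).
Proof.
move=> e0; apply: is_derive_eq.
have D0 : 0 < e ^+ 2 + (s - u) ^+ 2 by rewrite ltr_wpDr ?sqr_ge0 ?exprn_gt0.
rewrite scaler0 add0r subr0 /GRing.scale/= mulr1 /cauchy_kernel.
by field; rewrite !gt_eqF.
Qed.

Lemma continuous_cauchy_kernel e u : 0 < e -> continuous (fun s => cauchy_kernel e (s - u)).
Proof.
move=> e0 s; apply: cvgM; first exact: cvg_cst.
apply: cvgV; first by rewrite gt_eqF// ltr_wpDr ?sqr_ge0 ?exprn_gt0.
apply: cvgD; first exact: cvg_cst.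
apply: (@continuous_comp _ _ _ (fun s => s - u) (fun s => s ^+ 2)); last exact: exprn_continuous.
by apply: cvgB; [exact: cvg_id|exact: cvg_cst].
Qed.

Lemma integral_cauchy_kernel_itv e u a b : 0 < e -> a < b ->
  (\int[mu]_(s in `[a, b]) (cauchy_kernel e (s - u))%:E =
   (2 * atan ((b - u) / e) - 2 * atan ((a - u) / e))%:E)%E.
Proof.
move=> e0 ab; have dF s := derive_atan_div u s e0.
have cF s : {for s, continuous (fun s => 2 * atan ((s - u) / e))}.
  by apply/differentiable_continuous/derivable1_diffP; exact: ex_derive.
rewrite (@continuous_FTC2 _ _ (fun s => 2 * atan ((s - u) / e)))//.
- by apply: continuous_subspaceT; exact: continuous_cauchy_kernel.
- split.
  + by move=> s _; exact: ex_derive.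
  + exact/cvg_at_right_filter/cF.
  + exact/cvg_at_left_filter/cF.
- by move=> s _; rewrite derive1E derive_val.
Qed.

Lemma integral_cauchy_kernelT e u : 0 < e ->
  (\int[mu]_s (cauchy_kernel e (s - u))%:E = (2 * pi)%:E)%E.
Proof.
move=> e0.
have H v : (\int[mu]_(s in `[v, +oo[) (cauchy_kernel e (s - v))%:E = pi%:E)%E.
  have dF s := derive_atan_div v s e0.
  have cF s : {for s, continuous (fun s => 2 * atan ((s - v) / e))}.
    by apply/differentiable_continuous/derivable1_diffP; exact: ex_derive.
  rewrite (@ge0_continuous_FTC2y _ _ (fun s => 2 * atan ((s - v) / e)) v pi).
  - by rewrite subrr mul0r atan0 mulr0 sube0.
  - by move=> s _; rewrite cauchy_kernel_ge0// ltW.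
  - by apply: continuous_subspaceT; exact: continuous_cauchy_kernel.
  - rewrite [X in _ --> X](_ : _ = 2 * (pi / 2)); last by field.
    apply: cvgMr; apply: cvg_comp (@cvgy_atan R).
    apply: gt0_cvgMly; first by rewrite invr_gt0.
    exact: cvg_addrr.
  - by move=> s _; exact: ex_derive.
  - exact/cvg_at_right_filter/cF.
  - by move=> s _; rewrite derive1E derive_val.
rewrite (@ge0_integralT_split _ u).
- have -> : (\int[mu]_(s in `[(- u)%R, +oo[) (cauchy_kernel e (- s - u))%:E =
      \int[mu]_(s in `[(- u)%R, +oo[) (cauchy_kernel e (s - - u))%:E)%E.
    apply: eq_integral => s _; congr EFin.
    by rewrite -cauchy_kernelN; congr (cauchy_kernel _ _); ring.
  by rewrite !H -EFinD; congr EFin; lra.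
- exact: continuous_cauchy_kernel.
- by move=> s; rewrite cauchy_kernel_ge0// ltW.
Qed.

End one_dimensional.

(** * Integration over R^n coordinate by coordinate *)

Section cV_integrals.
Context {R : realType}.
Implicit Types (e c : R).
Local Notation leb := (@lebesgue_measure R).

Lemma cV_cons0 n (s : R) (z : 'cV[R]_n) : cV_cons (s, z) 0 0 = s.
Proof. by have := cV_consK (s, z) => -[]. Qed.

Lemma cV_consS n (s : R) (z : 'cV[R]_n) i : cV_cons (s, z) (lift ord0 i) 0 = z i 0.
Proof.
rewrite -[RHS](col_mxEd (s%:M : 'M[R]_1) z) /cV_cons /=.
by rewrite (_ : rshift 1 i = lift ord0 i) //; exact/val_inj.
Qed.

Lemma ge0_integral_cV0 (f : 'cV[R]_0 -> \bar R) :
  measurable_fun setT f -> (forall z, 0 <= f z)%E ->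
  (\int[lebesgue_cV]_z f z = f 0%R)%E.
Proof.
move=> mf f0.
transitivity (\int[\d_(0%R : 'cV[R]_0)]_z f z)%E.
  exact: eq_measure_integral.
by rewrite integral_dirac// diracT mul1e.
Qed.

(** [lebesgue_cV] in dimension [n + 1] is by definition the image of a product measure; change of
    variables and Tonelli peel off the first coordinate. *)
Lemma ge0_integral_cV_cons n (f : 'cV[R]_n.+1 -> \bar R) :
  measurable_fun setT f -> (forall z, 0 <= f z)%E ->
  (\int[lebesgue_cV]_z f z = \int[leb]_s \int[lebesgue_cV]_z f (cV_cons (s, z)))%E.
Proof.
move=> mf f0.
pose nu : {measure set 'cV[R]_n.+1 -> \bar R} :=
  measure_function_pushforward__canonical__measure_function_Measure
     (leb \x @lebesgue_cV R n)%E (@measurable_cV_cons R n).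
transitivity (\int[nu]_z f z)%E; first exact: eq_measure_integral.
rewrite ge0_integral_pushforward//.
rewrite fubini_tonelli1//.
- exact: (measurableT_comp mf (@measurable_cV_cons R n)).
- by move=> ?; exact: f0.
- exact: measurable_cV_cons.
Qed.

Lemma measurable_prod_coord n (f : 'I_n -> R -> R) :
  (forall i, measurable_fun setT (f i)) ->
  measurable_fun setT (fun z : 'cV[R]_n => \prod_i f i (z i 0)).
Proof.
move=> mf; apply: measurable_prod => i _.
by apply: (measurableT_comp (mf i)); exact: measurable_coord.
Qed.

Lemma ge0_integral_cV_prod n (f : 'I_n -> R -> R) (k : 'I_n -> R) :
  (forall i, measurable_fun setT (f i)) -> (forall i s, 0 <= f i s) ->
  (forall i, \int[leb]_s (f i s)%:E = (k i)%:E)%E ->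
  (\int[lebesgue_cV]_z (\prod_i f i (z i 0))%:E = (\prod_i k i)%:E)%E.
Proof.
elim: n f k => [|n IH] f k mf f0 fk.
  rewrite ge0_integral_cV0 ?big_ord0//.
    by apply/measurable_EFinP; exact: measurable_prod_coord.
  by move=> z; rewrite lee_fin prodr_ge0.
rewrite ge0_integral_cV_cons; last 2 first.
- by apply/measurable_EFinP; exact: measurable_prod_coord.
- by move=> z; rewrite lee_fin prodr_ge0.
pose f' (i : 'I_n) := f (lift ord0 i); pose K := \prod_(i < n) k (lift ord0 i).
have k0 i : 0 <= k i by rewrite -lee_fin -fk; apply: integral_ge0 => s _; rewrite lee_fin.
transitivity (\int[leb]_s (K%:E * (f ord0 s)%:E))%E.
  apply: eq_integral => s _; rewrite muleC.
  rewrite -(IH f' (fun i => k (lift ord0 i)) (fun i => mf _) (fun i => f0 _) (fun i => fk _)).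
  rewrite -ge0_integralZl//; last 3 first.
  - by apply/measurable_EFinP; apply: (@measurable_prod_coord n f') => i; exact: mf.
  - by move=> z _; rewrite lee_fin; apply: prodr_ge0 => i _; exact: f0.
  - by rewrite lee_fin.
  apply: eq_integral => z _; rewrite -EFinM big_ord_recl cV_cons0; congr (_ * _)%:E.
  by apply: eq_bigr => i _; rewrite cV_consS.
rewrite ge0_integralZl//; last 3 first.
- have mf0 : measurable_fun setT (EFin \o f ord0) by apply/measurable_EFinP; exact: mf.
  exact: mf0.
- by move=> s _; rewrite lee_fin.
- by rewrite lee_fin prodr_ge0.
by rewrite fk -EFinM big_ord_recl mulrC.
Qed.

Definition laplace_weight n e (z : 'cV[R]_n) : R := \prod_i expR (- (e * `|z i 0|)).

Lemma laplace_weight_ge0 n e (z : 'cV[R]_n) : 0 <= laplace_weight e z.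
Proof. by rewrite prodr_ge0// => i _; exact: expR_ge0. Qed.

Lemma measurable_laplace_weight n e : measurable_fun setT (@laplace_weight n e).
Proof.
apply: (@measurable_prod_coord n (fun _ s => expR (- (e * `|s|)))) => i.
apply: (measurableT_comp (@measurable_expR R)); apply: measurableT_comp => //.
by apply: measurable_funM => //; exact: measurable_normr.
Qed.

(** Induction on the dimension, for all phases at once: the first coordinate [s] is absorbed into
    the phase as [x_0 s + c]. *)
Lemma laplace_cV n e c (x : 'cV[R]_n) : 0 < e ->
  (\int[lebesgue_cV]_z ((1 + cos (dotp x z + c)) * laplace_weight e z)%:E =
   ((2 / e) ^+ n + cos c * \prod_i cauchy_kernel e (x i 0))%:E)%E.
Proof.
move=> e0; have e2 : 0 <= 2 / e by rewrite divr_ge0// ltW.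
have cos1 u : 0 <= 1 + cos u :> R by have := cos_geN1 u; lra.
elim: n c x => [|n IH] c x.
  rewrite ge0_integral_cV0; last 2 first.
  - apply/measurable_EFinP/measurable_funM; last exact: measurable_laplace_weight.
    apply: measurable_funD => //; apply: (measurableT_comp (@measurable_cos R)).
    by apply: measurable_funD => //; exact: measurable_dotp.
  - by move=> z; rewrite lee_fin mulr_ge0 ?laplace_weight_ge0.
  by rewrite /dotp /laplace_weight !big_ord0 add0r !mulr1 expr0.
rewrite ge0_integral_cV_cons; last 2 first.
- apply/measurable_EFinP/measurable_funM; last exact: measurable_laplace_weight.
  apply: measurable_funD => //; apply: (measurableT_comp (@measurable_cos R)).
  by apply: measurable_funD => //; exact: measurable_dotp.
- by move=> z; rewrite lee_fin mulr_ge0 ?laplace_weight_ge0.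
pose x' := \col_(i < n) x (lift ord0 i) 0.
pose W := (2 / e) ^+ n; pose K := \prod_(i < n) cauchy_kernel e (x' i 0).
have kW u : cauchy_kernel e u <= 2 / e.
  have D0 : 0 < e ^+ 2 + u ^+ 2 by rewrite ltr_wpDr ?sqr_ge0 ?exprn_gt0.
  rewrite /cauchy_kernel ler_pdivrMr// mulrDr (_ : 2 / e * e ^+ 2 = 2 * e).
    by rewrite lerDl mulr_ge0// sqr_ge0.
  by field; rewrite gt_eqF.
(* Needed to split [W + K cos] as [(W - K) + K (1 + cos)], two nonnegative terms whose integrals can
   be added. *)
have KW : K <= W.
  rewrite /W -[n in _ ^+ n]card_ord -prodr_const; apply: ler_prod => i _.
  by rewrite cauchy_kernel_ge0 ?kW// ltW.
have K0 : 0 <= K by rewrite prodr_ge0// => i _; rewrite cauchy_kernel_ge0// ltW.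
have mE : measurable_fun setT (EFin \o (fun s : R => expR (- (e * `|s|)))).
  apply/measurable_EFinP; apply: (measurableT_comp (@measurable_expR R)).
  apply: measurableT_comp => //.
  by apply: measurable_funM => //; exact: measurable_normr.
transitivity (\int[leb]_s ((W - K)%:E * (expR (- (e * `|s|)))%:E +
    K%:E * ((1 + cos (x 0 0 * s + c)) * expR (- (e * `|s|)))%:E))%E.
  apply: eq_integral => s _.
  transitivity (\int[lebesgue_cV]_z ((expR (- (e * `|s|)))%:E *
     ((1 + cos (dotp x' z + (x 0%R 0%R * s + c))) * laplace_weight e z)%:E))%E.
    apply: eq_integral => z _; rewrite -EFinM; congr EFin.
    rewrite /dotp /laplace_weight !big_ord_recl !cV_cons0.
    rewrite (eq_bigr (fun i => x' i 0 * z i 0)) => [|i _]; last by rewrite cV_consS mxE.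
    rewrite [X in _ * (_ * X)](eq_bigr (fun i => expR (- (e * `|z i 0|)))) => [|i _];
      last by rewrite cV_consS.
    rewrite [X in 1 + cos X](_ : _ = \sum_(i < n) x' i 0 * z i 0 + (x 0 0 * s + c)); last by ring.
    by ring.
  rewrite ge0_integralZl//; first last.
  - by move=> z _; rewrite lee_fin mulr_ge0 ?laplace_weight_ge0.
  - apply/measurable_EFinP/measurable_funM; last exact: measurable_laplace_weight.
    apply: measurable_funD => //; apply: (measurableT_comp (@measurable_cos R)).
    by apply: measurable_funD => //; exact: measurable_dotp.
  by rewrite IH -!EFinM -EFinD; congr EFin; rewrite -/W -/K; ring.
have mC : measurable_fun setT (EFin \o (fun s : R => (1 + cos (x 0 0 * s + c)) * expR (- (e * `|s|)))).
  apply/measurable_EFinP/measurable_funM; last exact/measurable_EFinP.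
  apply: measurable_funD => //; apply: (measurableT_comp (@measurable_cos R)).
  by apply: measurable_funD => //; exact: measurable_funM.
rewrite ge0_integralD//; first last.
- exact: measurable_funeM.
- by move=> s _; rewrite mule_ge0// lee_fin ?mulr_ge0 ?expR_ge0.
- exact: measurable_funeM.
- by move=> s _; rewrite mule_ge0// lee_fin ?subr_ge0 ?expR_ge0.
rewrite !ge0_integralZl//; first last.
- by rewrite lee_fin subr_ge0.
rewrite integral_expRN_abs// laplaceT// -!EFinM -EFinD; congr EFin.
rewrite big_ord_recl exprS -/W.
have -> : \prod_(i < n) cauchy_kernel e (x (lift ord0 i) 0) = K.
  by apply: eq_bigr => i _; rewrite mxE.
ring.
Qed.

End cV_integrals.

(** * Characteristic functions tested against Laplace weights *)

Import HBNNSimple.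

(** Checked on nonnegative simple functions and extended by the supremum. It turns a bound on a law
    by a multiple of Lebesgue measure into a bound on expectations. *)
Lemma ge0_integral_le_measure {R : realType} d (T : measurableType d)
    (m1 m2 : {measure set T -> \bar R}) (c : R) (f : T -> \bar R) :
  0 <= c -> (forall A, measurable A -> m1 A <= c%:E * m2 A)%E ->
  (forall x, 0 <= f x)%E ->
  (\int[m1]_x f x <= c%:E * \int[m2]_x f x)%E.
Proof.
move=> c0 H f0; rewrite [leLHS]ge0_integralTE//.
apply: ge_ereal_sup => _ [g gf <-].
apply: (@le_trans _ _ (c%:E * sintegral m2 g)%E).
  rewrite !sintegralE ge0_mule_fsumr; last first.
    by move=> x; rewrite nnsfun_mulemu_ge0.
  apply: lee_fsum => //= x [y _ <-].
  by rewrite muleCA lee_wpmul2l ?lee_fin//; exact: H.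
rewrite lee_wpmul2l ?lee_fin// ge0_integralTE//.
by apply: ereal_sup_ubound; exists g.
Qed.

Section characteristic_function.
Context {R : realType} {n : nat} d (Omega : measurableType d).
Variables (P : probability Omega R) (X : Omega -> 'cV[R]_n).
Hypothesis mX : measurable_fun setT X.
Implicit Types (x z : 'cV[R]_n) (c e : R).

Lemma bounded_integrable (f : Omega -> R) c : measurable_fun setT f ->
  (forall w, `|f w| <= c) -> P.-integrable setT (EFin \o f).
Proof.
move=> mf fc; apply: (@le_integrable _ _ _ P _ measurableT _ (EFin \o cst c)).
- exact/measurable_EFinP.
- by move=> w _; rewrite lee_fin (le_trans (fc w))// ler_norm.
- exact: finite_measure_integrable_cst.
Qed.

(** Phase 0 gives the real part, and phase [- pi / 2] the imaginary part, of [exp (- i <x, z>)]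
    times the characteristic function of [X] at [z]. *)
Definition charc c x z : R := \int[P]_w cos (dotp (X w - x) z + c).

Lemma measurable_cos_dotp d' (T : measurableType d') (f g : T -> 'cV[R]_n) c :
  measurable_fun setT f -> measurable_fun setT g ->
  measurable_fun setT (fun t => cos (dotp (f t) (g t) + c)).
Proof.
move=> mf mg; apply: (measurableT_comp measurable_cos).
by apply: measurable_funD => //; exact: measurable_fun_dotp.
Qed.

Lemma measurable_subr_cst x : measurable_fun setT (fun w => X w - x).
Proof.
apply: measurable_fun_coord => i; under eq_fun do rewrite !mxE.
by apply: measurable_funB => //; exact: (measurableT_comp (measurable_coord i) mX).
Qed.

Lemma integrable_charc c x z : P.-integrable setT (EFin \o (fun w => cos (dotp (X w - x) z + c))).
Proof.
apply: (@bounded_integrable _ 1) => [|w]; last exact: cos_max.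
by apply: measurable_cos_dotp; [exact: measurable_subr_cst|exact: measurable_cst].
Qed.

Lemma charc_bounds c x z : -1 <= charc c x z <= 1.
Proof.
rewrite -ler_norml; apply: le_trans (le_normr_Rintegral measurableT (integrable_charc c x z)) _.
rewrite -[leRHS](_ : \int[P]_w 1 = 1); last first.
  by rewrite Rintegral_cst// [X in fine X](probability_setT P) mul1r.
apply: le_Rintegral => //.
- exact: integrable_norm (integrable_charc c x z).
- exact: (finite_measure_integrable_cst P 1 measurableT).
- by move=> w _; exact: cos_max.
Qed.

(** Bridge from a signed real integral to a nonnegative extended one, to which Tonelli applies. *)
Lemma one_add_Rintegral (f : Omega -> R) (a : R) :
  measurable_fun setT f -> (forall w, `|f w| <= 1) -> 0 <= a ->
  (((1 + \int[P]_w f w) * a)%:E = \int[P]_w ((1 + f w) * a)%:E)%E.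
Proof.
move=> mf f1 a0; have jf := bounded_integrable mf f1.
under eq_integral do rewrite mulrC EFinM.
rewrite ge0_integralZl//; first last.
- by move=> w _; rewrite lee_fin; have := f1 w; rewrite ler_norml => /andP[]; lra.
- by apply/measurable_EFinP; exact: measurable_funD.
rewrite mulrC EFinM; congr (_ * _)%E.
rewrite EFinD; under eq_integral do rewrite EFinD.
rewrite integralD//; last exact: (finite_measure_integrable_cst P 1 measurableT).
rewrite integral_cst// mul1e [X in _ = (X + _)%E](probability_setT P); congr (_ + _)%E.
rewrite fineK//; exact: integrable_fin_num jf.
Qed.

Lemma one_add_charc c x z (a : R) : 0 <= a ->
  (((1 + charc c x z) * a)%:E = \int[P]_w ((1 + cos (dotp (X w - x) z + c)) * a)%:E)%E.
Proof.
move=> a0; apply: one_add_Rintegral => // [|w]; last exact: cos_max.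
exact: (measurable_cos_dotp c (measurable_subr_cst x) (@measurable_cst _ _ _ _ setT z)).
Qed.

Lemma measurable_charc_joint c x e :
  measurable_fun setT (fun p : Omega * 'cV[R]_n =>
    ((1 + cos (dotp (X p.1 - x) p.2 + c)) * laplace_weight e p.2)%:E).
Proof.
apply/measurable_EFinP/measurable_funM; last first.
  exact: (measurableT_comp (@measurable_laplace_weight R n e) measurable_snd).
apply: measurable_funD => //; apply: measurable_cos_dotp; last exact: measurable_snd.
exact: (measurableT_comp (measurable_subr_cst x) measurable_fst).
Qed.

Lemma cauchy_kernel_le e u : 0 < e -> cauchy_kernel e u <= 2 / e.
Proof.
move=> e0; have D0 : 0 < e ^+ 2 + u ^+ 2 by rewrite ltr_wpDr ?sqr_ge0 ?exprn_gt0.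
rewrite /cauchy_kernel ler_pdivrMr// mulrDr (_ : 2 / e * e ^+ 2 = 2 * e).
  by rewrite lerDl mulr_ge0 ?divr_ge0 ?sqr_ge0// ltW.
by field; rewrite gt_eqF.
Qed.

Definition prod_cauchy e x : R := \prod_(i < n) cauchy_kernel e (x i 0).

Lemma prod_cauchy_ge0 e x : 0 < e -> 0 <= prod_cauchy e x.
Proof. by move=> e0; apply: prodr_ge0 => i _; rewrite cauchy_kernel_ge0// ltW. Qed.

Lemma prod_cauchy_le e x : 0 < e -> prod_cauchy e x <= (2 / e) ^+ n.
Proof.
move=> e0; rewrite -[n in _ ^+ n]card_ord -prodr_const; apply: ler_prod => i _.
by rewrite cauchy_kernel_ge0 ?cauchy_kernel_le// ltW.
Qed.

Lemma measurable_cauchy_kernel e : 0 < e -> measurable_fun setT (@cauchy_kernel R e).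
Proof.
move=> e0; apply: continuous_measurable_fun.
rewrite (_ : cauchy_kernel e = fun s => cauchy_kernel e (s - 0)).
  exact: continuous_cauchy_kernel.
by apply/funext => s; rewrite subr0.
Qed.

Lemma measurable_prod_cauchy e : 0 < e -> measurable_fun setT (prod_cauchy e).
Proof.
by move=> e0; apply: (measurable_prod_coord (f := fun=> cauchy_kernel e)) => i;
  exact: measurable_cauchy_kernel.
Qed.

(* [charc 0] tested against a Laplace weight is the mean of a product of Cauchy
   kernels; the constant [1] only makes the integrand nonnegative. *)
Lemma integral_charc_weight c e x : 0 < e ->
  (\int[lebesgue_cV]_z ((1 + charc c x z) * laplace_weight e z)%:E =
   ((2 / e) ^+ n + cos c * \int[P]_w prod_cauchy e (X w - x))%:E)%E.
Proof.
move=> e0.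
have mp : measurable_fun setT (fun w => prod_cauchy e (X w - x)).
  exact: (measurableT_comp (measurable_prod_cauchy e0) (measurable_subr_cst x)).
have ip : P.-integrable setT (EFin \o (fun w => prod_cauchy e (X w - x))).
  apply: (@bounded_integrable _ ((2 / e) ^+ n)) => // w.
  by rewrite ger0_norm ?prod_cauchy_le// prod_cauchy_ge0.
under eq_integral do rewrite one_add_charc ?laplace_weight_ge0//.
have p1 (u : R) : 0 <= 1 + cos u by have := cos_geN1 u; lra.
have F0 p : (0 <= ((1 + cos (dotp (X p.1 - x) p.2 + c)) * laplace_weight e p.2)%:E)%E.
  by rewrite lee_fin mulr_ge0 ?laplace_weight_ge0.
rewrite -(fubini_tonelli (m1 := P) (m2 := @lebesgue_cV R n) _ (measurable_charc_joint c x e) F0)/=.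
under eq_integral do rewrite laplace_cV//.
rewrite EFinD; under eq_integral do rewrite EFinD.
rewrite integralD//; last 2 first.
- exact: (finite_measure_integrable_cst P ((2 / e) ^+ n) measurableT).
- by under eq_fun do rewrite EFinM; exact: integrableZl.
rewrite integral_cst// [X in (_ * X)%E](probability_setT P) mule1; congr (_ + _)%E.
under eq_integral do rewrite EFinM.
rewrite integralZl// EFinM fineK//; exact: integrable_fin_num ip.
Qed.

Lemma integral_laplace_weight e : 0 < e ->
  (\int[lebesgue_cV]_z (@laplace_weight R n e z)%:E = ((2 / e) ^+ n)%:E :> \bar R)%E.
Proof.
move=> e0; rewrite (@ge0_integral_cV_prod R n (fun _ s => expR (- (e * `|s|))) (fun=> 2 / e)).
- by rewrite prodr_const card_ord.
- move=> _; apply: (measurableT_comp (@measurable_expR R)).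
  by apply: measurableT_comp => //; apply: measurable_funM => //; exact: measurable_normr.
- by move=> _ s; exact: expR_ge0.
- by move=> _; exact: integral_expRN_abs.
Qed.

Lemma integral_prod_cauchyT e (a : 'cV[R]_n) : 0 < e ->
  (\int[lebesgue_cV]_z (prod_cauchy e (a - z))%:E = ((2 * pi) ^+ n)%:E :> \bar R)%E.
Proof.
move=> e0; rewrite /prod_cauchy.
under eq_integral do under eq_bigr do rewrite !mxE.
rewrite (@ge0_integral_cV_prod R n (fun i s => cauchy_kernel e (a i 0 - s)) (fun=> 2 * pi)).
- by rewrite prodr_const card_ord.
- move=> i; apply: (measurableT_comp (measurable_cauchy_kernel e0)).
  by apply: measurable_funB => //.
- by move=> i s; rewrite cauchy_kernel_ge0// ltW.
- move=> i; rewrite -(integral_cauchy_kernelT (a i 0) e0); apply: eq_integral => s _.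
  by rewrite -cauchy_kernelN opprB.
Qed.

End characteristic_function.

(** * The squared modulus of a characteristic function *)

Section bounded_density.
Context {R : realType} {n : nat} d (Omega : measurableType d).
Variables (P : probability Omega R) (X : Omega -> 'cV[R]_n).
Hypothesis mX : measurable_fun setT X.
Implicit Types (x z : 'cV[R]_n) (c e M : R).

Local Notation Re z := (charc P X 0 0 z).
Local Notation Im z := (charc P X (- (pi / 2)) 0 z).

Lemma cosD_charc (y x z : 'cV[R]_n) c :
  cos (dotp (y - x) z + c) = cos (c - dotp x z) * cos (dotp y z)
    - sin (c - dotp x z) * sin (dotp y z).
Proof.
rewrite (_ : dotp (y - x) z + c = c - dotp x z + dotp y z) ?cosD//.
by rewrite dotpC dotpDr dotpNr !(dotpC z); ring.
Qed.

Lemma charcE c x z :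
  charc P X c x z = cos (c - dotp x z) * Re z - sin (c - dotp x z) * Im z.
Proof.
have mcos := integrable_charc P mX 0 0 z.
have msin := integrable_charc P mX (- (pi / 2)) 0 z.
rewrite /charc; under eq_Rintegral do rewrite cosD_charc.
have E1 w : cos (dotp (X w - 0) z + 0) = cos (dotp (X w) z) by rewrite subr0 addr0.
have E2 w : cos (dotp (X w - 0) z - pi / 2) = sin (dotp (X w) z) by rewrite subr0 cosBpihalf.
under [X in _ = _ * X - _]eq_Rintegral do rewrite E1.
under [X in _ = _ - _ * X]eq_Rintegral do rewrite E2.
have ic : P.-integrable setT (EFin \o (fun w => cos (dotp (X w) z))).
  by apply: eq_integrable mcos => // w _; rewrite /= E1.
have isn : P.-integrable setT (EFin \o (fun w => sin (dotp (X w) z))).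
  by apply: eq_integrable msin => // w _; rewrite /= E2.
rewrite RintegralB//; last 2 first.
- exact: (@integrableZl _ _ _ P _ measurableT _ _ ic).
- exact: (@integrableZl _ _ _ P _ measurableT _ _ isn).
by rewrite !RintegralZl.
Qed.

(** By [charcE] the left-hand side is the square of one component of the vector ([Re z], [Im z])
    after a rotation. *)
Lemma charc_sqr_le c x z : charc P X c x z ^+ 2 <= Re z ^+ 2 + Im z ^+ 2.
Proof.
rewrite charcE; set a := Re z; set b := Im z; set u := c - _.
have := cos2Dsin2 u; set C := cos u; set S := sin u => CS.
have : 0 <= (C * b + S * a) ^+ 2 by exact: sqr_ge0.
have -> : (C * b + S * a) ^+ 2 = (C ^+ 2 + S ^+ 2) * (a ^+ 2 + b ^+ 2) - (C * a - S * b) ^+ 2.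
  by ring.
by rewrite CS; lra.
Qed.

(** The independent copy of [X] is the outer integration variable, entering through the shift
    [x = X w]; no product probability space has to be built. *)
Lemma integral_charc_sqr z : Re z ^+ 2 + Im z ^+ 2 = \int[P]_w charc P X 0 (X w) z.
Proof.
have mcos := integrable_charc P mX 0 0 z.
have msin := integrable_charc P mX (- (pi / 2)) 0 z.
under [RHS]eq_Rintegral do rewrite charcE add0r cosN sinN mulNr opprK.
have E1 w : cos (dotp (X w - 0) z + 0) = cos (dotp (X w) z) by rewrite subr0 addr0.
have E2 w : cos (dotp (X w - 0) z - pi / 2) = sin (dotp (X w) z) by rewrite subr0 cosBpihalf.
have ic : P.-integrable setT (EFin \o (fun w => cos (dotp (X w) z))).
  by apply: eq_integrable mcos => // w _; rewrite /= E1.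
have isn : P.-integrable setT (EFin \o (fun w => sin (dotp (X w) z))).
  by apply: eq_integrable msin => // w _; rewrite /= E2.
rewrite RintegralD//; last 2 first.
- exact: (@integrableZr _ _ _ P _ measurableT _ _ ic).
- exact: (@integrableZr _ _ _ P _ measurableT _ _ isn).
rewrite !RintegralZr// !expr2; congr (_ * _ + _ * _).
- by rewrite /charc; apply: eq_Rintegral => w _; rewrite E1.
- by rewrite /charc; apply: eq_Rintegral => w _; rewrite E2.
Qed.

Lemma measurable_charc c x : measurable_fun setT (charc P X c x).
Proof.
have F0 p : (0 <= ((1 + cos (dotp (X p.1 - x) p.2 + c)) * 1)%:E)%E.
  by rewrite lee_fin mulr1; have := cos_geN1 (dotp (X p.1 - x) p.2 + c); lra.
have mF : measurable_fun setT (fun p : Omega * 'cV[R]_n =>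
    ((1 + cos (dotp (X p.1 - x) p.2 + c)) * 1)%:E).
  apply/measurable_EFinP/measurable_funM => //.
  apply: measurable_funD => //; apply: measurable_cos_dotp; last exact: measurable_snd.
  exact: (measurableT_comp (measurable_subr_cst mX x) measurable_fst).
rewrite (_ : charc P X c x = fun z => (1 + charc P X c x z) * 1 - 1); last first.
  by apply/funext => z; rewrite mulr1 addrC addKr.
apply: measurable_funB => //; apply/measurable_EFinP.
rewrite (_ : _ \o _ = fubini_G P (fun p : Omega * 'cV[R]_n =>
    ((1 + cos (dotp (X p.1 - x) p.2 + c)) * 1)%:E)).
  exact: (measurable_fun_fubini_tonelli_G _ mF F0).
by apply/funext => z; rewrite /= (one_add_charc P mX).
Qed.

(* If [X'] is an independent copy of [X], then [Re ^ 2 + Im ^ 2] is the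
   characteristic function of [X - X'], whose density is also bounded by [M]. *)
Lemma integral_charc_sqr_weight_le M e : 0 <= M -> 0 < e ->
  (forall B, measurable B -> P (X @^-1` B) <= M%:E * lebesgue_cV B)%E ->
  (\int[lebesgue_cV]_z ((Re z ^+ 2 + Im z ^+ 2) * laplace_weight e z)%:E <=
    (M * (2 * pi) ^+ n)%:E)%E.
Proof.
move=> M0 e0 HM.
(* One copy is averaged with the other frozen at [x]: a law bounded by [M] times Lebesgue measure
   against a kernel of total mass [(2 pi) ^ n]. *)
have kM x : (\int[P]_w (prod_cauchy e (X w - x))%:E <= (M * (2 * pi) ^+ n)%:E)%E.
  have mg : measurable_fun setT (fun y : 'cV[R]_n => prod_cauchy e (y - x)).
    apply: (measurableT_comp (@measurable_prod_cauchy R n e e0)).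
    apply: measurable_fun_coord => i; under eq_fun do rewrite !mxE.
    by apply: measurable_funB => //; exact: measurable_coord.
  rewrite -(@ge0_integral_pushforward _ _ _ _ _ X mX P setT (fun y : 'cV[R]_n => (prod_cauchy e (y - x))%:E))//; last first.
  - by move=> y; rewrite lee_fin prod_cauchy_ge0.
  - exact/measurable_EFinP.
  apply: (@le_trans _ _ (M%:E * \int[lebesgue_cV]_y (prod_cauchy e (y - x))%:E)%E).
    apply: (@ge0_integral_le_measure R _ _
      (measure_function_pushforward__canonical__measure_function_Measure P mX)
      (@lebesgue_cV R n) M) => //.
    by move=> y; rewrite lee_fin prod_cauchy_ge0.
  rewrite EFinM lee_wpmul2l ?lee_fin// -(integral_prod_cauchyT x e0).
  rewrite le_eqVlt; apply/orP; left; apply/eqP; apply: eq_integral => y _; congr EFin.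
  by apply: eq_bigr => i _; rewrite -cauchy_kernelN !mxE opprB.
pose Q z := Re z ^+ 2 + Im z ^+ 2.
have Q0 z : 0 <= Q z by rewrite addr_ge0 ?sqr_ge0.
have mQ : measurable_fun setT Q.
  by apply: measurable_funD; apply: measurable_funX; exact: measurable_charc.
have mw := @measurable_laplace_weight R n e.
have w0 := @laplace_weight_ge0 R n e.
have e2 : 0 <= 2 / e by rewrite divr_ge0// ltW.
pose F (p : Omega * 'cV[R]_n) := ((1 + charc P X 0 (X p.1) p.2) * laplace_weight e p.2)%:E.
have mchX : measurable_fun setT (fun p : Omega * 'cV[R]_n => charc P X 0 (X p.1) p.2).
  under eq_fun do rewrite charcE.
  have md : measurable_fun setT (fun p : Omega * 'cV[R]_n => 0 - dotp (X p.1) p.2).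
    apply: measurable_funB => //; apply: measurable_fun_dotp; last exact: measurable_snd.
    exact: (measurableT_comp mX measurable_fst).
  apply: measurable_funB; apply: measurable_funM.
  - exact: (measurableT_comp measurable_cos md).
  - exact: (measurableT_comp (measurable_charc _ _) measurable_snd).
  - exact: (measurableT_comp measurable_sin md).
  - exact: (measurableT_comp (measurable_charc _ _) measurable_snd).
have mF : measurable_fun setT F.
  apply/measurable_EFinP/measurable_funM; last exact: (measurableT_comp mw measurable_snd).
  exact: measurable_funD.
have F0 p : (0 <= F p)%E.
  by rewrite lee_fin mulr_ge0//; have /andP[] := charc_bounds P mX 0 (X p.1) p.2; lra.
have FQ z : (\int[P]_w F (w, z) = ((1 + Q z) * laplace_weight e z)%:E)%E.
  rewrite /Q integral_charc_sqr (@one_add_Rintegral _ _ _ P)//.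
  - exact: (measurableT_comp mchX (measurable_pair2 z)).
  - by move=> w; rewrite ler_norml; exact: charc_bounds.
have := fubini_tonelli (m1 := P) (m2 := @lebesgue_cV R n) F mF F0.
under [in X in _ = X -> _]eq_integral do rewrite FQ.
move=> FT.
(* The auxiliary 1 contributes the finite term [(2 / e) ^ n] to both sides, and it cancels at the
   end. *)
have : (\int[lebesgue_cV]_z ((1 + Q z) * laplace_weight e z)%:E <=
    ((2 / e) ^+ n)%:E + (M * (2 * pi) ^+ n)%:E)%E.
  rewrite -FT.
  apply: (@le_trans _ _ (\int[P]_w (((2 / e) ^+ n)%:E + (M * (2 * pi) ^+ n)%:E))%E).
    apply: ge0_le_integral => //.
    - by move=> w _; exact: integral_ge0.
    - exact: (measurable_fun_fubini_tonelli_F F mF F0).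
    - move=> w _; rewrite /F/= (integral_charc_weight P mX)// cos0 mul1r EFinD leeD2l//.
      rewrite fineK ?kM// ge0_fin_numE ?(le_lt_trans (kM _)) ?ltry//.
      by apply: integral_ge0 => y _; rewrite lee_fin prod_cauchy_ge0.
  by rewrite integral_cst// [X in (_ * X)%E](probability_setT P) mule1.
under eq_integral do rewrite mulrDl mul1r EFinD.
rewrite ge0_integralD//; last 4 first.
- by move=> z _; rewrite lee_fin.
- exact/measurable_EFinP.
- by move=> z _; rewrite lee_fin mulr_ge0.
- by apply/measurable_EFinP; exact: measurable_funM.
by rewrite integral_laplace_weight// leeD2lE.
Qed.

End bounded_density.

(** * (C1) implies (C2) *)

Section weight_limit.
Context {R : realType} {n : nat}.

Lemma laplace_weight_nd (z : 'cV[R]_n) (k l : nat) : (k <= l)%N ->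
  laplace_weight k.+1%:R^-1 z <= laplace_weight l.+1%:R^-1 z.
Proof.
move=> kl; apply: ler_prod => i _; rewrite expR_ge0 ler_expR lerN2.
by rewrite ler_wpM2r// lef_pV2 ?posrE ?ltr0n// ler_nat ltnS.
Qed.

Lemma laplace_weight_cvg (z : 'cV[R]_n) :
  laplace_weight k.+1%:R^-1 z @[k --> \oo] --> (1 : R).
Proof.
rewrite -[X in _ --> X](_ : \prod_(i < n) (1 : R) = 1); last by rewrite big1.
apply: cvg_big => [|i _]; first exact: mul_continuous.
rewrite -[X in _ --> X](_ : expR (- (0 * `|z i 0|)) = 1); last by rewrite mul0r oppr0 expR0.
apply: (continuous_cvg _ (@continuous_expR R _)).
apply: cvgN; apply: cvgMl; exact: cvg_harmonic.
Qed.

(** Monotone convergence along [e = 1 / (k + 1)]; for finite [M] it also yields integrability. *)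
Lemma integral_weight_le (f : 'cV[R]_n -> R) (M : \bar R) :
  measurable_fun setT f -> (forall z, 0 <= f z) ->
  (forall e : R, 0 < e -> (\int[lebesgue_cV]_z (f z * laplace_weight e z)%:E <= M)%E) ->
  (\int[lebesgue_cV]_z (f z)%:E <= M)%E.
Proof.
move=> mf f0 H.
pose g (k : nat) (z : 'cV[R]_n) := (f z * laplace_weight k.+1%:R^-1 z)%:E.
have mg k : measurable_fun setT (g k).
  by apply/measurable_EFinP/measurable_funM => //; exact: measurable_laplace_weight.
have fg z : (f z)%:E = limn (g ^~ z).
  apply/esym/cvg_lim => //; apply: cvg_EFin; first exact: nearW.
  rewrite -[X in _ --> X]mulr1; apply: cvgMr; exact: laplace_weight_cvg.
under eq_integral do rewrite fg.
rewrite monotone_convergence//.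
- apply: lime_le; last by apply: nearW => k; apply: H; rewrite invr_gt0.
  apply: ereal_nondecreasing_is_cvgn => k l kl; apply: ge0_le_integral => //.
  - by move=> z _; rewrite lee_fin mulr_ge0// laplace_weight_ge0.
  - by move=> z _; rewrite lee_fin ler_wpM2l// laplace_weight_nd.
- by move=> k z _; rewrite lee_fin mulr_ge0// laplace_weight_ge0.
- move=> z _ k l kl; rewrite lee_fin ler_wpM2l// laplace_weight_nd//.
Qed.

End weight_limit.

Section C1_C2.
Context {R : realType} {n : nat} d (Omega : measurableType d).
Variables (P : probability Omega R) (Y : R -> {RV P >-> 'cV[R]_n}).
Variables (A : 'M[R]_n) (N : {measure set 'cV[R]_n -> \bar R}) (b : 'cV[R]_n).
Hypothesis n0 : (0 < n)%N.
Hypothesis ANb : generating_triplet A N.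
Hypothesis Y_exponent : has_exponent Y A N b.
Hypothesis h0 : concentration A N r @[r --> 0^'+] --> +oo.
Implicit Types (x y z : 'cV[R]_n) (r s t : R) (T : \bar R).
Local Open Scope complex_scope.

Local Notation psi := (RePsi A N b).
Local Notation h := (concentration A N).
Local Notation hinv := (concentration_inv A N).

Lemma Re_cexp (w : R[i]) : complex.Re (cexp w) = expR (complex.Re w) * cos (complex.Im w).
Proof. by rewrite /cexp /= mul0r subr0. Qed.

Lemma Im_cexp (w : R[i]) : complex.Im (cexp w) = expR (complex.Re w) * sin (complex.Im w).
Proof. by rewrite /cexp /= mul0r addr0. Qed.

Lemma Re_i_mul (a : R) : complex.Re ('i * a%:C) = 0.
Proof. by rewrite /= mul0r mulr0 subrr. Qed.

Lemma Im_i_mul (a : R) : complex.Im ('i * a%:C) = a.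
Proof. by rewrite /= mul0r mul1r add0r. Qed.

Lemma Re_exponent t z : complex.Re (- t%:C * Psi A N b z) = - t * psi z.
Proof. by rewrite /RePsi; case: (Psi A N b z) => u v /=; rewrite oppr0 mul0r subr0. Qed.

Lemma Re_charc t z : 0 <= t ->
  charc P (Y t) 0 0 z = complex.Re (cexp (- t%:C * Psi A N b z)).
Proof.
move=> t0; rewrite -Y_exponent// /cintegral.
rewrite [RHS](_ : _ = \int[P]_w complex.Re (cexp ('i * (dotp z (Y t w))%:C)))//.
apply: eq_Rintegral => w _.
by rewrite Re_cexp Re_i_mul Im_i_mul expR0 mul1r subr0 addr0 dotpC.
Qed.

Lemma Im_charc t z : 0 <= t ->
  charc P (Y t) (- (pi / 2)) 0 z = complex.Im (cexp (- t%:C * Psi A N b z)).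
Proof.
move=> t0; rewrite -Y_exponent// /cintegral.
rewrite [RHS](_ : _ = \int[P]_w complex.Im (cexp ('i * (dotp z (Y t w))%:C)))//.
apply: eq_Rintegral => w _.
by rewrite Im_cexp Re_i_mul Im_i_mul expR0 mul1r subr0 cosBpihalf dotpC.
Qed.

Lemma charc_sqr_exponent t z : 0 <= t ->
  charc P (Y t) 0 0 z ^+ 2 + charc P (Y t) (- (pi / 2)) 0 z ^+ 2 = expR (- t * psi z) ^+ 2.
Proof.
move=> t0; rewrite Re_charc// Im_charc// Re_cexp Im_cexp Re_exponent.
by rewrite !exprMn -mulrDr cos2Dsin2 mulr1.
Qed.

Lemma integral_exponent_le t M : 0 < t -> 0 <= M ->
  (forall B, measurable B -> P (Y t @^-1` B) <= M%:E * lebesgue_cV B)%E ->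
  (\int[lebesgue_cV]_z (expR (- (2 * t) * psi z))%:E <= (M * (2 * pi) ^+ n)%:E)%E.
Proof.
move=> t0 M0 HM; have mY : measurable_fun setT (Y t) by [].
rewrite (_ : (fun z => _) = (fun z => (charc P (Y t) 0 0 z ^+ 2
    + charc P (Y t) (- (pi / 2)) 0 z ^+ 2)%:E)); last first.
  apply/funext => z; rewrite charc_sqr_exponent ?ltW// -expRM_natl; congr (expR _)%:E.
  by ring.
apply: integral_weight_le => [|z|e e0].
- by apply: measurable_funD; apply: measurable_funX; exact: measurable_charc.
- by rewrite addr_ge0 ?sqr_ge0.
- exact: integral_charc_sqr_weight_le.
Qed.

Lemma C1_C2 : C1 Y A N b -> C2 A N b.
Proof.
move=> [p [Hp [T [c [T0 [c0 H]]]]]].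
pose c' := c * (2 * pi) ^+ n.
have pi2 : 0 < 2 * pi :> R by rewrite mulr_gt0// pi_gt0.
have c'0 : 0 < c' by rewrite mulr_gt0// exprn_gt0.
have E t : 0 < t -> (t%:E < T)%E ->
    (\int[lebesgue_cV]_z (expR (- (2 * t) * psi z))%:E <= (c' * (hinv t^-1) ^- n)%:E)%E.
  move=> t0 tT; have [mp p0 pP _] := Hp _ t0.
  have ti : 0 < t^-1 by rewrite invr_gt0.
  have [r0 _] := concentration_invP ANb h0 ti.
  have M0 : 0 <= c * (hinv t^-1) ^- n by rewrite mulr_ge0 ?invr_ge0 ?exprn_ge0 ?ltW.
  rewrite /c' mulrAC; apply: integral_exponent_le => // B mB.
  rewrite pP//; apply: (@le_trans _ _ (\int[lebesgue_cV]_(x in B) (c * (hinv t^-1) ^- n)%:E)%E).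
    apply: ge0_le_integral => //.
    - by move=> x _; rewrite lee_fin.
    - by apply/measurable_EFinP/measurable_funTS.
    - move=> x _; apply: le_trans (H _ t0 tT).
      by apply: ereal_sup_ubound; exists x.
  by rewrite integral_cst.
(* The density bound at time [t / 2] controls the integral at time [t], but in terms of
   [hinv (2 / t)]; doubling returns to [hinv (1 / t)] at the price of [a ^ n]. *)
have [a a2 Ha] := cube_doubling b n0 ANb h0 c'0 (ltr0Sn R 1).
exists T, (c' * a ^+ n); split=> //.
split; first by rewrite mulr_gt0// exprn_gt0//; lra.
move=> t t0 tT; have t20 : 0 < t / 2 by lra.
have t2T : ((t / 2)%:E < T)%E by apply: le_lt_trans tT; rewrite lee_fin; lra.
have E1 : 2 * (t / 2) = t by field.
have E2 : (t / 2)^-1 = 2 * t^-1 by rewrite invfM invrK mulrC.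
have := E _ t20 t2T; rewrite E1 E2 => /le_trans; apply.
have ti : 0 < t^-1 by rewrite invr_gt0.
have ti2 : 0 < 2 * t^-1 by lra.
have [r0 _] := concentration_invP ANb h0 ti.
have [s0 _] := concentration_invP ANb h0 ti2.
rewrite lee_fin -mulrA ler_wpM2l ?(ltW c'0)//.
have a0 : 0 < a by lra.
rewrite -ler_pdivrMl ?exprn_gt0// -invfM -exprMn lef_pV2 ?posrE ?exprn_gt0 ?mulr_gt0//.
rewrite ler_pXn2r ?nnegrE ?mulr_ge0 ?(ltW a0) ?(ltW r0) ?(ltW s0)//.
by apply: Ha => //; exact: E.
Qed.

End C1_C2.

(** * (C2) implies (C1): Fourier inversion *)

Section box.
Context {R : realType} {n : nat}.
Implicit Types (a b : 'I_n -> R) (x y : 'cV[R]_n).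

(** At [c = 0] the sequence is constantly 0, in accordance with [Num.sg 0 = 0]; this produces the
    halves on the faces of boxes. *)
Lemma atan_cvg_sg (c : R) :
  atan (c / k.+1%:R^-1) @[k --> \oo] --> pi / 2 * Num.sg c.
Proof.
have pos (u : R) : 0 < u -> atan (u / k.+1%:R^-1) @[k --> \oo] --> pi / 2.
  move=> u0; apply: (@cvg_comp _ _ _ (fun k => u / k.+1%:R^-1) (@atan R) _ (pinfty_nbhs R)).
    apply/cvgryPge => M; under eq_near do rewrite invrK. exists (Num.truncn (M / u)) => // k /= Mk.
    rewrite -ler_pdivrMl// mulrC (le_trans (ltW (truncnS_gt _)))// ler_nat ltnS//.
  exact: cvgy_atan.
have [c0|c0|->] := ltgtP c 0.
- rewrite (ltr0_sg c0) mulrN1.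
  under eq_fun do rewrite -[c in atan (c / _)]opprK mulNr atanN.
  by apply: cvgN; apply: pos; rewrite oppr_gt0.
- by rewrite (gtr0_sg c0) mulr1; exact: pos.
- rewrite sgr0 mulr0; under eq_fun do rewrite mul0r atan0.
  exact: cvg_cst.
Qed.

Definition closed_box a b := [set x : 'cV[R]_n | forall i, `[a i, b i]%classic (x i 0)].

Definition open_box a b := [set x : 'cV[R]_n | forall i, `]a i, b i[%classic (x i 0)].

Lemma measurable_closed_box a b : measurable (closed_box a b).
Proof.
by apply: (@measurable_box _ _ (fun i => `[a i, b i]%classic)) => i; exact: measurable_itv.
Qed.

Lemma measurable_open_box a b : measurable (open_box a b).
Proof.
by apply: (@measurable_box _ _ (fun i => `]a i, b i[%classic)) => i; exact: measurable_itv.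
Qed.

Lemma lebesgue_closed_box_lty a b : (lebesgue_cV (closed_box a b) < +oo)%E.
Proof.
rewrite (@lebesgue_cV_box _ _ (fun i => `[a i, b i]%classic)) => [|i]; last exact: measurable_itv.
rewrite -ge0_fin_numE; last by apply: prode_ge0.
apply: (big_ind (fun r : \bar R => r \is a fin_num)) => // [r s|i _]; first exact: fin_numM.
rewrite lebesgue_measure_itv/=.
by case: ifP.
Qed.

Lemma indic_closed_box a b x :
  \1_(closed_box a b) x = \prod_i \1_(`[a i, b i]%classic) (x i 0) :> R.
Proof.
have [xab|xab] := pselect (closed_box a b x).
  rewrite indicE mem_set// big1// => i _; rewrite indicE mem_set//; exact: xab.
rewrite indicE memNset//.
have [i xi] : exists i, ~ `[a i, b i]%classic (x i 0) by exact/existsNP.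
by rewrite (bigD1 i)//= indicE memNset// mul0r.
Qed.

Lemma open_box_sub a b a' b' : (forall i, a' i <= a i) -> (forall i, b i <= b' i) ->
  open_box a b `<=` open_box a' b'.
Proof.
move=> aa bb x xab i; have := xab i; rewrite /= !in_itv/= => /andP[ax xb].
by rewrite (le_lt_trans (aa i) ax) (lt_le_trans xb (bb i)).
Qed.

Lemma closed_box_sub a b a' b' : (forall i, a' i <= a i) -> (forall i, b i <= b' i) ->
  closed_box a b `<=` closed_box a' b'.
Proof.
move=> aa bb x xab i; have := xab i; rewrite /= !in_itv/= => /andP[ax xb].
by rewrite (le_trans (aa i) ax) (le_trans xb (bb i)).
Qed.

Lemma open_box_setI a b a' b' : open_box a b `&` open_box a' b' =
  open_box (fun i => Num.max (a i) (a' i)) (fun i => Num.min (b i) (b' i)).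
Proof.
apply/seteqP; split=> x /=.
  move=> [xab xab'] i; have := xab i; have := xab' i.
  by rewrite /= !in_itv/= gt_max lt_min => /andP[-> ->] /andP[-> ->].
move=> H; split=> i; have := H i; rewrite /= !in_itv/= gt_max lt_min.
  by move=> /andP[/andP[-> _] /andP[-> _]].
by move=> /andP[/andP[_ ->] /andP[_ ->]].
Qed.

Lemma open_box_exhaust (x : 'cV[R]_n) :
  exists k : nat, open_box (fun=> - k%:R) (fun=> k%:R) x.
Proof.
exists (Num.truncn (enorm x)).+1 => i; rewrite /= in_itv/= -ltr_norml.
exact: le_lt_trans (normr_coord_le x i) (truncnS_gt _).
Qed.

Section shrink.
Variables a b : 'I_n -> R.
Hypothesis ab : forall i, a i < b i.

(** The offset 3 keeps each margin at most a third of the side, so that the shrunken box is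
    nondegenerate even for [k = 0]. *)
Definition shrink_lo (k : nat) i : R := a i + (b i - a i) / k.+3%:R.
Definition shrink_hi (k : nat) i : R := b i - (b i - a i) / k.+3%:R.

Lemma shrink_lt k i : shrink_lo k i < shrink_hi k i.
Proof.
have d0 : 0 < (b i - a i) / k.+3%:R by rewrite divr_gt0 ?subr_gt0 ?ltr0n.
have dE : k.+3%:R * ((b i - a i) / k.+3%:R) = b i - a i by rewrite mulrC divfK.
have : 3 * ((b i - a i) / k.+3%:R) <= k.+3%:R * ((b i - a i) / k.+3%:R).
  by rewrite ler_pM2r// ler_nat.
by rewrite dE /shrink_lo /shrink_hi; move: (_ / _) d0 => u; lra.
Qed.

Lemma shrink_nd k l i : (k <= l)%N ->
  shrink_lo l i <= shrink_lo k i /\ shrink_hi k i <= shrink_hi l i.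
Proof.
move=> kl; rewrite /shrink_lo /shrink_hi lerD2l lerD2l lerN2.
have : (b i - a i) / l.+3%:R <= (b i - a i) / k.+3%:R; last by [].
by rewrite ler_pM2l ?subr_gt0// lef_pV2 ?posrE ?ltr0n// ler_nat !ltnS.
Qed.

Lemma shrink_gt k i : a i < shrink_lo k i /\ shrink_hi k i < b i.
Proof.
have d0 : 0 < (b i - a i) / k.+3%:R by rewrite divr_gt0 ?subr_gt0 ?ltr0n.
by rewrite /shrink_lo /shrink_hi ltrDl gtrBl.
Qed.

Lemma shrink_exhaust x : open_box a b x ->
  exists k, open_box (shrink_lo k) (shrink_hi k) x.
Proof.
move=> xab; suff : \forall k \near \oo, open_box (shrink_lo k) (shrink_hi k) x.
  by move=> [k _ /(_ k (leqnn k))]; exists k.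
apply: filter_forall => i; have := xab i; rewrite /= in_itv/= => /andP[ax xb].
have dk : (b i - a i) / k.+3%:R @[k --> \oo] --> (0 : R).
  rewrite -[X in _ --> X](mulr0 (b i - a i)); apply: cvgMr.
  by have := @cvg_harmonic R; rewrite -(cvg_shiftn 2); under eq_fun do rewrite /harmonic addn2.
have m0 : 0 < Num.min (x i 0 - a i) (b i - x i 0) by rewrite lt_min !subr_gt0 ax.
near=> k; rewrite in_itv/= /shrink_lo /shrink_hi.
suff : (b i - a i) / k.+3%:R < Num.min (x i 0 - a i) (b i - x i 0).
  by rewrite lt_min; move: (_ / _) => u; lra.
near: k; exact: (cvgr_lt 0).
Unshelve. all: by end_near. Qed.

End shrink.

(** The identity, defined on the space with the generated sigma-algebra, is measurable coordinate by
    coordinate: a slab is a countable union of boxes, long in the other directions. *)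
Lemma sigma_algebra_open_box :
  (measurable : set (set 'cV[R]_n)) = <<s range (fun ab => open_box ab.1 ab.2) >>.
Proof.
set G := range _; apply/seteqP; split; last first.
  apply: smallest_sub; first exact: sigma_algebra_measurable.
  by move=> _ [[a b] _ <-]; exact: measurable_open_box.
pose f (x : g_sigma_algebraType G) : 'cV[R]_n := x.
suff mf : measurable_fun setT f by move=> B /(mf measurableT); rewrite setTI.
apply: measurable_fun_coord => i.
apply: (measurability _ (measurable_realfun.RGenOpens.measurableE R)) => //.
move=> _ [_ [p [q ->] <-]]; rewrite setTI.
rewrite (_ : _ @^-1` _ = \bigcup_k open_box (fun j => if j == i then p else - k%:R)
    (fun j => if j == i then q else k%:R)).
  by apply: bigcupT_measurable => k; apply: sub_sigma_algebra; eexists (_, _).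
apply/seteqP; split=> x /=.
  move=> xpq; have [k xk] := open_box_exhaust x; exists k => // j /=.
  by case: eqP => [->//|_]; exact: xk.
by move=> [k _ /(_ i)]; rewrite /= eqxx.
Qed.

(** Limit of the normalised Cauchy mass that the box receives from [y]. When [a < b] it is 1 inside,
    0 off the closed box, with a factor one half for each face through [y]. *)
Definition box_weight a b y : R :=
  \prod_i ((Num.sg (b i - y i 0) - Num.sg (a i - y i 0)) / 2).

Lemma box_weight_open a b y : open_box a b y -> box_weight a b y = 1.
Proof.
move=> yab; rewrite /box_weight big1// => i _.
have := yab i; rewrite /= in_itv/= => /andP[ai bi].
rewrite gtr0_sg ?subr_gt0// ltr0_sg ?subr_lt0//; lra.
Qed.

Lemma box_weight_bounds a b y : (forall i, a i <= b i) ->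
  0 <= box_weight a b y <= \1_(closed_box a b) y.
Proof.
move=> ab; rewrite indic_closed_box.
have H i : 0 <= (Num.sg (b i - y i 0) - Num.sg (a i - y i 0)) / 2 <=
    (\1_(`[a i, b i]%classic) (y i 0) : R).
  have sgB v : Num.sg (v - y i 0) = if y i 0 < v then 1 else if y i 0 == v then 0 else -1.
    have [yv|yv|->] := ltgtP (y i 0) v.
    - by rewrite gtr0_sg ?subr_gt0.
    - by rewrite ltr0_sg ?subr_lt0.
    - by rewrite subrr sgr0.
  rewrite indicE mem_setE in_itv/= !sgB; have := ab i.
  by case: (ltgtP (y i 0) (a i)); case: (ltgtP (y i 0) (b i)) => /=; lra.
rewrite prodr_ge0 => [|i _]; last by have /andP[] := H i.
by apply: ler_prod => i _; exact: H.
Qed.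

Lemma integral_box_prod_cauchy a b y (e : R) : 0 < e -> (forall i, a i < b i) ->
  (\int[lebesgue_cV]_x (\1_(closed_box a b) x * prod_cauchy e (y - x))%:E =
   (\prod_i (2 * atan ((b i - y i 0) / e) - 2 * atan ((a i - y i 0) / e)))%:E)%E.
Proof.
move=> e0 ab.
under eq_integral => x _.
  rewrite indic_closed_box -big_split/=.
  under eq_bigr do rewrite !mxE -cauchy_kernelN opprB.
  over.
apply: (@ge0_integral_cV_prod R n (fun i s => \1_(`[a i, b i]%classic) s * cauchy_kernel e (s - y i 0))).
- move=> i; apply: measurable_funM; first exact: measurable_indic.
  by apply: continuous_measurable_fun; exact: continuous_cauchy_kernel.
- by move=> i s; rewrite mulr_ge0// cauchy_kernel_ge0// ltW.
- move=> i; rewrite -integral_cauchy_kernel_itv// [RHS]integral_mkcond.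
  by apply: eq_integral => s _; rewrite epatch_indic EFinM muleC.
Qed.

End box.

Lemma measure_bigcup_le {R : realType} d (T : measurableType d)
    (mu : {measure set T -> \bar R}) (F : (set T)^nat) (c : \bar R) :
  (forall k, measurable (F k)) -> nondecreasing_seq F ->
  (forall k, mu (F k) <= c)%E -> (mu (\bigcup_k F k) <= c)%E.
Proof.
move=> mF ndF Fc.
have cvF := nondecreasing_cvg_mu (mu := mu) mF (bigcupT_measurable _ mF) ndF.
rewrite -(cvg_lim (@ereal_hausdorff R) cvF); apply: lime_le; last exact: nearW.
exact: cvgP cvF.
Qed.

(** * Fourier inversion for a law whose characteristic function has an integrable majorant *)

Section inversion.
Context {R : realType} {n : nat} d (Omega : measurableType d).
Variables (P : probability Omega R) (X : Omega -> 'cV[R]_n).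
Hypothesis mX : measurable_fun setT X.
Variable g : 'cV[R]_n -> R.
Hypothesis ig : (@lebesgue_cV R n).-integrable setT (EFin \o g).
Hypothesis charc_le : forall c x z, `|charc P X c x z| <= g z.
Implicit Types (x z : 'cV[R]_n) (c e : R).

Local Notation leb := (@lebesgue_cV R n).
Local Notation eps k := (k.+1%:R^-1 : R).

Let eps_gt0 k : 0 < eps k.
Proof. by rewrite invr_gt0. Qed.

Let mprod e x : 0 < e -> measurable_fun setT (fun w => prod_cauchy e (X w - x)).
Proof.
move=> e0.
exact: (measurableT_comp (@measurable_prod_cauchy R n e e0) (measurable_subr_cst mX x)).
Qed.

Let iprod e x : 0 < e -> P.-integrable setT (EFin \o (fun w => prod_cauchy e (X w - x))).
Proof.
move=> e0; apply: (@bounded_integrable _ _ _ P _ ((2 / e) ^+ n)) => [|w].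
  exact: mprod.
by rewrite ger0_norm ?prod_cauchy_le// prod_cauchy_ge0.
Qed.

Lemma integrable_laplace_weight e : 0 < e ->
  leb.-integrable setT (EFin \o @laplace_weight R n e).
Proof.
move=> e0; have mw := @measurable_laplace_weight R n e.
apply/integrableP; split; first exact/measurable_EFinP.
under eq_integral do rewrite /= ger0_norm ?laplace_weight_ge0//.
by rewrite integral_laplace_weight// ltry.
Qed.

Lemma integrable_charc_mul_weight c x e : 0 < e ->
  leb.-integrable setT (EFin \o (fun z => charc P X c x z * laplace_weight e z)).
Proof.
move=> e0; apply: le_integrable (integrable_laplace_weight e0) => //.
  apply/measurable_EFinP/measurable_funM; first exact: measurable_charc.
  exact: measurable_laplace_weight.
move=> z _; rewrite lee_fin normrM ler_piMl// ler_norml; exact: charc_bounds.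
Qed.

(** Both terms are integrable against the weight, so the auxiliary 1 of [integral_charc_weight] can
    be subtracted. *)
Lemma integral_charc_mul_weight c x e : 0 < e ->
  (\int[leb]_z (charc P X c x z * laplace_weight e z)%:E =
   (cos c * \int[P]_w prod_cauchy e (X w - x))%:E)%E.
Proof.
move=> e0; have := integral_charc_weight P mX c x e0.
have icw := integrable_charc_mul_weight c x e0.
have iw := integrable_laplace_weight e0.
under eq_integral do rewrite mulrDl mul1r EFinD.
rewrite integralD// integral_laplace_weight//.
by rewrite -(fineK (integrable_fin_num measurableT icw)) -EFinD => -[/addrI ->].
Qed.

Lemma cvg_integral_charc_mul_weight c x :
  (\int[leb]_z (charc P X c x z * laplace_weight (eps k) z)%:E)%E @[k --> \oo] -->
  (\int[leb]_z (charc P X c x z)%:E)%E.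
Proof.
apply: (@dominated_cvg _ _ _ leb _ measurableT _ _ (EFin \o g)) => //.
- move=> k; apply/measurable_EFinP/measurable_funM; first exact: measurable_charc.
  exact: measurable_laplace_weight.
- move=> z _; apply: cvg_EFin; first exact: nearW.
  rewrite -[X in _ --> X]mulr1; apply: cvgMr; exact: laplace_weight_cvg.
- move=> k z _; rewrite /= lee_fin normrM (le_trans _ (charc_le c x z))//.
  rewrite ler_piMr// ger0_norm ?laplace_weight_ge0//.
  by apply: prodr_ile1 => i; rewrite expR_ge0/= -expR0 ler_expR oppr_le0 mulr_ge0.
Qed.

(** Every regularisation carries the factor [cos c], zero at this phase; hence the inverse Fourier
    integral is real. *)
Lemma integral_charc_sin x : (\int[leb]_z (charc P X (- (pi / 2)) x z)%:E = 0)%E.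
Proof.
apply: (cvg_unique (@ereal_hausdorff R) (@cvg_integral_charc_mul_weight (- (pi / 2)) x)).
rewrite (_ : (fun k => _) = cst 0%E); first exact: cvg_cst.
by apply/funext => k; rewrite integral_charc_mul_weight// cosN cos_pihalf mul0r.
Qed.

Lemma integrable_charc_cV c x : leb.-integrable setT (EFin \o charc P X c x).
Proof.
apply: le_integrable ig => //; first by apply/measurable_EFinP; exact: measurable_charc.
by move=> z _; rewrite /= lee_fin (le_trans (charc_le c x z))// ler_norm.
Qed.

Definition inversion_density x : R := (2 * pi) ^- n * \int[leb]_z charc P X 0 x z.

(** Density of the law of [X] convolved with independent Cauchy variables of width [e]. Its
    positivity passes to the limit [inversion_density]. *)
Definition smoothed_density e x : R := (2 * pi) ^- n * \int[P]_w prod_cauchy e (X w - x).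

Let pi2 : 0 < (2 * pi) ^- n :> R.
Proof. by rewrite invr_gt0 exprn_gt0// mulr_gt0// pi_gt0. Qed.

Lemma smoothed_density_ge0 e x : 0 < e -> 0 <= smoothed_density e x.
Proof.
move=> e0; rewrite mulr_ge0 ?(ltW pi2)//; apply: Rintegral_ge0 => w _.
exact: prod_cauchy_ge0.
Qed.

Lemma smoothed_density_cvg x : smoothed_density (eps k) x @[k --> \oo] --> inversion_density x.
Proof.
apply: cvgMr; have ic := integrable_charc_cV 0 x.
have := @cvg_integral_charc_mul_weight 0 x.
under eq_fun do rewrite integral_charc_mul_weight// cos0 mul1r.
rewrite -[X in _ --> X -> _]fineK ?(integrable_fin_num _ ic)//.
by move/fine_cvg.
Qed.

Lemma inversion_density_ge0 x : 0 <= inversion_density x.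
Proof.
rewrite -(cvg_lim (@Rhausdorff R) (@smoothed_density_cvg x)).
apply: (limr_ge (cvgP _ (@smoothed_density_cvg x))).
by apply: nearW => k; exact: smoothed_density_ge0.
Qed.

Lemma smoothed_density_le e x : 0 < e ->
  smoothed_density e x <= (2 * pi) ^- n * \int[leb]_z g z.
Proof.
move=> e0; rewrite ler_wpM2l ?(ltW pi2)//.
have := integral_charc_mul_weight 0 x e0; rewrite cos0 mul1r => E.
rewrite -[leLHS]/(fine (_%:E)) -E; apply: le_Rintegral => //.
  exact: integrable_charc_mul_weight.
move=> z _; apply: le_trans (charc_le 0 x z).
apply: le_trans (ler_norm _) _; rewrite normrM ler_piMr// ger0_norm ?laplace_weight_ge0//.
by apply: prodr_ile1 => i; rewrite expR_ge0/= -expR0 ler_expR oppr_le0 mulr_ge0// ltW.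
Qed.

Lemma measurable_prod_cauchy_sub e : 0 < e ->
  measurable_fun setT (fun p : Omega * 'cV[R]_n => (prod_cauchy e (X p.1 - p.2))%:E).
Proof.
move=> e0; apply/measurable_EFinP/(measurableT_comp (@measurable_prod_cauchy R n e e0)).
apply: measurable_fun_coord => i; under eq_fun do rewrite !mxE.
apply: measurable_funB; last exact: (measurableT_comp (measurable_coord i) measurable_snd).
exact: (measurableT_comp (measurable_coord i) (measurableT_comp mX measurable_fst)).
Qed.

Lemma smoothed_densityE e x : 0 < e -> ((smoothed_density e x)%:E =
  ((2 * pi) ^- n)%:E * \int[P]_w (prod_cauchy e (X w - x))%:E)%E.
Proof. by move=> e0; rewrite EFinM fineK// (integrable_fin_num _ (iprod x e0)). Qed.

Lemma measurable_smoothed_density e : 0 < e -> measurable_fun setT (smoothed_density e).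
Proof.
move=> e0; apply/measurable_EFinP.
rewrite (_ : _ \o _ = fun x => ((2 * pi) ^- n)%:E *
    fubini_G P (fun p : Omega * 'cV[R]_n => (prod_cauchy e (X p.1 - p.2))%:E) x)%E.
  apply: measurable_funeM; apply: measurable_fun_fubini_tonelli_G.
  - exact: measurable_prod_cauchy_sub.
  - by move=> p; rewrite lee_fin prod_cauchy_ge0.
by apply/funext => x; rewrite /= smoothed_densityE.
Qed.

Lemma measurable_inversion_density : measurable_fun setT inversion_density.
Proof.
apply: (@measurable_fun_cvg _ _ _ _ (fun k => smoothed_density (eps k))) => [k|x _].
  exact: measurable_smoothed_density.
exact: smoothed_density_cvg.
Qed.

Lemma inversion_density_le x : inversion_density x <= (2 * pi) ^- n * \int[leb]_z g z.
Proof.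
rewrite ler_wpM2l ?(ltW pi2)//; apply: le_Rintegral => // [|z _].
  exact: integrable_charc_cV.
exact: le_trans (ler_norm _) (charc_le 0 x z).
Qed.

Lemma integral_box_smoothed a b e : 0 < e -> (forall i, a i < b i) ->
  (\int[leb]_x (\1_(closed_box a b) x * smoothed_density e x)%:E =
   \int[P]_w (\prod_i ((atan ((b i - X w i 0) / e) - atan ((a i - X w i 0) / e)) / pi))%:E)%E.
Proof.
move=> e0 ab.
pose F (p : Omega * 'cV[R]_n) := ((2 * pi) ^- n * (\1_(closed_box a b) p.2 * prod_cauchy e (X p.1 - p.2)))%:E.
have mI : measurable_fun setT (\1_(closed_box a b) : 'cV[R]_n -> R).
  by apply: measurable_indic; exact: measurable_closed_box.
have mF : measurable_fun setT F.
  apply/measurable_EFinP/measurable_funM => //; apply: measurable_funM.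
    exact: (measurableT_comp mI measurable_snd).
  by apply/measurable_EFinP; exact: measurable_prod_cauchy_sub.
have F0 p : (0 <= F p)%E.
  by rewrite lee_fin mulr_ge0 ?(ltW pi2)// mulr_ge0 ?prod_cauchy_ge0.
have := fubini_tonelli (m1 := P) (m2 := leb) F mF F0.
rewrite (_ : (\int[leb]_y _)%E = (\int[leb]_x (\1_(closed_box a b) x * smoothed_density e x)%:E)%E); last first.
  apply: eq_integral => x _; rewrite EFinM smoothed_densityE// muleCA.
  have mp : measurable_fun setT (fun w => (prod_cauchy e (X w - x))%:E).
    by apply/measurable_EFinP; exact: mprod.
  have p0 w : (0 <= (prod_cauchy e (X w - x))%:E)%E by rewrite lee_fin prod_cauchy_ge0.
  rewrite -ge0_integralZl// -ge0_integralZl ?lee_fin ?(ltW pi2)//; first exact: measurable_funeM.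
  by move=> w _; exact: mule_ge0.
move=> <-; apply: eq_integral => w _.
rewrite /F; under eq_integral do rewrite EFinM.
rewrite ge0_integralZl//; first last.
- by rewrite lee_fin (ltW pi2).
- by move=> x _; rewrite lee_fin mulr_ge0 ?prod_cauchy_ge0.
- apply/measurable_EFinP/measurable_funM => //.
  exact: (measurableT_comp (iffLR (measurable_EFinP _ _) (measurable_prod_cauchy_sub e0)) (measurable_pair1 w)).
rewrite /= integral_box_prod_cauchy// -EFinM; congr EFin.
rewrite -[n in _ ^- n]card_ord -exprVn -prodr_const -big_split/=; apply: eq_bigr => i _.
have E (q u v : R) : q != 0 -> (2 * q)^-1 * (2 * u - 2 * v) = (u - v) / q.
  by move=> q0; field.
by rewrite E// gt_eqF// pi_gt0.
Qed.

(** Both sides are limits of one quantity as the width tends to 0: under Lebesgue measure by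
    convergence of the smoothed densities, under [P] by the explicit arctangents. The majorants are
    a constant on the box and the constant 1. *)
Lemma integral_box_inversion a b : (forall i, a i < b i) ->
  (\int[leb]_x (\1_(closed_box a b) x * inversion_density x)%:E =
   \int[P]_w (box_weight a b (X w))%:E)%E.
Proof.
move=> ab.
have mI : measurable_fun setT (\1_(closed_box a b) : 'cV[R]_n -> R).
  by apply: measurable_indic; exact: measurable_closed_box.
pose M := (2 * pi) ^- n * \int[leb]_z g z.
have L : (\int[leb]_x (\1_(closed_box a b) x * smoothed_density (eps k) x)%:E)%E @[k --> \oo]
    --> (\int[leb]_x (\1_(closed_box a b) x * inversion_density x)%:E)%E.
  apply: (@dominated_cvg _ _ _ leb _ measurableT _ _ (fun x => (M * \1_(closed_box a b) x)%:E)) => //.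
  - move=> k; apply/measurable_EFinP/measurable_funM => //; exact: measurable_smoothed_density.
  - move=> x _; apply: cvg_EFin; first exact: nearW.
    apply: cvgMr; exact: smoothed_density_cvg.
  - under eq_fun do rewrite EFinM.
    apply: integrableZl => //; apply/integrableP; split; first exact/measurable_EFinP.
    under eq_integral do rewrite /= ger0_norm//.
    by rewrite integral_indic ?setIT; [exact: lebesgue_closed_box_lty|by []|exact: measurable_closed_box].
  - move=> k x _; rewrite lee_fin normrM mulrC !ger0_norm ?smoothed_density_ge0//.
    by rewrite ler_wpM2r// smoothed_density_le.
have pi0 : pi != 0 :> R by rewrite gt_eqF// pi_gt0.
have L2 : (\int[leb]_x (\1_(closed_box a b) x * smoothed_density (eps k) x)%:E)%E @[k --> \oo]
    --> (\int[P]_w (box_weight a b (X w))%:E)%E.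
  under eq_fun do rewrite integral_box_smoothed//.
  apply: (@dominated_cvg _ _ _ P _ measurableT _ _ (cst 1%E)) => //.
  - move=> k; apply/measurable_EFinP/measurable_prod => i _.
    have mc v : measurable_fun setT (fun w => atan ((v - X w i 0) / eps k)).
      apply: (measurableT_comp (continuous_measurable_fun (@continuous_atan R))).
      apply: measurable_funM => //; apply: measurable_funB => //.
      exact: (measurableT_comp (measurable_coord i) mX).
    by apply: measurable_funM => //; exact: measurable_funB.
  - move=> w _; apply: cvg_EFin; first exact: nearW.
    apply: cvg_big => [|i _]; first exact: mul_continuous.
    have E (q u v : R) : q != 0 -> (u - v) / 2 = (q / 2 * u - q / 2 * v) / q.
      by move=> q0; field.
    by rewrite (E _ _ _ pi0); apply: cvgMl; apply: cvgB; exact: atan_cvg_sg.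
  - exact: (finite_measure_integrable_cst P 1 measurableT).
  - move=> k w _; rewrite lee_fin.
    have H i : 0 <= (atan ((b i - X w i 0) / eps k) - atan ((a i - X w i 0) / eps k)) / pi <= 1.
      have ai := atan_gtNpi2 ((a i - X w i 0) / eps k).
      have bi := atan_ltpi2 ((b i - X w i 0) / eps k).
      rewrite ler_pdivrMr ?pi_gt0// mul1r divr_ge0 ?(ltW (pi_gt0 R))//=; first lra.
      rewrite subr_ge0 le_atan// ler_wpM2r ?(ltW (eps_gt0 k))// lerD2r ltW//.
    rewrite ger0_norm; last by apply: prodr_ge0 => i _; have /andP[] := H i.
    by apply: prodr_ile1 => i _; exact: H.
exact: (cvg_unique (@ereal_hausdorff R) L L2).
Qed.

Definition inversion_measure (B : set 'cV[R]_n) : \bar R :=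
  (\int[leb]_(x in B) (inversion_density x)%:E)%E.

Let inversion_measure0 : inversion_measure set0 = 0%E.
Proof. exact: integral_set0. Qed.

Let inversion_measure_ge0 B : (0 <= inversion_measure B)%E.
Proof. by apply: integral_ge0 => x _; rewrite lee_fin inversion_density_ge0. Qed.

Let inversion_measure_sigma_additive : semi_sigma_additive inversion_measure.
Proof.
apply: semi_sigma_additive_nng_induced => [|x]; last by rewrite lee_fin inversion_density_ge0.
by apply/measurable_EFinP; exact: measurable_inversion_density.
Qed.

HB.instance Definition _ := isMeasure.Build _ _ _ inversion_measure
  inversion_measure0 inversion_measure_ge0 inversion_measure_sigma_additive.

Let muX : {measure set 'cV[R]_n -> \bar R} :=
  measure_function_pushforward__canonical__measure_function_Measure P mX.

Lemma inversion_measure_closed_box a b : (forall i, a i < b i) ->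
  inversion_measure (closed_box a b) = (\int[P]_w (box_weight a b (X w))%:E)%E.
Proof.
move=> ab; rewrite -integral_box_inversion// /inversion_measure integral_mkcond.
by apply: eq_integral => x _; rewrite epatch_indic EFinM muleC.
Qed.

Let mpre B : measurable B -> measurable (X @^-1` B).
Proof. by move=> mB; rewrite -[X in measurable X]setTI; exact: mX. Qed.

Lemma measurable_box_weight a b : measurable_fun setT (fun w => (box_weight a b (X w))%:E).
Proof.
have msg : measurable_fun setT (fun u : R => Num.sg u).
  under eq_fun => u.
    rewrite (_ : Num.sg u = if 0 < u then 1 else if u < 0 then -1 else 0); last first.
      by have [u0|u0|->] := ltgtP u 0; rewrite ?(gtr0_sg u0) ?(ltr0_sg u0) ?sgr0.
    over.
  apply: measurable_fun_ifT => //; first exact: measurable_fun_ltr.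
  by apply: measurable_fun_ifT => //; exact: measurable_fun_ltr.
apply/measurable_EFinP/measurable_prod => i _.
have mc v : measurable_fun setT (fun w => Num.sg (v - X w i 0)).
  apply: (measurableT_comp msg).
  by apply: measurable_funB => //; exact: (measurableT_comp (measurable_coord i) mX).
by apply: measurable_funM => //; exact: measurable_funB.
Qed.

Lemma open_box_le_inversion a b : (forall i, a i < b i) ->
  (muX (open_box a b) <= inversion_measure (closed_box a b))%E.
Proof.
move=> ab; rewrite inversion_measure_closed_box//.
rewrite -[leLHS]/(P (X @^-1` open_box a b)) -[X in P X]setIT -integral_indic//; last first.
  by apply: mpre; exact: measurable_open_box.
have w0 y : 0 <= box_weight a b y by have /andP[] := box_weight_bounds y (fun i => ltW (ab i)).
apply: ge0_le_integral => //.
- by apply/measurable_EFinP/measurable_indic/mpre; exact: measurable_open_box.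
- exact: measurable_box_weight.
- move=> w _; rewrite lee_fin indicE; have [|_//] := boolP (w \in _).
  by rewrite inE => /= wab; rewrite box_weight_open.
Qed.

Lemma inversion_le_closed_box a b : (forall i, a i < b i) ->
  (inversion_measure (closed_box a b) <= muX (closed_box a b))%E.
Proof.
move=> ab; rewrite inversion_measure_closed_box//.
rewrite -[leRHS]/(P (X @^-1` closed_box a b)) -[X in P X]setIT -integral_indic//; last first.
  by apply: mpre; exact: measurable_closed_box.
have wI y := box_weight_bounds y (fun i => ltW (ab i)).
apply: ge0_le_integral => //.
- by move=> w _; rewrite lee_fin; have /andP[] := wI (X w).
- exact: measurable_box_weight.
- by apply/measurable_EFinP/measurable_indic/mpre; exact: measurable_closed_box.
- by move=> w _; rewrite lee_fin; have /andP[_] := wI (X w).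
Qed.

(** The weight only sandwiches: the open box from below, the closed box from above. The shrunken
    closed boxes lie in [open_box a b] and the shrunken open ones already exhaust it, so both
    inequalities reach [open_box a b] in the limit. *)
Lemma inversion_open_box a b : muX (open_box a b) = inversion_measure (open_box a b).
Proof.
have [ab|] := pselect (forall i, a i < b i); last first.
  move=> /existsNP[i /negP abi]; rewrite (_ : open_box a b = set0) ?measure0//.
  rewrite -subset0 => x /(_ i); rewrite /= in_itv/= => /andP[ax xb].
  by move: abi; rewrite (lt_trans ax xb).
have ai k i : a i <= shrink_lo a b k i by have [/ltW] := shrink_gt ab k i.
have bi k i : shrink_hi a b k i <= b i by have [_ /ltW] := shrink_gt ab k i.
have shab k := shrink_lt ab k.
have oc k : closed_box (shrink_lo a b k) (shrink_hi a b k) `<=` open_box a b.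
  move=> x xk i; have := xk i; have [ai' bi'] := shrink_gt ab k i.
  by rewrite /= !in_itv/= => /andP[/(lt_le_trans ai') -> /le_lt_trans ->].
have oo k : open_box (shrink_lo a b k) (shrink_hi a b k) `<=`
    closed_box (shrink_lo a b k) (shrink_hi a b k).
  by move=> x xk i; have := xk i; rewrite /= !in_itv/= => /andP[/ltW -> /ltW ->].
have oE : \bigcup_k open_box (shrink_lo a b k) (shrink_hi a b k) = open_box a b.
  apply/seteqP; split=> x; first by move=> [k _ /oo/oc].
  by move=> /shrink_exhaust[k]; exists k.
have cE : \bigcup_k closed_box (shrink_lo a b k) (shrink_hi a b k) = open_box a b.
  apply/seteqP; split=> x; first by move=> [k _ /oc].
  by move=> /shrink_exhaust[k /oo]; exists k.
apply/eqP; rewrite eq_le; apply/andP; split.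
  rewrite -[in leLHS]oE; apply: measure_bigcup_le => [k|k l kl|k].
  - exact: measurable_open_box.
  - by apply/subsetPset/open_box_sub => i; have [] := shrink_nd ab i kl.
  - apply: (le_trans (open_box_le_inversion (shab k))); apply: le_measure (oc k).
    + by rewrite inE; exact: measurable_closed_box.
    + by rewrite inE; exact: measurable_open_box.
rewrite -[in leLHS]cE; apply: measure_bigcup_le => [k|k l kl|k].
- exact: measurable_closed_box.
- by apply/subsetPset/closed_box_sub => i; have [] := shrink_nd ab i kl.
- apply: (le_trans (inversion_le_closed_box (shab k))); apply: le_measure (oc k).
  + by rewrite inE; exact: measurable_closed_box.
  + by rewrite inE; exact: measurable_open_box.
Qed.

Lemma inversion_densityP B : measurable B ->
  P (X @^-1` B) = (\int[leb]_(x in B) (inversion_density x)%:E)%E.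
Proof.
(* Open boxes are stable under intersection, generate the Borel sets and exhaust the space with
   finite mass, so agreement on them is enough. *)
apply: (@measure_unique _ R _ (range (fun ab => open_box ab.1 ab.2))
  (fun k => open_box (fun=> - k%:R) (fun=> k%:R)) sigma_algebra_open_box _ _ _ muX inversion_measure).
- by move=> _ _ [[a b] _ <-] [[a' b'] _ <-]; rewrite open_box_setI; eexists (_, _).
- by move=> k; eexists (_, _).
- by apply/seteqP; split=> // x _; have [k] := open_box_exhaust x; exists k.
- by move=> _ [[a b] _ <-]; exact: inversion_open_box.
- by move=> k; rewrite (le_lt_trans (probability_le1 P _)) ?ltry//; apply: mpre; exact: measurable_open_box.
Qed.

End inversion.

Section C2_C1.
Context {R : realType} {n : nat} d (Omega : measurableType d).
Variables (P : probability Omega R) (Y : R -> {RV P >-> 'cV[R]_n}).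
Variables (A : 'M[R]_n) (N : {measure set 'cV[R]_n -> \bar R}) (b : 'cV[R]_n).
Hypothesis ANb : generating_triplet A N.
Hypothesis Y_exponent : has_exponent Y A N b.
Implicit Types (x y z : 'cV[R]_n) (r s t : R) (T : \bar R).
Local Open Scope complex_scope.

Local Notation psi := (RePsi A N b).
Local Notation hinv := (concentration_inv A N).
Local Notation leb := (@lebesgue_cV R n).

Lemma normr_charc_le_exponent t c x z : 0 <= t ->
  `|charc P (Y t) c x z| <= expR (- t * psi z).
Proof.
move=> t0; have mY : measurable_fun setT (Y t) by [].
rewrite -ler_sqr ?nnegrE ?expR_ge0// real_normK ?num_real//.
by rewrite -(charc_sqr_exponent Y_exponent)//; exact: charc_sqr_le.
Qed.

Lemma fourier_integrandE t x z : 0 <= t ->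
  cexp (- 'i * (dotp x z)%:C) * cexp (- t%:C * Psi A N b z) =
  charc P (Y t) 0 x z +i* charc P (Y t) (- (pi / 2)) x z.
Proof.
move=> t0; have mY : measurable_fun setT (Y t) by [].
rewrite ![charc _ _ _ x _]charcE// (Re_charc Y_exponent)// (Im_charc Y_exponent)//.
set w := cexp (- t%:C * _); rewrite sub0r cosN sinN -opprD cosN sinN.
rewrite (addrC (pi / 2)) cosDpihalf sinDpihalf.
have -> : cexp (- 'i * (dotp x z)%:C) = cos (dotp x z) +i* - sin (dotp x z).
  apply/eqP; rewrite eq_complex Re_cexp Im_cexp/=.
  by rewrite oppr0 !mul0r mulr0 subr0 add0r expR0 !mul1r mulN1r cosN sinN !eqxx.
by case: w => u v; apply/eqP; rewrite eq_complex/=; apply/andP; split; apply/eqP; ring.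
Qed.

Lemma C2_C1 : C2 A N b -> C1 Y A N b.
Proof.
move=> [T [c [T0 [c0 H]]]].
have pi2 : 0 < (2 * pi) ^- n :> R by rewrite invr_gt0 exprn_gt0// mulr_gt0// pi_gt0.
have ig t : 0 < t -> leb.-integrable setT (EFin \o (fun z => expR (- t * psi z))).
  (* (C2) speaks only of times below [T], but a density is wanted at every time: [exp (- t psi)]
     decreases in [t], so some time [s <= t] below [T] provides the bound. *)
  move=> t0; have [s [s0 st sT]] : exists s, [/\ 0 < s, s <= t & (s%:E < T)%E].
    case: T T0 {H} => [r||]//; rewrite ?lte_fin => r0; last by exists t; rewrite ltry.
    exists (Num.min t (r / 2)); rewrite lt_min t0 ge_min lexx divr_gt0//; split=> //.
    by rewrite lte_fin gt_min; apply/orP; right; lra.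
  have mg u : measurable_fun setT (EFin \o (fun z => expR (- u * psi z))).
    exact: (measurable_expR_RePsi b ANb).
  apply/integrableP; split => //.
  under eq_integral do rewrite /= ger0_norm ?expR_ge0//.
  apply: le_lt_trans (le_lt_trans (H _ s0 sT) (ltry _)); apply: ge0_le_integral => //.
  - exact: (mg t).
  - exact: (mg s).
  - by move=> z _; rewrite lee_fin ler_expR !mulNr lerN2 ler_wpM2r// RePsi_ge0.
have charc_le t (t0 : 0 < t) c' x z := @normr_charc_le_exponent t c' x z (ltW t0).
exists (fun t => inversion_density P (Y t)); split.
  move=> t t0; have mY : measurable_fun setT (Y t) by [].
  split=> [|x|B mB|_ x].
  - exact: (measurable_inversion_density mY (ig t t0) (charc_le t t0)).
  - exact: (inversion_density_ge0 mY (ig t t0) (charc_le t t0)).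
  - exact: (inversion_densityP mY (ig t t0) (charc_le t t0)).
  - rewrite (_ : (fun z => _) = fun z => charc P (Y t) 0 x z +i* charc P (Y t) (- (pi / 2)) x z).
      rewrite /cintegral/= /Rintegral (integral_charc_sin mY (ig t t0) (charc_le t t0)).
      by apply/eqP; rewrite eq_complex/= !mulr0 !mul0r addr0 subr0 !eqxx.
    by apply/funext => z; rewrite fourier_integrandE// ltW.
exists T, ((2 * pi) ^- n * c); split=> //; split; first by rewrite mulr_gt0.
move=> t t0 tT; have mY : measurable_fun setT (Y t) by [].
apply: ge_ereal_sup => _ [x _ <-]; rewrite lee_fin -mulrA.
apply: (le_trans (inversion_density_le mY (ig t t0) (charc_le t t0) x)).
rewrite ler_wpM2l ?(ltW pi2)// -lee_fin fineK; first exact: H.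
exact: integrable_fin_num (ig t t0).
Qed.

End C2_C1.

Theorem lemma3p9 (R : realType) (d : nat) (d_gt0 : (0 < d)%N)
    (disp : measure_display) (Omega : measurableType disp)
    (P : probability Omega R) (Y : R -> {RV P >-> 'cV[R]_d})
    (A : 'M[R]_d) (N : {measure set 'cV[R]_d -> \bar R}) (b : 'cV[R]_d)
    (Y_levy : levy_process Y)
    (ANb : generating_triplet A N)
    (Y_exponent : has_exponent Y A N b)
    (h0 : concentration A N r @[r --> 0^'+] --> +oo) :
  [/\ C1 Y A N b <-> C8 A N,
      C2 A N b <-> C8 A N,
      C3 A N b <-> C8 A N
    & C4 A N b <-> C8 A N].
Proof.
have C8_C2' := C8_C2 b d_gt0 ANb h0; have C2_C8' := @C2_C8 _ _ _ _ b d_gt0 ANb h0.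
split; split.
- by move=> /(C1_C2 d_gt0 ANb Y_exponent h0).
- by move=> /C8_C2'/(C2_C1 ANb Y_exponent).
- exact: C2_C8'.
- exact: C8_C2'.
- exact: C3_C8.
- exact: C8_C3.
- exact: C4_C8.
- exact: C8_C4.
Qed.
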